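(* Let $\alpha\geq -\frac12$. The slice Cholewinski-Fock space $\mathcal{F}^{\alpha}_{Slice}(\mathbb{H})$ is a quaternionic reproducing kernel Hilbert space whose reproducing kernel is given by $$K_\alpha(p,q)=\sum_{n=0}^\infty\frac{p^n\overline{q^n}}{\beta_n(\alpha)}\qquad\text{for all }(p,q)\in\mathbb{H}\times\mathbb{H}.$$
   Context: $\mathbb{H}$ is the skew field of quaternions, $\mathbb{S}=\{q\in\mathbb{H}: q^2=-1\}$, and $\mathbb{C}_I=\mathbb{R}+\mathbb{R}I$ for $I\in\mathbb{S}$. A function $f:\mathbb{H}\to\mathbb{H}$ is entire slice (left) regular if it is real differentiable and, for every $I\in\mathbb{S}$, its restriction $f_I$ to $\mathbb{C}_I$ has continuous partial derivatives and satisfies $\frac12(\partial_x+I\partial_y)f_I(x+yI)=0$; equivalently $f(q)=\sum_{n\ge 0}q^na_n$ with $a_n\in\mathbb{H}$, converging on all of $\mathbb{H}$. Put $f^e(q)=\frac{f(q)+f(-q)}2$, $f^o(q)=\frac{f(q)-f(-q)}2$. Let $\mathrm{Mac}_\alpha(x)=\int_0^\infty e^{-x\cosh t}\cosh(\alpha t)\,dt$ ($x>0$) be the Macdonald function (modified Bessel function of the third kind) and, for $I\in\mathbb{S}$, on $\mathbb{C}_I$ with Lebesgue measure $d\lambda_I$, let $$d\lambda_{\alpha,I}(p)=\frac{|p|^{2\alpha+2}}{\pi 2^\alpha\Gamma(\alpha+1)}\mathrm{Mac}_\alpha(|p|^2)\,d\lambda_I(p).$$ $\mathcal{F}^{\alpha}_{Slice}(\mathbb{H})$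 is the right $\mathbb{H}$-vector space of entire slice regular $f$ such that, for $I\in\mathbb{S}$ (the choice of $I$ is immaterial), $$\int_{\mathbb{C}_I}|f^e_I|^2d\lambda_{\alpha,I}+2(\alpha+1)\int_{\mathbb{C}_I}|f^o_I(p)|^2|p|^{-2}d\lambda_{\alpha+1,I}(p)<\infty,$$ with inner product $$\langle f,g\rangle=\int_{\mathbb{C}_I}\overline{g^e_I}f^e_I\,d\lambda_{\alpha,I}+2(\alpha+1)\int_{\mathbb{C}_I}\overline{g^o_I(p)}f^o_I(p)|p|^{-2}d\lambda_{\alpha+1,I}(p).$$ $\beta_n(\alpha)=2^n\left[\frac n2\right]!\,\frac{\Gamma\left(\left[\frac{n+1}{2}\right]+\alpha+1\right)}{\Gamma(\alpha+1)}$, where $[\cdot]$ is the integer part. A quaternionic reproducing kernel Hilbert space is a right quaternionic Hilbert space of $\mathbb{H}$-valued functions in which all point evaluations $f\mapsto f(q)$ are continuous; its reproducing kernel is the function $K$ such that $K(\cdot,q)$ belongs to the space and $f(q)=\langle f,K(\cdot,q)\rangle$ for all $f$ in the space and all $q$. *)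

(* Defs.v *)
From HB Require Import structures.
From mathcomp Require Import all_boot all_order all_algebra.
From mathcomp Require Import all_classical all_reals all_analysis.
From mathcomp Require Import ring lra.

Set Implicit Arguments.
Unset Strict Implicit.
Unset Printing Implicit Defensive.

Import Order.TTheory GRing.Theory Num.Theory.
Import numFieldNormedType.Exports.

Local Open Scope classical_set_scope.
Local Open Scope ring_scope.

Record quat (R : realType) := Quat { qre : R; qi : R; qj : R; qk : R }.

Section QuatAlgebra.
Context {R : realType}.
Implicit Types (p q : quat R) (a : R).

Definition quat_tuple q := (qre q, qi q, qj q, qk q).
Definition tuple_quat (t : R * R * R * R) := Quat t.1.1.1 t.1.1.2 t.1.2 t.2.
Lemma quat_tupleK : cancel quat_tuple tuple_quat. Proof. by case. Qed.

HB.instance Definition _ := Choice.copy (quat R) (can_type quat_tupleK).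

Definition addq p q :=
  Quat (qre p + qre q) (qi p + qi q) (qj p + qj q) (qk p + qk q).
Definition oppq q := Quat (- qre q) (- qi q) (- qj q) (- qk q).
Definition zeroq : quat R := Quat 0 0 0 0.
Definition oneq : quat R := Quat 1 0 0 0.
Definition mulq p q := Quat
  (qre p * qre q - qi p * qi q - qj p * qj q - qk p * qk q)
  (qre p * qi q + qi p * qre q + qj p * qk q - qk p * qj q)
  (qre p * qj q - qi p * qk q + qj p * qre q + qk p * qi q)
  (qre p * qk q + qi p * qj q - qj p * qi q + qk p * qre q).
Definition scaleq a q := Quat (a * qre q) (a * qi q) (a * qj q) (a * qk q).

Fact addqA : associative addq.
Proof. by move=> [? ? ? ?] [? ? ? ?] [? ? ? ?]; congr Quat => /=; ring. Qed.
Fact addqC : commutative addq.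
Proof. by move=> [? ? ? ?] [? ? ? ?]; congr Quat => /=; ring. Qed.
Fact add0q : left_id zeroq addq.
Proof. by move=> [? ? ? ?]; congr Quat => /=; ring. Qed.
Fact addNq : left_inverse zeroq oppq addq.
Proof. by move=> [? ? ? ?]; congr Quat => /=; ring. Qed.

HB.instance Definition _ :=
  GRing.isZmodule.Build (quat R) addqA addqC add0q addNq.

Fact mulqA : associative mulq.
Proof. by move=> [? ? ? ?] [? ? ? ?] [? ? ? ?]; congr Quat => /=; ring. Qed.
Fact mul1q : left_id oneq mulq.
Proof. by move=> [? ? ? ?]; congr Quat => /=; ring. Qed.
Fact mulq1 : right_id oneq mulq.
Proof. by move=> [? ? ? ?]; congr Quat => /=; ring. Qed.
Fact mulqDl : left_distributive mulq addq.
Proof. by move=> [? ? ? ?] [? ? ? ?] [? ? ? ?]; congr Quat => /=; ring. Qed.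
Fact mulqDr : right_distributive mulq addq.
Proof. by move=> [? ? ? ?] [? ? ? ?] [? ? ? ?]; congr Quat => /=; ring. Qed.
Fact oneq_neq0 : oneq != 0 :> quat R.
Proof. by apply/eqP => -[] /eqP; rewrite oner_eq0. Qed.

HB.instance Definition _ := GRing.Zmodule_isNzRing.Build (quat R)
  mulqA mul1q mulq1 mulqDl mulqDr oneq_neq0.

Fact scaleqA a b q : scaleq a (scaleq b q) = scaleq (a * b) q.
Proof. by case: q => ? ? ? ?; congr Quat => /=; ring. Qed.
Fact scale1q : left_id 1 scaleq.
Proof. by move=> [? ? ? ?]; congr Quat => /=; ring. Qed.
Fact scaleqDr : right_distributive scaleq +%R.
Proof. by move=> ? [? ? ? ?] [? ? ? ?]; congr Quat => /=; ring. Qed.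
Fact scaleqDl q : {morph scaleq^~ q : a b / a + b}.
Proof. by case: q => ? ? ? ? ? ?; congr Quat => /=; ring. Qed.

HB.instance Definition _ := GRing.Zmodule_isLmodule.Build R (quat R)
  scaleqA scale1q scaleqDr scaleqDl.

Fact scaleqAl a p q : a *: (p * q) = a *: p * q.
Proof. by case: p q => ? ? ? ? [? ? ? ?]; congr Quat => /=; ring. Qed.
Fact scaleqAr a p q : a *: (p * q) = p * (a *: q).
Proof. by case: p q => ? ? ? ? [? ? ? ?]; congr Quat => /=; ring. Qed.

HB.instance Definition _ := GRing.Lmodule_isLalgebra.Build R (quat R) scaleqAl.
HB.instance Definition _ := GRing.Lalgebra_isAlgebra.Build R (quat R) scaleqAr.

Definition normq q : R :=
  Num.sqrt (qre q ^+ 2 + qi q ^+ 2 + qj q ^+ 2 + qk q ^+ 2).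

Fact ler_normqD p q : normq (p + q) <= normq p + normq q.
Proof.
case: p q => a b c d [a' b' c' d']; rewrite /normq /=.
set u := a ^+ 2 + _ + _ + _; set v := a' ^+ 2 + _ + _ + _.
have u0 : 0 <= u by rewrite !addr_ge0 ?sqr_ge0.
have v0 : 0 <= v by rewrite !addr_ge0 ?sqr_ge0.
have s0 : 0 <= Num.sqrt u + Num.sqrt v by rewrite addr_ge0 ?sqrtr_ge0.
rewrite -[leRHS](ger0_norm s0) -sqrtr_sqr; apply: ler_wsqrtr.
rewrite [leRHS]sqrrD !sqr_sqrtr// -sqrtrM//.
suff : a * a' + b * b' + c * c' + d * d' <= Num.sqrt (u * v).
  by rewrite /u /v; nra.
apply: (le_trans (ler_norm _)); rewrite -sqrtr_sqr; apply: ler_wsqrtr.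
rewrite -subr_ge0 [leRHS](_ : _ = (a * b' - b * a') ^+ 2
  + (a * c' - c * a') ^+ 2 + (a * d' - d * a') ^+ 2 + (b * c' - c * b') ^+ 2
  + (b * d' - d * b') ^+ 2 + (c * d' - d * c') ^+ 2); last first.
  by rewrite /u /v; ring.
by rewrite !addr_ge0 ?sqr_ge0.
Qed.

Fact normqZ a q : normq (a *: q) = `|a| * normq q.
Proof.
case: q => b c d e; rewrite /normq /= -sqrtr_sqr -sqrtrM ?sqr_ge0//.
by congr Num.sqrt; ring.
Qed.

Fact normq0_eq0 q : normq q = 0 -> q = 0.
Proof.
case: q => a b c d /eqP; rewrite /normq /= sqrtr_eq0.
rewrite -[_ <= 0]andbT => /andP[h _].
have [ha hb hc hd] :
    [/\ 0 <= a ^+ 2, 0 <= b ^+ 2, 0 <= c ^+ 2 & 0 <= d ^+ 2].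
  by split; exact: sqr_ge0.
by congr Quat; apply/eqP; rewrite -sqrf_eq0 eq_le; apply/andP; split => //; lra.
Qed.

HB.instance Definition _ := Lmodule_isNormed.Build R (quat R)
  ler_normqD normqZ normq0_eq0.

End QuatAlgebra.

Section QuatSlices.
Context {R : realType}.

Definition conjq (q : quat R) := Quat (qre q) (- qi q) (- qj q) (- qk q).

Definition unit_sphere : set (quat R) := [set q | q ^+ 2 = -1].

(* the identification R^2 -> C_I, (x, y) |-> x + y I *)
Definition slice (I : quat R) (z : R * R) : quat R := z.1%:A + z.2 *: I.

End QuatSlices.

Section SliceRegular.
Context {R : realType}.
Implicit Types (f : quat R -> quat R) (I : quat R).

Definition partialx (F : R * R -> quat R) (z : R * R) := 'D_((1, 0) : R * R) F z.
Definition partialy (F : R * R -> quat R) (z : R * R) := 'D_((0, 1) : R * R) F z.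

Definition entire_slice_regular f : Prop :=
  (forall q, differentiable f q) /\
  forall I, unit_sphere I ->
    [/\ forall z, derivable (f \o slice I) z ((1, 0) : R * R),
        forall z, derivable (f \o slice I) z ((0, 1) : R * R),
        continuous (partialx (f \o slice I)),
        continuous (partialy (f \o slice I)) &
        forall z : R * R, 2^-1 *:
          (partialx (f \o slice I) z + I * partialy (f \o slice I) z) = 0].

Definition evenpart f (q : quat R) : quat R := 2^-1 *: (f q + f (- q)).
Definition oddpart f (q : quat R) : quat R := 2^-1 *: (f q - f (- q)).

End SliceRegular.

Section SpecialFunctions.
Context {R : realType}.
Implicit Types (alpha x : R).

Definition cosh x : R := (expR x + expR (- x)) / 2.

Definition Gamma x : R :=
  \int[lebesgue_measure]_(t in `]0, +oo[) (t `^ (x - 1) * expR (- t)).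

(* convergent only for x > 0; at x = 0 the value is a convention, which is
   only ever used on a null set *)
Definition Mac alpha x : R :=
  \int[lebesgue_measure]_(t in `[0, +oo[)
    (expR (- (x * cosh t)) * cosh (alpha * t)).

Definition beta_coef alpha (n : nat) : R :=
  2 ^+ n * (n./2)`!%:R * (Gamma ((n.+1)./2%:R + alpha + 1) / Gamma (alpha + 1)).

End SpecialFunctions.

Section CholewinskiFock.
Context {R : realType}.
Implicit Types (f g : quat R -> quat R) (I : quat R) (alpha : R).

(* Lebesgue measure of C_I, carried to R^2 along [slice I], which is an
   isometry for the Euclidean norm when I is an imaginary unit *)
Definition leb2 := (@lebesgue_measure R \x @lebesgue_measure R)%E.

(* density of lambda_{alpha, I} with respect to lambda_I *)
Definition density alpha (p : quat R) : R :=
  `|p| `^ (2 * alpha + 2) / (pi * 2 `^ alpha * Gamma (alpha + 1))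
  * Mac alpha (`|p| ^+ 2).

Definition int_slice I (F : quat R -> R) : \bar R :=
  (\int[leb2]_z (F (slice I z))%:E)%E.

(* componentwise integral of a quaternion-valued function *)
Definition qint_slice I (F : quat R -> quat R) : quat R :=
  Quat (\int[leb2]_z qre (F (slice I z))) (\int[leb2]_z qi (F (slice I z)))
       (\int[leb2]_z qj (F (slice I z))) (\int[leb2]_z qk (F (slice I z))).

Definition sliceFock alpha I : set (quat R -> quat R) :=
  [set f | entire_slice_regular f /\
    (int_slice I (fun p => `|evenpart f p| ^+ 2 * density alpha p)%R
     + (2 * (alpha + 1))%:E *
       int_slice I (fun p =>
         `|oddpart f p| ^+ 2 * `|p| ^- 2 * density (alpha + 1) p)%R
     < +oo)%E].

(* For f, g in [sliceFock alpha I] all the integrands are integrable, by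
   Cauchy-Schwarz; otherwise the value is a convention. *)
Definition sliceFock_ip alpha I f g : quat R :=
  qint_slice I (fun p =>
    density alpha p *: (conjq (evenpart g p) * evenpart f p))
  + (2 * (alpha + 1)) *: qint_slice I (fun p =>
    (`|p| ^- 2 * density (alpha + 1) p) *:
      (conjq (oddpart g p) * oddpart f p)).

Definition kernel_term alpha (p q : quat R) (n : nat) : quat R :=
  (beta_coef alpha n)^-1 *: (p ^+ n * conjq (q ^+ n)).

Definition fock_kernel alpha (p q : quat R) : quat R :=
  limn (series (kernel_term alpha p q)).

End CholewinskiFock.

Section QuaternionicRKHS.
Context {R : realType}.
Variables (V : set (quat R -> quat R))
  (ip : (quat R -> quat R) -> (quat R -> quat R) -> quat R).
Implicit Types (f g h : quat R -> quat R) (a : quat R).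

Definition ip_norm f : R := Num.sqrt (qre (ip f f)).

(* Linear in the first variable for the right action; the rule
   <f, g a> = conj(a) <f, g> and the reality of <f, f> follow from [ip_conj]. *)
Record right_qhilbert : Prop := RightQHilbert {
  qh_zero : V (fun=> 0) ;
  qh_add : forall f g, V f -> V g -> V (f \+ g) ;
  qh_scale : forall f a, V f -> V (fun q => f q * a) ;
  ip_add : forall f g h, V f -> V g -> V h -> ip (f \+ g) h = ip f h + ip g h ;
  ip_scale : forall f g a, V f -> V g -> ip (fun q => f q * a) g = ip f g * a ;
  ip_conj : forall f g, V f -> V g -> conjq (ip f g) = ip g f ;
  ip_ge0 : forall f, V f -> 0 <= qre (ip f f) ;
  ip_eq0 : forall f, V f -> ip f f = 0 -> forall q, f q = 0 ;
  qh_complete : forall u : nat -> quat R -> quat R, (forall n, V (u n)) ->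
    (forall e : R, 0 < e -> exists N, forall m n, (N <= m)%N -> (N <= n)%N ->
      ip_norm (u m \- u n) < e) ->
    exists2 f, V f & (fun n => ip_norm (u n \- f)) @ \oo --> (0 : R) }.

Definition continuous_evaluations : Prop :=
  forall (q : quat R) f, V f -> forall e : R, 0 < e ->
    exists2 d : R, 0 < d &
      forall g, V g -> ip_norm (g \- f) < d -> `|g q - f q| < e.

Definition quaternionic_rkhs : Prop :=
  right_qhilbert /\ continuous_evaluations.

Definition reproducing_kernel (K : quat R -> quat R -> quat R) : Prop :=
  forall q, V (K ^~ q) /\ forall f, V f -> f q = ip f (K ^~ q).

End QuaternionicRKHS.

(* Main.v *)
(** An entire slice regular function is a power series [f(q) = sum q^n a_n]: on
    a slice the Cauchy-Riemann equations give the Cauchy formula, obtained by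
    integrating the derivative of [F (z + s (w - z))] over [0 <= s <= 1] and
    over the circle of the points [w], and expanding the Cauchy kernel in a
    geometric series; the coefficients do not depend on the slice because they
    are determined by the values on the real axis.

    The even and odd parts of [f] are [e(q^2)] and [q o(q^2)] with power series
    [e] and [o], so in polar coordinates Parseval on circles reduces both norm
    integrals to the radial moments of the density.  These are Mellin transforms
    of the Macdonald function, that is double exponential integrals in which a
    change of variables separates the two factors [Gamma].  The norm of [f] is
    therefore the weighted l2 norm [sum beta_n |a_n|^2].  Since
    [beta_n >= n!] for [alpha >= -1/2], this weighted l2 space consists of
    entire power series, point evaluations are bounded, and completeness and
    the reproducing formula are read off the coefficients. *)

Require Import Defs.
From HB Require Import structures.
From mathcomp Require Import all_boot all_order all_algebra.
From mathcomp Require Import all_classical all_reals all_analysis.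
From mathcomp Require Import measurable_realfun.
From mathcomp Require Import ring lra.
Import Order.TTheory GRing.Theory Num.Theory.
Import numFieldNormedType.Exports.
Local Open Scope classical_set_scope.
Local Open Scope ring_scope.

Set Implicit Arguments.
Unset Strict Implicit.
Unset Printing Implicit Defensive.

(** * Quaternions and slices *)

(** Noncommutativity dictates the order of factors: points of one slice commute with each other but
    not with the values of [f], so the Cauchy kernel, the exponentials and the powers of the
    variable stay on the left and the coefficients on the right.

    The double integral behind the Cauchy formula works because, with w on the circle, w F'(z + s (w
    - z)) has two primitives: in s it is the derivative of w / (w - z) F, and in the angle it is the
    derivative of - (J / s) F. The second primitive is periodic, so the integral over the circle
    vanishes for every s, and exchanging the integrals gives the formula.

    Only norms are computed by integration; the full inner product follows by polarization and right
    linearity.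

    Integrals of nonnegative functions stay in the extended reals as long as possible, since Tonelli
    and monotone convergence apply there before finiteness is known. Finiteness of [Gamma] is proved
    afterwards, and the Macdonald integral is finite almost everywhere because its Mellin transform
    is finite. *)

Section QuatBasics.
Context {R : realType}.
Implicit Types (p q a b : quat R).

Lemma quat_eqP p q : [/\ qre p = qre q, qi p = qi q, qj p = qj q & qk p = qk q] ->
  p = q.
Proof. by case: p => ????; case: q => ???? /= [-> -> -> ->]. Qed.

Lemma qreB p q : qre (p - q) = qre p - qre q. Proof. by []. Qed.
Lemma qiB p q : qi (p - q) = qi p - qi q. Proof. by []. Qed.
Lemma qjB p q : qj (p - q) = qj p - qj q. Proof. by []. Qed.
Lemma qkB p q : qk (p - q) = qk p - qk q. Proof. by []. Qed.
Lemma mulqE p q : p * q = Defs.mulq p q. Proof. by []. Qed.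

Lemma qnormE q : `|q| = Num.sqrt (qre q ^+ 2 + qi q ^+ 2 + qj q ^+ 2 + qk q ^+ 2).
Proof. by []. Qed.

Lemma sumsq_ge0 q : 0 <= qre q ^+ 2 + qi q ^+ 2 + qj q ^+ 2 + qk q ^+ 2.
Proof. by rewrite !addr_ge0 ?sqr_ge0. Qed.

Lemma qnorm_sqr q : `|q| ^+ 2 = qre q ^+ 2 + qi q ^+ 2 + qj q ^+ 2 + qk q ^+ 2.
Proof. by rewrite qnormE sqr_sqrtr// sumsq_ge0. Qed.

Lemma qnormM p q : `|p * q| = `|p| * `|q|.
Proof.
rewrite !qnormE -sqrtrM ?sumsq_ge0//; congr Num.sqrt.
by rewrite mulqE /Defs.mulq /=; ring.
Qed.

Lemma qnorm1 : `|1 : quat R| = 1.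
Proof. by rewrite qnormE /= expr1n expr0n /= !addr0 sqrtr1. Qed.

Lemma qnormX q n : `|q ^+ n| = `|q| ^+ n.
Proof. by elim: n => [|n ih]; rewrite ?expr0 ?qnorm1// !exprS qnormM ih. Qed.

Lemma qnorm_conj q : `|conjq q| = `|q|.
Proof. by rewrite !qnormE /= !sqrrN. Qed.

Lemma conjqK : involutive (@conjq R).
Proof. by move=> q; apply: quat_eqP; split; rewrite //= opprK. Qed.

Lemma conjqM p q : conjq (p * q) = conjq q * conjq p.
Proof. by apply: quat_eqP; rewrite !mulqE /Defs.mulq /=; split; ring. Qed.

Lemma conjqD p q : conjq (p + q) = conjq p + conjq q.
Proof. by apply: quat_eqP; split; rewrite //= opprD. Qed.

Lemma conjqZ (c : R) q : conjq (c *: q) = c *: conjq q.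
Proof. by apply: quat_eqP; split; rewrite //= mulrN. Qed.

Lemma conjq1 : conjq 1 = 1 :> quat R.
Proof. by apply: quat_eqP; split; rewrite //= oppr0. Qed.

Lemma mul_conjq q : conjq q * q = (`|q| ^+ 2)%:A.
Proof.
by rewrite qnorm_sqr; apply: quat_eqP; rewrite mulqE /Defs.mulq /=; split; ring.
Qed.

Lemma normr_qre q : `|qre q| <= `|q|.
Proof.
by rewrite -sqrtr_sqr qnormE ler_wsqrtr// -!addrA lerDl !addr_ge0// sqr_ge0.
Qed.

Lemma normr_qi q : `|qi q| <= `|q|.
Proof.
rewrite -sqrtr_sqr qnormE ler_wsqrtr//.
by move: (sqr_ge0 (qre q)) (sqr_ge0 (qj q)) (sqr_ge0 (qk q)); lra.
Qed.

Lemma normr_qj q : `|qj q| <= `|q|.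
Proof.
rewrite -sqrtr_sqr qnormE ler_wsqrtr//.
by move: (sqr_ge0 (qre q)) (sqr_ge0 (qi q)) (sqr_ge0 (qk q)); lra.
Qed.

Lemma normr_qk q : `|qk q| <= `|q|.
Proof.
rewrite -sqrtr_sqr qnormE ler_wsqrtr//.
by move: (sqr_ge0 (qre q)) (sqr_ge0 (qi q)) (sqr_ge0 (qj q)); lra.
Qed.

Lemma qnorm_le_sum q : `|q| <= `|qre q| + `|qi q| + `|qj q| + `|qk q|.
Proof.
have h (x : R) : 0 <= `|x| by [].
rewrite -[leRHS]ger0_norm ?addr_ge0// -sqrtr_sqr qnormE ler_wsqrtr//.
rewrite -(real_normK (num_real (qre q))) -(real_normK (num_real (qi q))).
rewrite -(real_normK (num_real (qj q))) -(real_normK (num_real (qk q))).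
move: (h (qre q)) (h (qi q)) (h (qj q)) (h (qk q)).
move: `|qre q| `|qi q| `|qj q| `|qk q| => x y z t *.
rewrite -subr_ge0 [leRHS](_ : _ =
  2 * (x * y) + 2 * (x * z) + 2 * (x * t) + 2 * (y * z) + 2 * (y * t) + 2 * (z * t)); last by ring.
by rewrite !addr_ge0// mulr_ge0// mulr_ge0.
Qed.

Lemma near_qdist_lt q (e : R) : 0 < e -> \forall p \near q, `|q - p| < e.
Proof. by move=> e0; apply/nbhs_normP; exists e. Qed.

Lemma bounded_comp_continuous (h : quat R -> R) :
  (forall p q, h (p - q) = h p - h q) -> (forall q, `|h q| <= `|q|) ->
  continuous h.
Proof.
move=> hB hle q; apply/(@cvgrPdist_lt _ _ _ (nbhs q)) => e e0; near=> p.
rewrite -hB (le_lt_trans (hle _))//; near: p; exact: near_qdist_lt.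
Unshelve. all: by end_near. Qed.

Lemma qre_continuous : continuous (@qre R).
Proof. by apply: bounded_comp_continuous => //; exact: normr_qre. Qed.
Lemma qi_continuous : continuous (@qi R).
Proof. by apply: bounded_comp_continuous => //; exact: normr_qi. Qed.
Lemma qj_continuous : continuous (@qj R).
Proof. by apply: bounded_comp_continuous => //; exact: normr_qj. Qed.
Lemma qk_continuous : continuous (@qk R).
Proof. by apply: bounded_comp_continuous => //; exact: normr_qk. Qed.

Lemma cvg_quat {T} (F : set_system T) {FF : ProperFilter F} (f : T -> quat R) (l : quat R) :
  (fun t => qre (f t)) @ F --> qre l -> (fun t => qi (f t)) @ F --> qi l ->
  (fun t => qj (f t)) @ F --> qj l -> (fun t => qk (f t)) @ F --> qk l ->
  f @ F --> l.
Proof.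
move=> h1 h2 h3 h4; apply/cvgrPdist_lt => e e0.
have e4 : 0 < e / 4 by rewrite divr_gt0.
near=> t; apply: (le_lt_trans (qnorm_le_sum _)).
have : `|qre (l - f t)| < e / 4 by rewrite qreB; near: t; exact: cvgr_dist_lt.
have : `|qi (l - f t)| < e / 4 by rewrite qiB; near: t; exact: cvgr_dist_lt.
have : `|qj (l - f t)| < e / 4 by rewrite qjB; near: t; exact: cvgr_dist_lt.
have : `|qk (l - f t)| < e / 4 by rewrite qkB; near: t; exact: cvgr_dist_lt.
by lra.
Unshelve. all: by end_near. Qed.

Lemma cvg_comps {T} (F : set_system T) {FF : ProperFilter F} (f : T -> quat R) (l : quat R) :
  f @ F --> l -> [/\ (fun t => qre (f t)) @ F --> qre l, (fun t => qi (f t)) @ F --> qi l,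
  (fun t => qj (f t)) @ F --> qj l & (fun t => qk (f t)) @ F --> qk l].
Proof.
move=> fl; split.
- exact: (cvg_comp _ _ fl (@qre_continuous l)).
- exact: (cvg_comp _ _ fl (@qi_continuous l)).
- exact: (cvg_comp _ _ fl (@qj_continuous l)).
- exact: (cvg_comp _ _ fl (@qk_continuous l)).
Qed.

Lemma cvg_quatM {T} (F : set_system T) {FF : ProperFilter F} (f g : T -> quat R) (a b : quat R) :
  f @ F --> a -> g @ F --> b -> (fun t => f t * g t) @ F --> a * b.
Proof.
move=> /cvg_comps[a1 a2 a3 a4] /cvg_comps[b1 b2 b3 b4].
rewrite -[X in X @ F]/(fun t => Defs.mulq (f t) (g t)) mulqE /Defs.mulq.
by apply: cvg_quat => /=; do ![apply: cvgB|apply: cvgD]; apply: cvgM.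
Qed.

Lemma cvg_conjq {T} (F : set_system T) {FF : ProperFilter F} (f : T -> quat R) (a : quat R) :
  f @ F --> a -> (fun t => conjq (f t)) @ F --> conjq a.
Proof. by move=> /cvg_comps[a1 a2 a3 a4]; apply: cvg_quat => //=; apply: cvgN. Qed.

Lemma quatM_continuous {T : topologicalType} (f g : T -> quat R) :
  continuous f -> continuous g -> continuous (fun t => f t * g t).
Proof. by move=> cf cg t; apply: (@cvg_quatM _ (nbhs t)); [exact: cf|exact: cg]. Qed.

Lemma conjq_continuous {T : topologicalType} (f : T -> quat R) :
  continuous f -> continuous (fun t => conjq (f t)).
Proof. by move=> cf t; apply: (@cvg_conjq _ (nbhs t)); exact: cf. Qed.

(** Each component is additive and bounded by the norm, so absolute convergence is used on four real
    series. *)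
Lemma quat_normed_cvg (u : nat -> quat R) :
  cvgn (series (fun n => `|u n|)) -> cvgn (series u).
Proof.
move=> cu.
have key (h : quat R -> R) : h 0 = 0 -> (forall p q, h (p + q) = h p + h q) ->
    (forall q, `|h q| <= `|q|) -> cvgn (fun n => h (series u n)).
  move=> h0 hD hle.
  rewrite (_ : (fun n => _) = series (fun n => h (u n))); last first.
    by apply/funext => n; rewrite /series /=; exact: (big_morph h hD h0).
  by apply: normed_cvg; apply: series_le_cvg cu => [n|n|n] /=; [exact: normr_ge0|exact: normr_ge0|exact: hle].
apply/cvg_ex; exists (Quat (limn (fun n => qre (series u n)))
  (limn (fun n => qi (series u n))) (limn (fun n => qj (series u n)))
  (limn (fun n => qk (series u n)))).
by apply: cvg_quat; apply: key => //;
  [exact: normr_qre|exact: normr_qi|exact: normr_qj|exact: normr_qk].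
Qed.

Lemma quat_mull_continuous a : continuous (fun q => a * q).
Proof.
move=> q; apply/(@cvgrPdist_lt _ _ _ (nbhs q)) => e e0; near=> p.
rewrite -mulrBr qnormM (@le_lt_trans _ _ ((`|a| + 1) * `|q - p|))//.
  by rewrite ler_wpM2r// lerDl.
have a1 : 0 < `|a| + 1 by rewrite ltr_wpDl.
rewrite mulrC -ltr_pdivlMr//; near: p.
by apply: near_qdist_lt; rewrite divr_gt0.
Unshelve. all: by end_near. Qed.

Lemma quat_mulr_continuous a : continuous (fun q => q * a).
Proof.
move=> q; apply/(@cvgrPdist_lt _ _ _ (nbhs q)) => e e0; near=> p.
rewrite -mulrBl qnormM mulrC (@le_lt_trans _ _ ((`|a| + 1) * `|q - p|))//.
  by rewrite ler_wpM2r// lerDl.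
have a1 : 0 < `|a| + 1 by rewrite ltr_wpDl.
rewrite mulrC -ltr_pdivlMr//; near: p.
by apply: near_qdist_lt; rewrite divr_gt0.
Unshelve. all: by end_near. Qed.

End QuatBasics.

Section Slices.
Context {R : realType}.
Implicit Types (I q : quat R) (z : R * R).

(** The imaginary components of the square are twice the real part times those of [I], so a nonzero
    real part would make [I] real, with square [-1]. *)
Lemma unit_sphereE I : unit_sphere I <->
  qre I = 0 /\ qi I ^+ 2 + qj I ^+ 2 + qk I ^+ 2 = 1.
Proof.
rewrite /unit_sphere /= expr2; split => [|[h0 h1]].
  rewrite mulqE /Defs.mulq => -[].
  case: I => a b c d /=; rewrite !oppr0.
  set h := a * a - _ - _ - _.
  move=> h1 h2 h3 h4.
  have [a0|a0] := eqVneq a 0.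
    by split => //; move: h1; rewrite /h a0; lra.
  have ab (x : R) : a * x + x * a = 0 -> x = 0.
    rewrite [x * a]mulrC -mulr2n => /eqP; rewrite mulrn_eq0 /= mulf_eq0.
    by rewrite (negbTE a0) /= => /eqP.
  have b0 : b = 0 by apply: ab; move: h2; lra.
  have c0 : c = 0 by apply: ab; move: h3; lra.
  have d0 : d = 0 by apply: ab; move: h4; lra.
  move: h1; rewrite /h b0 c0 d0 !mul0r !subr0 => h1.
  by have := sqr_ge0 a; rewrite expr2 h1 oppr_ge0 ler10.
by apply: quat_eqP; rewrite mulqE /Defs.mulq /= h0; split; rewrite ?oppr0; lra.
Qed.

Lemma sliceE I z : unit_sphere I ->
  slice I z = Quat z.1 (z.2 * qi I) (z.2 * qj I) (z.2 * qk I).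
Proof.
move=> /unit_sphereE[I0 _]; rewrite /slice; apply: quat_eqP; split => /=;
  by rewrite ?I0; lra.
Qed.

Lemma slice_normsq I z : unit_sphere I -> `|slice I z| ^+ 2 = z.1 ^+ 2 + z.2 ^+ 2.
Proof.
move=> hI; rewrite sliceE// qnorm_sqr /=.
have [_ h] := (unit_sphereE I).1 hI.
by rewrite !exprMn -!addrA -!mulrDr addrA h mulr1.
Qed.

Lemma slice_norm I z : unit_sphere I -> `|slice I z| = Num.sqrt (z.1 ^+ 2 + z.2 ^+ 2).
Proof. by move=> hI; rewrite -(slice_normsq _ hI) sqrtr_sqr ger0_norm. Qed.

Lemma sliceM I z w : unit_sphere I -> slice I z * slice I w =
  slice I (z.1 * w.1 - z.2 * w.2, z.1 * w.2 + z.2 * w.1).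
Proof.
move=> hI; have II : I * I = -1 by rewrite -expr2.
rewrite /slice /= mulrDl !mulrDr -!scalerAl -!scalerAr !mul1r mulr1 !scalerA II.
rewrite scalerN !scalerBl !scalerDl -!addrA; congr (_ + _).
by rewrite [LHS]addrA [LHS]addrC.
Qed.

Lemma slice_comm I z w : unit_sphere I -> slice I z * slice I w = slice I w * slice I z.
Proof. by move=> hI; rewrite !sliceM//; congr slice; congr pair; ring. Qed.

Lemma sliceD I z w : slice I (z.1 + w.1, z.2 + w.2) = slice I z + slice I w.
Proof. by rewrite /slice /= !scalerDl addrACA. Qed.

Lemma sliceN I z : slice I (- z.1, - z.2) = - slice I z.
Proof. by rewrite /slice /= !scaleNr opprD. Qed.

Lemma slice_real I (x : R) : slice I (x, 0) = x%:A.
Proof. by rewrite /slice /= scale0r addr0. Qed.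

Lemma conj_slice I z : unit_sphere I -> conjq (slice I z) = slice I (z.1, - z.2).
Proof. by move=> hI; rewrite !sliceE//; apply: quat_eqP; split; rewrite //= mulNr. Qed.

Lemma mem_slice q : exists2 J : quat R, unit_sphere J & exists z, q = slice J z.
Proof.
pose n := Num.sqrt (qi q ^+ 2 + qj q ^+ 2 + qk q ^+ 2).
have n2 : n ^+ 2 = qi q ^+ 2 + qj q ^+ 2 + qk q ^+ 2.
  by rewrite sqr_sqrtr// !addr_ge0 ?sqr_ge0.
(* A real [q] lies on every slice, so any unit will do; otherwise the unit is the normalised
   imaginary part. *)
have [n0|n0] := eqVneq n 0.
  have hJ : unit_sphere (Quat 0 1 0 0 : quat R).
    by apply/unit_sphereE; rewrite /=; split => //; lra.
  exists (Quat 0 1 0 0) => //; exists (qre q, 0).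
  move: n2; rewrite n0 expr0n /= => /esym/eqP.
  rewrite !paddr_eq0 ?addr_ge0 ?sqr_ge0// !sqrf_eq0 -andbA => /and3P[/eqP h1 /eqP h2 /eqP h3].
  by rewrite sliceE//; apply: quat_eqP; rewrite /= h1 h2 h3; split; rewrite // ?mul0r.
have hJ : unit_sphere (Quat 0 (qi q / n) (qj q / n) (qk q / n)).
  apply/unit_sphereE; split => //=.
  by rewrite !exprMn -!mulrDl -n2 -exprMn divff// expr1n.
exists (Quat 0 (qi q / n) (qj q / n) (qk q / n)) => //; exists (qre q, n).
by rewrite sliceE//; apply: quat_eqP; split => //=; rewrite mulrCA divff// mulr1.
Qed.

Lemma slice_linear I : linear (slice I : R * R -> quat R).
Proof.
move=> c z w; rewrite /slice /= !scalerDl scalerDr !scalerA -!addrA.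
by congr (_ + _); rewrite [RHS]addrCA.
Qed.

Lemma slice_continuous I : continuous (slice I).
Proof.
move=> z; apply: cvgD; apply: cvgZr_tmp; [exact: cvg_fst|exact: cvg_snd].
Qed.

HB.instance Definition _ I := GRing.isLinear.Build R (R * R)%type (quat R) *:%R
  (slice I) (slice_linear I).

Lemma sphere_sqr I : unit_sphere I -> I * I = -1.
Proof. by rewrite -expr2. Qed.

Lemma sliceI I : slice I (0, 1) = I.
Proof. by rewrite /slice /= scale0r add0r scale1r. Qed.

(** Named so as to carry a linear structure: one-sided multiplications enter derivatives through
    [is_derive_lin]. *)
Definition lmulq (c q : quat R) := c * q.

Fact lmulq_linear c : linear (lmulq c).
Proof. by move=> x p q; rewrite /lmulq mulrDr -scalerAr. Qed.

HB.instance Definition _ c := GRing.isLinear.Build R (quat R) (quat R) *:%R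
  (lmulq c) (lmulq_linear c).

Definition rmulq (c q : quat R) := q * c.

Fact rmulq_linear c : linear (rmulq c).
Proof. by move=> x p q; rewrite /rmulq mulrDl -scalerAl. Qed.

HB.instance Definition _ c := GRing.isLinear.Build R (quat R) (quat R) *:%R
  (rmulq c) (rmulq_linear c).

End Slices.

(** * Entire power series *)

Section Differentiability.
Context {R : realType} {V W : normedModType R}.

(** The bound on [L] gives its continuity and the quadratic remainder is little-o; uniqueness of the
    differential then identifies it with [L]. *)
Lemma differentiable_quadratic (f : V -> W) (L : {linear V -> W}) (x : V) (M C : R) :
  (forall h, `|L h| <= M * `|h|) ->
  (forall h, `|h| <= 1 -> `|f (x + h) - f x - L h| <= C * `|h| ^+ 2) ->
  differentiable f x /\ 'd f x = L :> (V -> W).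
Proof.
move=> LM fC.
have Lc : continuous L.
  move=> y; apply/(@cvgrPdist_lt _ _ _ (nbhs y)) => e e0; near=> z.
  rewrite -linearB (le_lt_trans (LM _))//.
  have M1 : 0 < `|M| + 1 by rewrite ltr_wpDl.
  rewrite (@le_lt_trans _ _ ((`|M| + 1) * `|y - z|))//.
    by rewrite ler_wpM2r// (le_trans (ler_norm _))// lerDl.
  rewrite mulrC -ltr_pdivlMr//; near: z.
  by apply: cvgr_dist_lt => //; rewrite divr_gt0.
have fL : f \o shift x = cst (f x) + L +o_ 0 id.
  apply/eqaddoP => _/posnumP[e]; near=> h => /=.
  rewrite !fctE /= opprD addrA [h + x]addrC.
  have C1 : 0 < `|C| + 1 by rewrite ltr_wpDl.
  have hsmall : `|h| < Num.min 1 (e%:num / (`|C| + 1)).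
    near: h; apply: (@nbhs0_lt _ V).
    by rewrite lt_min ltr01 divr_gt0.
  move: hsmall; rewrite lt_min => /andP[h1 h2].
  rewrite (le_trans (fC _ (ltW h1)))// expr2 mulrA ler_wpM2r//.
  rewrite (@le_trans _ _ ((`|C| + 1) * `|h|))//.
    by rewrite ler_wpM2r// (le_trans (ler_norm _))// lerDl.
  by rewrite mulrC -ler_pdivlMr// ltW.
have dE := diff_unique Lc fL.
by split=> //; apply/diff_locallyP; rewrite dE.
Unshelve. all: by end_near. Qed.

End Differentiability.

Section PowerSeries.
Context {R : realType}.
Implicit Types (q h c : quat R) (a b : nat -> quat R) (r : R).

Definition entire_coef a :=
  forall r, 0 <= r -> cvgn (series (fun n => r ^+ n * `|a n|)).

Definition qseries a q : quat R := limn (series (fun n => q ^+ n * a n)).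

Lemma norm_lim_series_le (u : nat -> quat R) (v : nat -> R) :
  (forall n, `|u n| <= v n) -> cvgn (series v) ->
  cvgn (series u) /\ `|limn (series u)| <= limn (series v).
Proof.
move=> uv cv.
have cnu : cvgn (series (fun n => `|u n|)).
  apply: series_le_cvg cv => // n; exact: le_trans (uv n).
have cu := quat_normed_cvg cnu; split => //.
have cn : (fun n => `|series u n|) @ \oo --> `|limn (series u)|.
  exact: cvg_norm cu.
rewrite -(cvg_lim _ cn)//; apply: ler_lim => //.
  by apply/cvg_ex; eexists; exact: cn.
near=> n; rewrite /series /= (le_trans (ler_norm_sum _ _ _))//.
by rewrite ler_sum// => i _; exact: uv.
Unshelve. all: by end_near. Qed.

Lemma qsum_lim (u : nat -> quat R) s : series u @ \oo --> s -> limn (series u) = s.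
Proof. by move=> us; exact: cvg_lim. Qed.

Lemma qsumD (u v : nat -> quat R) s t : series u @ \oo --> s ->
  series v @ \oo --> t -> series (fun n => u n + v n) @ \oo --> s + t.
Proof.
move=> us vt; rewrite (_ : series _ = series u \+ series v); first exact: cvgD.
by apply/funext => n; rewrite /series /= big_split.
Qed.

Lemma qsumZ (u : nat -> quat R) s r : series u @ \oo --> s ->
  series (fun n => r *: u n) @ \oo --> r *: s.
Proof.
move=> us; rewrite (_ : series _ = r \*: series u); first exact: cvgZl_tmp.
by apply/funext => n; rewrite /series /= scaler_sumr.
Qed.

Lemma qsumB (u v : nat -> quat R) s t : series u @ \oo --> s ->
  series v @ \oo --> t -> series (fun n => u n - v n) @ \oo --> s - t.
Proof.
move=> us vt; rewrite -scaleN1r (_ : (fun n => _) = fun n => u n + (-1) *: v n).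
  exact/qsumD/qsumZ.
by apply/funext => n; rewrite scaleN1r.
Qed.

Lemma qsumMl (u : nat -> quat R) s c : series u @ \oo --> s ->
  series (fun n => c * u n) @ \oo --> c * s.
Proof.
move=> us; rewrite (_ : series _ = (fun x => c * x) \o series u); last first.
  by apply/funext => n; rewrite /series /= mulr_sumr.
exact: (cvg_comp _ _ us (@quat_mull_continuous _ c _)).
Qed.

Lemma qsumMr (u : nat -> quat R) (s : quat R) c : series u @ \oo --> s ->
  series (fun n => u n * c) @ \oo --> s * c.
Proof.
move=> us; rewrite (_ : series _ = (fun x => x * c) \o series u); last first.
  by apply/funext => n; rewrite /series /= mulr_suml.
exact: (cvg_comp _ _ us (@quat_mulr_continuous _ c _)).
Qed.

Lemma qsum_norm_le (u : nat -> quat R) s (v : nat -> R) t :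
  (forall n, `|u n| <= v n) -> series u @ \oo --> s -> series v @ \oo --> t ->
  `|s| <= t.
Proof.
move=> uv us vt; rewrite -(qsum_lim us) -(cvg_lim _ vt)//.
by apply: (norm_lim_series_le uv _).2; apply/cvg_ex; exists t.
Qed.

Lemma rsumZ (v : nat -> R) r : cvgn (series v) ->
  series (fun n => r * v n) @ \oo --> r * limn (series v).
Proof.
move=> cv; rewrite (_ : series _ = (fun n => r * series v n)); first exact: cvgMl_tmp.
by apply/funext => n; rewrite /series /= mulr_sumr.
Qed.

Lemma qseries_cvg a q : entire_coef a ->
  series (fun n => q ^+ n * a n) @ \oo --> qseries a q.
Proof.
move=> ea; apply: (norm_lim_series_le _ (ea `|q| (normr_ge0 q))).1 => n.
by rewrite qnormM qnormX.
Qed.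

Lemma qseriesD a b q : entire_coef a -> entire_coef b ->
  qseries (fun n => a n + b n) q = qseries a q + qseries b q.
Proof.
move=> ea eb; apply: qsum_lim.
under eq_fun do rewrite mulrDr.
by apply: qsumD; exact: qseries_cvg.
Qed.

Lemma qseriesMr a c q : entire_coef a ->
  qseries (fun n => a n * c) q = qseries a q * c.
Proof.
move=> ea; apply: qsum_lim; under eq_fun do rewrite mulrA.
by apply: qsumMr; exact: qseries_cvg.
Qed.

Lemma natr_le_expr2 n : n%:R <= 2 ^+ n :> R.
Proof. by rewrite -natrX ler_nat ltnW// ltn_expl. Qed.

(** The factor [n <= 2 ^+ n] is absorbed by doubling the radius. *)
Lemma entire_natr a : entire_coef a ->
  forall r, 0 <= r -> cvgn (series (fun n => n%:R * (r ^+ n * `|a n|))).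
Proof.
move=> ea r r0; have r2 : 0 <= 2 * r by rewrite mulr_ge0.
apply: series_le_cvg (ea _ r2) => n; rewrite ?mulr_ge0// ?exprn_ge0//.
by rewrite exprMn -mulrA ler_wpM2r ?mulr_ge0 ?exprn_ge0// natr_le_expr2.
Qed.

Lemma entire_natr_coef a : entire_coef a -> entire_coef (fun n => n%:R *: a n).
Proof.
move=> ea r r0; rewrite (_ : (fun n => _) = (fun n => n%:R * (r ^+ n * `|a n|))).
  exact: entire_natr.
by apply/funext => n; rewrite normrZ normr_nat mulrCA.
Qed.

Definition deriv_coef a n : quat R := n.+1%:R *: a n.+1.

Lemma entire_deriv_coef a : entire_coef a -> entire_coef (deriv_coef a).
Proof.
move=> ea.
(* For [1 <= r] the shift of index costs nothing, since [r ^+ n <= r ^+ n.+1]; a smaller radius is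
   first raised to [1]. *)
have h r : 1 <= r -> cvgn (series (fun n => r ^+ n * `|deriv_coef a n|)).
  move=> r1; have r0 : 0 <= r by rewrite (le_trans _ r1).
  have := entire_natr ea r0; rewrite -(@is_cvg_series_restrict 1%N).
  move=> /cvg_ex[/= l]; rewrite -(cvg_shiftS _) => cl.
  have c := cvgP _ cl.
  have {}c : cvgn (series (fun n => n.+1%:R * (r ^+ n.+1 * `|a n.+1|))).
    move: c; rewrite (_ : (fun n => _) = series (fun n => n.+1%:R * (r ^+ n.+1 * `|a n.+1|)))//.
    by apply/funext => n; rewrite /series /= big_add1.
  apply: series_le_cvg c => n; rewrite ?mulr_ge0 ?exprn_ge0//.
  rewrite normrZ normr_nat mulrCA ler_wpM2l// ler_wpM2r//.
  by rewrite exprS ler_peMl// exprn_ge0.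
move=> r r0; have m1 : 1 <= Num.max r 1 by rewrite le_max lexx orbT.
apply: series_le_cvg (h _ m1) => n; rewrite ?mulr_ge0 ?exprn_ge0//.
  by rewrite le_max r0.
by rewrite ler_wpM2r// lerXn2r// ?nnegrE ?le_max ?r0 ?lexx.
Qed.

Lemma qseries_deriv a q : entire_coef a ->
  qseries (deriv_coef a) q = limn (series (fun n => n%:R *: (q ^+ n.-1 * a n))).
Proof.
move=> ea; apply/esym/cvg_lim => //.
rewrite -(cvg_shiftS _).
rewrite (_ : (fun n => _) = series (fun n => q ^+ n * deriv_coef a n)).
  exact: qseries_cvg (entire_deriv_coef ea).
apply/funext => n; rewrite /series /= big_nat_recl//= scale0r add0r.
by apply: eq_bigr => i _; rewrite -scalerAr.
Qed.

(* the derivative of q |-> q ^+ n at q, applied to h *)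
Definition dpow q h n : quat R := \sum_(k < n) q ^+ k * h * q ^+ (n - k.+1).

Lemma dpowS q h n : dpow q h n.+1 = dpow q h n * q + q ^+ n * h.
Proof.
rewrite /dpow big_ord_recr /= subnn expr0 mulr1; congr (_ + _).
rewrite mulr_suml; apply: eq_bigr => i _; rewrite -[RHS]mulrA -exprSr.
by congr (_ * _ ^+ _); rewrite subSn.
Qed.

Lemma dpow_comm q h n : q * h = h * q -> dpow q h n = n%:R *: (q ^+ n.-1 * h).
Proof.
move=> qh; elim: n => [|n ih]; first by rewrite /dpow big_ord0 scale0r.
rewrite dpowS ih -scalerAl -mulrA -qh mulrA -exprSr.
case: n {ih} => [|n] /=; first by rewrite scale0r add0r scale1r.
by rewrite -[X in _ + X]scale1r -scalerDl natr1.
Qed.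

Lemma expr_leS (x r : R) n : 0 <= x -> x <= r -> 1 <= r -> x ^+ n <= r ^+ n.+1.
Proof.
move=> x0 xr r1; have r0 : 0 <= r by exact: le_trans xr.
apply: (@le_trans _ _ (r ^+ n)); first exact: lerXn2r.
by rewrite exprS ler_peMl// exprn_ge0.
Qed.

(** With [1 <= r] the natural exponent [n - 1] may be replaced by [n], which keeps truncated
    subtraction out of the induction. *)
Lemma dpow_norm q h n r : 1 <= r -> `|q| <= r ->
  `|dpow q h n| <= n%:R * (r ^+ n * `|h|).
Proof.
move=> r1 qr; have r0 : 0 <= r by rewrite (le_trans _ r1).
elim: n => [|n ih]; first by rewrite /dpow big_ord0 normr0 mul0r.
rewrite dpowS (le_trans (ler_normD _ _))// -natr1 mulrDl mul1r lerD//.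
  rewrite qnormM exprSr (le_trans (ler_pM _ _ ih qr))//.
  by rewrite -!mulrA [`|h| * r]mulrC.
rewrite qnormM qnormX ler_wpM2r//.
exact: expr_leS.
Qed.

Lemma expr_sub_norm q h n r : 1 <= r -> `|q| + `|h| <= r ->
  `|(q + h) ^+ n - q ^+ n| <= n%:R * (r ^+ n * `|h|).
Proof.
move=> r1 qr; have r0 : 0 <= r by rewrite (le_trans _ r1).
have q1 : `|q| <= r by rewrite (le_trans _ qr)// lerDl.
have q2 : `|q + h| <= r by rewrite (le_trans (ler_normD _ _)).
elim: n => [|n ih]; first by rewrite !expr0 subrr normr0 mul0r.
rewrite (_ : _ - _ = ((q + h) ^+ n - q ^+ n) * q + (q + h) ^+ n * h); last first.
  by rewrite !exprSr mulrDr mulrBl [RHS]addrAC.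
rewrite (le_trans (ler_normD _ _))// -[n.+1%:R]natr1 [leRHS]mulrDl mul1r lerD//.
  rewrite qnormM exprSr (le_trans (ler_pM _ _ ih q1))//.
  by rewrite -!mulrA [`|h| * r]mulrC.
rewrite qnormM qnormX ler_wpM2r//.
exact: expr_leS.
Qed.

(** The remainder for [n.+1] is the one for [n] times [q], plus the increment of the [n]-th power
    times [h]; the constants then follow from [n ^+ 2 + n <= n.+1 ^+ 2]. *)
Lemma expr_sub_dpow_norm q h n r : 1 <= r -> `|q| + `|h| <= r ->
  `|(q + h) ^+ n - q ^+ n - dpow q h n| <= n%:R ^+ 2 * (r ^+ n * `|h| ^+ 2).
Proof.
move=> r1 qr; have r0 : 0 <= r by rewrite (le_trans _ r1).
have q1 : `|q| <= r by rewrite (le_trans _ qr)// lerDl.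
elim: n => [|n ih].
  by rewrite !expr0 subrr /dpow big_ord0 subrr normr0 expr0n mul0r.
rewrite (_ : _ - _ = ((q + h) ^+ n - q ^+ n - dpow q h n) * q +
    ((q + h) ^+ n - q ^+ n) * h); last first.
  by rewrite dpowS !exprSr mulrDr !mulrBl [X in X - _]addrAC opprD addrACA.
rewrite (le_trans (ler_normD _ _))//.
apply: (@le_trans _ _ (n%:R ^+ 2 * (r ^+ n.+1 * `|h| ^+ 2) +
   n%:R * (r ^+ n.+1 * `|h| ^+ 2))).
  apply: lerD; rewrite qnormM.
    rewrite (le_trans (ler_pM _ _ ih q1))//.
    by rewrite le_eqVlt; apply/orP; left; apply/eqP; rewrite [r ^+ n.+1]exprSr; ring.
  rewrite (le_trans (ler_wpM2r _ (expr_sub_norm n r1 qr)))// expr2 -!mulrA.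
  by rewrite ler_wpM2l// ler_wpM2r ?mulr_ge0// exprS ler_peMl// exprn_ge0.
rewrite -mulrDl ler_wpM2r ?mulr_ge0 ?exprn_ge0//.
by rewrite -natr1 sqrrD1 -subr_ge0; have := ler0n R n; lra.
Qed.

(** The termwise differential. In general it is not a power series times [h], because [h] need not
    commute with [q]. *)
Definition dqseries a q h : quat R := limn (series (fun n => dpow q h n * a n)).

Lemma dqseries_cvg a q h : entire_coef a ->
  series (fun n => dpow q h n * a n) @ \oo --> dqseries a q h /\
  `|dqseries a q h| <=
  limn (series (fun n => n%:R * ((`|q| + 1) ^+ n * `|a n|))) * `|h|.
Proof.
move=> ea; have r1 : 1 <= `|q| + 1 by rewrite lerDr.
have r0 : 0 <= `|q| + 1 by rewrite (le_trans _ r1).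
have c := @rsumZ _ `|h| (entire_natr ea r0).
rewrite mulrC -(cvg_lim _ c)//.
apply: norm_lim_series_le; last by apply/cvg_ex; eexists; exact: c.
move=> n /=; rewrite qnormM.
rewrite (le_trans (ler_wpM2r _ (dpow_norm h n r1 _)))//; first by rewrite lerDl.
by rewrite le_eqVlt; apply/orP; left; apply/eqP; ring.
Qed.

Lemma dpow_linear q n : linear (fun h => dpow q h n).
Proof.
move=> c h k; rewrite /dpow scaler_sumr -big_split /=; apply: eq_bigr => i _.
by rewrite mulrDr mulrDl -scalerAr -scalerAl.
Qed.

Lemma dqseries_linear a q : entire_coef a -> linear (dqseries a q).
Proof.
move=> ea c h k; apply: qsum_lim.
under eq_fun do rewrite dpow_linear mulrDl -scalerAl.
apply: qsumD; last exact: (dqseries_cvg q k ea).1.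
exact: qsumZ (dqseries_cvg q h ea).1.
Qed.

Lemma qseries_diff a q : entire_coef a ->
  differentiable (qseries a) q /\ 'd (qseries a) q = dqseries a q :> (_ -> _).
Proof.
move=> ea.
pose L : {linear quat R -> quat R} :=
  HB.pack (dqseries a q) (GRing.isLinear.Build R (quat R) (quat R) *:%R
    (dqseries a q) (dqseries_linear q ea)).
(* The radius |q| + 1 serves all increments of norm at most [1] at once. *)
have r1 : 1 <= `|q| + 1 by rewrite lerDr.
have r0 : 0 <= `|q| + 1 by rewrite (le_trans _ r1).
have c2 : cvgn (series (fun n => n%:R ^+ 2 * ((`|q| + 1) ^+ n * `|a n|))).
  rewrite (_ : (fun n => _) = fun n => n%:R * ((`|q| + 1) ^+ n * `|n%:R *: a n|)).
    exact: entire_natr (entire_natr_coef ea) _ r0.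
  by apply/funext => n; rewrite normrZ normr_nat; ring.
apply: (@differentiable_quadratic _ _ _ _ L _ _
    (limn (series (fun n => n%:R ^+ 2 * ((`|q| + 1) ^+ n * `|a n|))))) => h.
  exact: (dqseries_cvg q h ea).2.
move=> h1; rewrite /L /=.
have dd := (dqseries_cvg q h ea).1.
have c3 := @rsumZ _ (`|h| ^+ 2) c2; rewrite mulrC.
apply: qsum_norm_le (qsumB (qsumB (@qseries_cvg a (q + h) ea) (@qseries_cvg a q ea)) dd) c3 => n.
rewrite -!mulrBl qnormM.
have qr : `|q| + `|h| <= `|q| + 1 by rewrite lerD2l.
rewrite (le_trans (ler_wpM2r _ (expr_sub_dpow_norm n r1 qr)))//.
by rewrite le_eqVlt; apply/orP; left; apply/eqP; ring.
Qed.

Lemma qseries_continuous a : entire_coef a -> continuous (qseries a).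
Proof. by move=> ea q; apply: differentiable_continuous; case: (qseries_diff q ea). Qed.

(** Inside a slice the increment commutes with the variable, so it can be moved to the far left of
    every term of the differential. *)
Lemma qseries_slice_derive a J z v : entire_coef a -> unit_sphere J ->
  derivable (qseries a \o slice J) z v /\
  'D_v (qseries a \o slice J) z = slice J v * qseries (deriv_coef a) (slice J z).
Proof.
move=> ea hJ.
have dS : differentiable (slice J) z.
  by apply: linear_differentiable; exact: slice_continuous.
have [df dE] := qseries_diff (slice J z) ea.
have dc : differentiable (qseries a \o slice J) z by exact: differentiable_comp.
split; first exact: diff_derivable.
rewrite deriveE// diff_comp//= dE.
rewrite (_ : 'd (slice J) z v = slice J v); last first.
  by rewrite diff_lin//; exact: slice_continuous.
apply: qsum_lim; rewrite qseries_deriv//.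
have comm n : dpow (slice J z) (slice J v) n = slice J v * dpow (slice J z) 1 n.
  rewrite !dpow_comm ?mulr1 ?mul1r//; last exact: slice_comm.
  rewrite -scalerAr; congr (_ *: _).
  elim: n.-1 => [|m ih]; first by rewrite expr0 mulr1 mul1r.
  by rewrite exprS -mulrA ih mulrA slice_comm// -!mulrA.
under eq_fun do rewrite comm -mulrA.
apply: qsumMl; rewrite (_ : (fun n => _) = fun n => dpow (slice J z) 1 n * a n).
  exact: (dqseries_cvg _ 1 ea).1.
by apply/funext => n; rewrite dpow_comm ?mulr1 ?mul1r// scalerAl.
Qed.

Lemma qseries_regular a : entire_coef a -> entire_slice_regular (qseries a).
Proof.
move=> ea; split => [q|J hJ]; first by case: (qseries_diff q ea).
have D := fun z v => qseries_slice_derive z v ea hJ.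
have e1 : slice J (1, 0) = 1 by rewrite slice_real scale1r.
have e2 : slice J (0, 1) = J by rewrite /slice /= scale0r add0r scale1r.
have px : partialx (qseries a \o slice J) = qseries (deriv_coef a) \o slice J.
  by apply/funext => z; rewrite /partialx (D _ _).2 e1 mul1r.
have py : partialy (qseries a \o slice J) = (fun q => J * q) \o (qseries (deriv_coef a) \o slice J).
  by apply/funext => z; rewrite /partialy (D _ _).2 e2.
have cd : continuous (qseries (deriv_coef a) \o slice J).
  move=> z; apply: continuous_comp; first exact: slice_continuous.
  exact: qseries_continuous (entire_deriv_coef ea) _.
split.
- by move=> z; case: (D z (1, 0)).
- by move=> z; case: (D z (0, 1)).
- by rewrite px.
- by rewrite py => z; apply: continuous_comp; [exact: cd|exact: quat_mull_continuous].
- move=> z; rewrite px py /= mulrA -expr2 (_ : J ^+ 2 = -1)// mulN1r subrr.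
  by rewrite scaler0.
Qed.

(* Only the smallest nonvanishing coefficient matters as x tends to 0. *)
Lemma real_series_coef_eq0 a (s M : R) : 0 < s ->
  (forall n, `|a n| * s ^+ n <= M) ->
  (forall x : R, 0 < x < s -> series (fun n => x ^+ n *: a n) @ \oo --> (0 : quat R)) ->
  forall n, a n = 0.
Proof.
move=> s0 aM a0; apply: ltn_ind => k ih.
have M0 : 0 <= M by apply: le_trans (aM 0%N); rewrite expr0 mulr1.
have bound x : 0 < x -> x <= s / 2 -> `|a k| <= 2 * M * x / s ^+ k.+1.
  move=> x0 xs; pose t := x / s.
  have t0 : 0 <= t by rewrite divr_ge0// ltW.
  have t2 : t <= 2^-1 by rewrite ler_pdivrMr// mulrC.
  have xk : 0 < x ^+ k by rewrite exprn_gt0.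
  have xs' : 0 < x < s by rewrite x0/= (le_lt_trans xs)// ltr_pdivrMr// ltr_pMr// ltr1n.
  have cn : (fun n => `|series (fun n => x ^+ n *: a n) n|) @ \oo --> `|0 : quat R|.
    exact: cvg_norm (a0 x xs').
  rewrite normr0 in cn.
  suff : x ^+ k * `|a k| <= 2 * M * t ^+ k.+1.
    rewrite mulrC -ler_pdivlMr// => /le_trans; apply.
    rewrite le_eqVlt; apply/orP; left; apply/eqP; rewrite /t exprMn exprVn [x ^+ k.+1]exprSr.
    by field; rewrite !gt_eqF ?exprn_gt0.
  have tk1 : 0 <= t ^+ k.+1 by rewrite exprn_ge0.
  (* Since [t = x / s] is at most 1/2, the majorants [M * t ^+ n] beyond [k] sum to at most twice
     the first of them. *)
  have tail N : `|\sum_(k.+1 <= n < N) x ^+ n *: a n| <= 2 * M * t ^+ k.+1.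
    rewrite (le_trans (ler_norm_sum _ _ _))//.
    apply: (@le_trans _ _ (\sum_(k.+1 <= n < N) M * t ^+ n)).
      apply: ler_sum => n _; rewrite normrZ normrX (gtr0_norm x0).
      rewrite /t exprMn mulrCA exprVn ler_wpM2l ?(exprn_ge0 _ (ltW x0))//.
      by rewrite ler_pdivlMr ?exprn_gt0.
    rewrite -mulr_sumr [leRHS](_ : _ = M * (2 * t ^+ k.+1)); last by ring.
    rewrite ler_wpM2l//.
    have [Nk|kN] := leqP N k.+1; first by rewrite big_geq// mulr_ge0.
    rewrite -{1}(subnKC (ltnW kN)) geometric_partial_tail.
    have t1 : t < 1 by rewrite (le_lt_trans t2)// invf_lt1// ltr1n.
    have tne : t != 1 by rewrite lt_eqF.
    rewrite geometric_seriesE//= -mulrA mulrC ler_wpM2r//.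
    rewrite ler_pdivrMr ?subr_gt0//.
    have := exprn_ge0 (N - k.+1) t0; move: t2; lra.
  suff : `|x ^+ k *: a k| <= 2 * M * t ^+ k.+1 by rewrite normrZ normrX gtr0_norm.
  apply/ler_addgt0Pr => e e0.
  have [N [kN Ne]] : exists N, (k < N)%N /\ `|series (fun n => x ^+ n *: a n) N| < e.
    have /cvgrPdist_lt/(_ _ e0) ev := cn.
    near \oo => N; exists N; split; first by near: N; exact: nbhs_infty_gt.
    rewrite -[X in X < _]normr_id -[X in `|X|]opprK normrN.
    by rewrite -[X in `|X|]sub0r; near: N.
  move: Ne; rewrite /series /= (big_cat_nat (leq0n k) (ltnW kN))/= big1_seq; last first.
    by move=> i /=; rewrite mem_index_iota => /andP[_ ik]; rewrite ih// scaler0.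
  rewrite add0r big_ltn// => Ne.
  rewrite -[X in `|X|](addrK (\sum_(k.+1 <= n < N) x ^+ n *: a n)).
  by rewrite (le_trans (ler_normB _ _))// addrC lerD// ltW.
set c := 2 * M / s ^+ k.+1.
have c0 : 0 <= c by rewrite divr_ge0 ?mulr_ge0// exprn_ge0// ltW.
have c1 : 0 < c + 1 by rewrite ltr_wpDl.
apply/eqP; rewrite -normr_le0; apply/ler_addgt0Pr => e e0; rewrite add0r.
pose x := Num.min (s / 2) (e / (c + 1)).
have x0 : 0 < x by rewrite lt_min !divr_gt0.
have xs : x <= s / 2 by rewrite ge_min lexx.
rewrite (le_trans (bound x x0 xs))// mulrAC -/c.
have : x <= e / (c + 1) by rewrite ge_min lexx orbT.
rewrite ler_pdivlMr// => h; rewrite (le_trans _ h)//.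
by rewrite mulrDr mulr1 mulrC lerDl ltW.
Unshelve. all: by end_near. Qed.

(** Real numbers are central, so on the real axis the difference is a series in powers of a real
    variable with sum zero; convergence at radius [1] bounds its coefficients. *)
Lemma qseries_inj a b : entire_coef a -> entire_coef b ->
  (forall x : R, qseries a x%:A = qseries b x%:A) -> a = b.
Proof.
move=> ea eb ab; apply/funext => n; apply/eqP; rewrite -subr_eq0; apply/eqP.
have rX (x : R) m (c : quat R) : x%:A ^+ m * c = x ^+ m *: c.
  elim: m => [|m ih]; first by rewrite !expr0 mul1r scale1r.
  by rewrite !exprS -mulrA ih mulr_algl scalerA.
have ez : entire_coef (fun n => a n - b n).
  move=> r r0; apply: series_le_cvg (is_cvg_seriesD (ea r r0) (eb r r0)) => m.
  - by rewrite mulr_ge0// exprn_ge0.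
  - by rewrite addr_ge0// mulr_ge0// exprn_ge0.
  - by rewrite !fctE -mulrDr ler_wpM2l ?exprn_ge0// ler_normB.
have [M _ aM] : exists2 M, True & forall m, `|a m - b m| * 1 ^+ m <= M.
  exists (limn (series (fun m => 1 ^+ m * `|a m - b m|))) => // m.
  rewrite mulrC; apply: le_trans (nondecreasing_cvgn_le _ (ez 1 ler01) m.+1).
    by rewrite /series /= big_nat_recr//= lerDr sumr_ge0// => i _; rewrite mulr_ge0// exprn_ge0.
  by apply: nondecreasing_series => i _ _; rewrite mulr_ge0// exprn_ge0.
apply: (@real_series_coef_eq0 (fun m => a m - b m) 1 M ltr01 aM) => x _.
rewrite -(subrr (qseries b x%:A)) -{1}ab.
under eq_fun do rewrite scalerBr -!rX.
by apply: qsumB; exact: qseries_cvg.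
Qed.

End PowerSeries.

(** * Measurability in the plane and Fubini on rectangles *)

Section PlaneMeasurability.
Context {R : realType}.
Local Notation mu := (@lebesgue_measure R).
Local Notation RR := (measurableTypeR R * measurableTypeR R)%type.

(** An open set is the union of the countably many rational squares it contains, and these are
    measurable rectangles. *)
Lemma open2_measurable (O : set (R * R)) : open O -> @measurable _ RR O.
Proof.
move=> oO.
pose B (t : rat * rat * rat) : set (R * R) :=
  ball (ratr t.1.1 : R) (ratr t.2) `*` ball (ratr t.1.2 : R) (ratr t.2).
have -> : O = \bigcup_(t in [set t | B t `<=` O]) B t.
  apply/seteqP; split => [[x y] Oxy|z [t tO]]; last exact: tO.
  have := oO; rewrite openE => /(_ _ Oxy)/nbhs_ballP[_/posnumP[e] eO].
  have /rat_in_itvoo[d] : 0 < e%:num / 2 by [].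
  rewrite in_itv/= => /andP[d0 de].
  have /rat_in_itvoo[a] : x - ratr d < x by rewrite ltrBlDr ltrDl.
  rewrite in_itv/= => /andP[ax xa].
  have /rat_in_itvoo[b] : y - ratr d < y by rewrite ltrBlDr ltrDl.
  rewrite in_itv/= => /andP[bx xb].
  have xaB : ball (ratr a : R) (ratr d) x by rewrite /ball /= ltr0_norm ?subr_lt0//; lra.
  have ybB : ball (ratr b : R) (ratr d) y by rewrite /ball /= ltr0_norm ?subr_lt0//; lra.
  exists (a, b, d) => //= -[u v] [/= ua vb]; apply: eO; split => /=.
    rewrite (splitr e%:num); apply: (@ball_triangle _ _ (ratr a : R)).
      by apply: ball_sym; apply: le_ball xaB; exact: ltW.
    by apply: le_ball ua; exact: ltW.
  rewrite (splitr e%:num); apply: (@ball_triangle _ _ (ratr b : R)).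
    by apply: ball_sym; apply: le_ball ybB; exact: ltW.
  by apply: le_ball vb; exact: ltW.
rewrite bigcup_mkcond; apply: countable_bigcupT_measurable => // t.
by case: ifPn => // _; apply: measurableX; exact: measurable_ball.
Qed.

Lemma continuous2_measurable (g : R * R -> R) : continuous g -> measurable_fun (setT : set RR) g.
Proof.
move=> cg; apply: (measurability _ (measurable_realfun.RGenOInfty.measurableE R)).
move=> /= _ [_ [x ->] <-]; rewrite setTI preimage_itvoy; apply: open2_measurable.
by move/continuousP : cg => /(_ _ (@open_gt R x)).
Qed.

(** Cut off outside the compact rectangle, [g] is bounded and integrable on the plane; the sections
    of the cut-off function are the cut-off sections. *)
Lemma rect_Fubini (g : R * R -> R) (a b c d : R) : continuous g ->
  (\int[mu]_(x in `[a, b]) \int[mu]_(y in `[c, d]) (g (x, y))%:E =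
   \int[mu]_(y in `[c, d]) \int[mu]_(x in `[a, b]) (g (x, y))%:E)%E.
Proof.
move=> cg; pose D : set (R * R) := `[a, b]%classic `*` `[c, d]%classic.
have mD : @measurable _ RR D by exact: measurableX.
have mg := continuous2_measurable cg.
have ig : ((mu \x mu)%E).-integrable (setT : set RR) ((EFin \o g) \_ D).
  apply/(@integrable_mkcond _ RR R _ D (EFin \o g) mD); apply: measurable_bounded_integrable => //.
  - rewrite [ltLHS](product_measure1E mu mu (measurable_itv `[a, b]) (measurable_itv `[c, d])).
    rewrite lte_mul_pinfty//.
      by rewrite ge0_fin_numE//; apply: compact_finite_measure; exact: segment_compact.
    by apply: compact_finite_measure; exact: segment_compact.
  - exact: measurable_funTS.
  - have : bounded_set (g @` D).
      apply: compact_bounded; apply: continuous_compact.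
        exact: continuous_subspaceT.
      by apply: compact_setX; exact: segment_compact.
    move=> [M [Mr MD]]; exists M; split => // x Mx z Dz /=.
    by apply: MD => //; exists z.
have e1 x y : (((EFin \o g) \_ D) (x, y) =
   if x \in `[a, b]%classic then ((fun y => (g (x, y))%:E) \_ `[c, d]%classic) y else 0)%E.
  by rewrite /patch /D in_setX /=; case: (x \in _); case: (y \in _).
have e2 x y : (((EFin \o g) \_ D) (x, y) =
   if y \in `[c, d]%classic then ((fun x => (g (x, y))%:E) \_ `[a, b]%classic) x else 0)%E.
  rewrite e1 /patch.
  by case: (x \in _); case: (y \in _).
have e3 : (\int[mu]_x \int[mu]_y ((EFin \o g) \_ D) (x, y) =
    \int[mu]_(x in `[a, b]) \int[mu]_(y in `[c, d]) (g (x, y))%:E)%E.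
  rewrite [RHS]integral_mkcond; apply: eq_integral => x _.
  under eq_integral do rewrite e1.
  rewrite [RHS]/patch; case: ifPn => _; last by rewrite integral0.
  by rewrite [RHS]integral_mkcond.
have e4 : (\int[mu]_y \int[mu]_x ((EFin \o g) \_ D) (x, y) =
    \int[mu]_(y in `[c, d]) \int[mu]_(x in `[a, b]) (g (x, y))%:E)%E.
  rewrite [RHS]integral_mkcond; apply: eq_integral => y _.
  under eq_integral do rewrite e2.
  rewrite [RHS]/patch; case: ifPn => _; last by rewrite integral0.
  by rewrite [RHS]integral_mkcond.
rewrite -e3 -e4; exact: Fubini ig.
Qed.

Lemma continuous_derive_FTC (f F : R -> R) (a b : R) : a <= b -> continuous f ->
  (forall x : R, is_derive x 1 F (f x)) ->
  (\int[mu]_(x in `[a, b]) (f x)%:E = (F b - F a)%:E)%E.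
Proof.
rewrite le_eqVlt => /predU1P[->|ab] cf dF.
  by rewrite set_itv1 integral_set1 subrr.
rewrite (@continuous_FTC2 _ f F a b)//.
- exact: continuous_subspaceT.
- have cF : continuous F.
    by move=> x; apply/differentiable_continuous/derivable1_diffP; case: (dF x).
  by split=> [x _| |]; [case: (dF x)|apply: cvg_at_right_filter; exact: cF|
    apply: cvg_at_left_filter; exact: cF].
- by move=> x _; rewrite derive1E; case: (dF x).
Qed.

End PlaneMeasurability.

(** * Integrals of quaternion-valued functions *)

Section QuatIntegral.
Context d (T : measurableType d) (R : realType).
Variables (mu : {measure set T -> \bar R}) (D : set T).
Hypothesis mD : measurable D.
Implicit Types (X Y : T -> quat R) (c : quat R).

Definition qintegral X : quat R := Quat (\int[mu]_(z in D) qre (X z)) (\int[mu]_(z in D) qi (X z))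
  (\int[mu]_(z in D) qj (X z)) (\int[mu]_(z in D) qk (X z)).

Definition qintegrable X :=
  [/\ mu.-integrable D (EFin \o (fun z => qre (X z))), mu.-integrable D (EFin \o (fun z => qi (X z))),
      mu.-integrable D (EFin \o (fun z => qj (X z))) & mu.-integrable D (EFin \o (fun z => qk (X z)))].

Lemma qintegralD X Y : qintegrable X -> qintegrable Y ->
  qintegral (fun z => X z + Y z) = qintegral X + qintegral Y.
Proof. by move=> [x1 x2 x3 x4] [y1 y2 y3 y4]; congr Quat; rewrite /= RintegralD. Qed.

Lemma qintegral_conj X : qintegrable X -> conjq (qintegral X) = qintegral (fun z => conjq (X z)).
Proof.
move=> [x1 x2 x3 x4]; have N (g : T -> R) : mu.-integrable D (EFin \o g) ->
    - (\int[mu]_(z in D) g z) = \int[mu]_(z in D) (- g z).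
  move=> ig; rewrite -mulN1r -RintegralZl//; apply: eq_Rintegral => z _; exact: mulN1r.
by congr Quat; rewrite /= N.
Qed.

(** Each component of [X z * c] and of [c * X z] is such a real combination, so this serves all
    eight cases of one-sided linearity. *)
Lemma Rintegral_lin4 X (x1 x2 x3 x4 : R) : qintegrable X ->
  \int[mu]_(z in D) (x1 * qre (X z) + x2 * qi (X z) + x3 * qj (X z) + x4 * qk (X z)) =
  x1 * qre (qintegral X) + x2 * qi (qintegral X) + x3 * qj (qintegral X) + x4 * qk (qintegral X).
Proof.
move=> [h1 h2 h3 h4].
have Z (x : R) g : mu.-integrable D (EFin \o g) -> mu.-integrable D (EFin \o (fun z => x * g z)).
  by move=> ig; apply: (integrableZl mD x ig).
have A g1 g2 : mu.-integrable D (EFin \o g1) -> mu.-integrable D (EFin \o g2) ->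
    mu.-integrable D (EFin \o (fun z => g1 z + g2 z)).
  by move=> i1 i2; apply: (integrableD mD i1 i2).
rewrite RintegralD//; [|exact/A/Z/h3/A/Z/h2/Z/h1|exact: Z].
rewrite RintegralD//; [|exact/A/Z/h2/Z/h1|exact: Z].
rewrite RintegralD//; [|exact: Z|exact: Z].
by rewrite !RintegralZl.
Qed.

Lemma qintegralMr c X : qintegrable X -> qintegral (fun z => X z * c) = qintegral X * c.
Proof.
move=> iX; apply: quat_eqP; split.
- transitivity (\int[mu]_(z in D) (qre c * qre (X z) + (- qi c) * qi (X z) + (- qj c) * qj (X z) + (- qk c) * qk (X z))).
    by apply: eq_Rintegral => z _; rewrite mulqE /Defs.mulq /=; ring.
  by rewrite Rintegral_lin4// mulqE /Defs.mulq /=; ring.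
- transitivity (\int[mu]_(z in D) (qi c * qre (X z) + qre c * qi (X z) + qk c * qj (X z) + (- qj c) * qk (X z))).
    by apply: eq_Rintegral => z _; rewrite mulqE /Defs.mulq /=; ring.
  by rewrite Rintegral_lin4// mulqE /Defs.mulq /=; ring.
- transitivity (\int[mu]_(z in D) (qj c * qre (X z) + (- qk c) * qi (X z) + qre c * qj (X z) + qi c * qk (X z))).
    by apply: eq_Rintegral => z _; rewrite mulqE /Defs.mulq /=; ring.
  by rewrite Rintegral_lin4// mulqE /Defs.mulq /=; ring.
- transitivity (\int[mu]_(z in D) (qk c * qre (X z) + qj c * qi (X z) + (- qi c) * qj (X z) + qre c * qk (X z))).
    by apply: eq_Rintegral => z _; rewrite mulqE /Defs.mulq /=; ring.
  by rewrite Rintegral_lin4// mulqE /Defs.mulq /=; ring.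
Qed.

Lemma qintegralMl c X : qintegrable X -> qintegral (fun z => c * X z) = c * qintegral X.
Proof.
move=> iX; apply: quat_eqP; split.
- transitivity (\int[mu]_(z in D) (qre c * qre (X z) + (- qi c) * qi (X z) + (- qj c) * qj (X z) + (- qk c) * qk (X z))).
    by apply: eq_Rintegral => z _; rewrite mulqE /Defs.mulq /=; ring.
  by rewrite Rintegral_lin4// mulqE /Defs.mulq /=; ring.
- transitivity (\int[mu]_(z in D) (qi c * qre (X z) + qre c * qi (X z) + (- qk c) * qj (X z) + qj c * qk (X z))).
    by apply: eq_Rintegral => z _; rewrite mulqE /Defs.mulq /=; ring.
  by rewrite Rintegral_lin4// mulqE /Defs.mulq /=; ring.
- transitivity (\int[mu]_(z in D) (qj c * qre (X z) + qk c * qi (X z) + qre c * qj (X z) + (- qi c) * qk (X z))).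
    by apply: eq_Rintegral => z _; rewrite mulqE /Defs.mulq /=; ring.
  by rewrite Rintegral_lin4// mulqE /Defs.mulq /=; ring.
- transitivity (\int[mu]_(z in D) (qk c * qre (X z) + (- qj c) * qi (X z) + qi c * qj (X z) + qre c * qk (X z))).
    by apply: eq_Rintegral => z _; rewrite mulqE /Defs.mulq /=; ring.
  by rewrite Rintegral_lin4// mulqE /Defs.mulq /=; ring.
Qed.

End QuatIntegral.

(** * Power series expansion of slice regular functions *)

Section CircleIntegral.
Context {R : realType}.
Local Notation tau := ((2 * pi)%R : R).
Local Notation mu := (@lebesgue_measure R).
Implicit Types (G H : R -> quat R) (g : R -> R) (c J : quat R).

Lemma is_derive_lin (V W X : normedModType R) (h : {linear W -> X}) (f : V -> W) df x v :
  continuous h -> is_derive x v f df -> is_derive x v (h \o f) (h df).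
Proof.
move=> ch [fd fE].
have c : (fun t : R => t^-1 *: ((h \o f) (t *: v + x) - (h \o f) x)) @ 0^' --> h df.
  rewrite (_ : (fun t => _) = h \o (fun t : R => t^-1 *: (f (t *: v + x) - f x))); last first.
    by apply/funext => t /=; rewrite linearZ_LR; congr (_ *: _); rewrite linearB.
  by rewrite -fE; apply: continuous_cvg; [exact: ch|exact: fd].
by split; [apply/cvg_ex; exists (h df)|apply: cvg_lim].
Qed.

Definition cint g : R := \int[mu]_(t in `[0, 2 * pi]) g t.

Definition qcint G : quat R := Quat (cint (fun t => qre (G t)))
  (cint (fun t => qi (G t))) (cint (fun t => qj (G t))) (cint (fun t => qk (G t))).

Lemma circle_integrable g : continuous g -> mu.-integrable `[0, 2 * pi] (EFin \o g).
Proof.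
move=> cg; apply: continuous_compact_integrable; first exact: segment_compact.
exact: continuous_subspaceT.
Qed.

Lemma cint_cst (x : R) : cint (fun=> x) = 2 * pi * x.
Proof.
rewrite /cint Rintegral_cst//= lebesgue_measure_itv/= lte_fin.
by rewrite mulr_gt0 ?pi_gt0//= oppr0 addr0 mulrC.
Qed.

Lemma le_cint g1 g2 : continuous g1 -> continuous g2 ->
  (forall t, 0 <= t <= 2 * pi -> g1 t <= g2 t) -> cint g1 <= cint g2.
Proof.
move=> c1 c2 h; apply: le_Rintegral => //; try exact: circle_integrable.
Qed.

Lemma cint_norm g (M : R) : continuous g ->
  (forall t, 0 <= t <= 2 * pi -> `|g t| <= M) -> `|cint g| <= 2 * pi * M.
Proof.
move=> cg gM; rewrite ler_norml -mulrN -!cint_cst !le_cint//; try exact: cst_continuous.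
  by move=> t /gM; rewrite ler_norml => /andP[].
by move=> t /gM; rewrite ler_norml => /andP[].
Qed.

Lemma comp_qre G : continuous G -> continuous (fun t => qre (G t)).
Proof. by move=> cG t; apply: continuous_comp; [exact: cG|exact: qre_continuous]. Qed.
Lemma comp_qi G : continuous G -> continuous (fun t => qi (G t)).
Proof. by move=> cG t; apply: continuous_comp; [exact: cG|exact: qi_continuous]. Qed.
Lemma comp_qj G : continuous G -> continuous (fun t => qj (G t)).
Proof. by move=> cG t; apply: continuous_comp; [exact: cG|exact: qj_continuous]. Qed.
Lemma comp_qk G : continuous G -> continuous (fun t => qk (G t)).
Proof. by move=> cG t; apply: continuous_comp; [exact: cG|exact: qk_continuous]. Qed.

Lemma qcint_integrable G : continuous G -> qintegrable mu `[0, 2 * pi] G.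
Proof.
by move=> cG; split; apply: circle_integrable; [exact: comp_qre|exact: comp_qi|exact: comp_qj|exact: comp_qk].
Qed.

Lemma qcintE G : qcint G = qintegral mu `[0, 2 * pi] G. Proof. by []. Qed.

Lemma qcintD G H : continuous G -> continuous H ->
  qcint (fun t => G t + H t) = qcint G + qcint H.
Proof. by move=> cG cH; rewrite !qcintE qintegralD//; exact: qcint_integrable. Qed.

Lemma qcintMl c G : continuous G -> qcint (fun t => c * G t) = c * qcint G.
Proof. by move=> cG; rewrite !qcintE qintegralMl//; exact: qcint_integrable. Qed.

Lemma qcintMr c G : continuous G -> qcint (fun t => G t * c) = qcint G * c.
Proof. by move=> cG; rewrite !qcintE qintegralMr//; exact: qcint_integrable. Qed.

Lemma qcint_cst c : qcint (fun=> c) = (2 * pi) *: c.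
Proof. by rewrite /qcint !cint_cst. Qed.

(** The constant is four times [2 * pi * M], one summand for each component; this crude bound
    suffices for the limits below. *)
Lemma qcint_norm G (M : R) : continuous G ->
  (forall t, 0 <= t <= 2 * pi -> `|G t| <= M) -> `|qcint G| <= 8 * pi * M.
Proof.
move=> cG GM; rewrite (le_trans (qnorm_le_sum _))//= [leRHS](_ : _ =
  2 * pi * M + 2 * pi * M + 2 * pi * M + 2 * pi * M); last by ring.
by rewrite !lerD// cint_norm//; do ?[exact: comp_qre|exact: comp_qi|exact: comp_qj|exact: comp_qk];
  move=> t /GM; apply: le_trans;
  [exact: normr_qre|exact: normr_qi|exact: normr_qj|exact: normr_qk].
Qed.

Lemma circle_bounded G : continuous G ->
  exists2 M, 0 <= M & forall t, 0 <= t <= 2 * pi -> `|G t| <= M.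
Proof.
move=> cG; have t0 : 0 <= tau by rewrite mulr_ge0// pi_ge0.
have cn : {within `[0, tau], continuous (fun t => `|G t|)}.
  by apply: continuous_subspaceT => t; apply: cvg_norm; exact: cG.
have [c _ cM] := EVT_max t0 cn.
by exists `|G c| => // t ht; apply: cM; rewrite in_itv.
Qed.

(** The fundamental theorem of calculus and Fubini are applied to real functions; the four
    components are among the linear forms tested. *)
Lemma qcint_eq0 G : (forall h : {linear quat R -> R^o}, continuous h ->
  (\int[mu]_(t in `[0%R, tau]) (h (G t))%:E = 0)%E) -> qcint G = 0.
Proof.
move=> h0; have z (h : quat R -> R) : linear (h : quat R -> R^o) -> continuous h ->
    cint (fun t => h (G t)) = 0.
  move=> hl hc.
  pose h' : {linear quat R -> R^o} :=
    HB.pack (h : quat R -> R^o) (GRing.isLinear.Build R (quat R) R^o *:%R h hl).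
  by rewrite /cint /Rintegral (h0 h').
by congr Quat; apply: z => //; [exact: qre_continuous|exact: qi_continuous|
  exact: qj_continuous|exact: qk_continuous].
Qed.

Lemma qcint_FTC_eq0 (h : {linear quat R -> R^o}) G H : continuous h -> continuous H ->
  (forall t : R, is_derive t 1 G (H t)) -> G (2 * pi) = G 0 ->
  (\int[mu]_(t in `[0%R, tau]) (h (H t))%:E = 0)%E.
Proof.
move=> ch cH dG G0.
have t0 : 0 <= tau by rewrite mulr_ge0// pi_ge0.
have cc : continuous (h \o H).
  by move=> t; apply: continuous_comp; [exact: cH|exact: ch].
have dh (t : R) : is_derive t 1 (h \o G) ((h \o H) t) by exact: is_derive_lin.
by rewrite (@continuous_derive_FTC R (h \o H) (h \o G) _ _ t0 cc dh) /= G0 subrr.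
Qed.

(** The exponential of [t *: J]. *)
Definition circ J (t : R) : quat R := slice J (cos t, sin t).

Lemma circD J s t : unit_sphere J -> circ J (s + t) = circ J s * circ J t.
Proof.
by move=> hJ; rewrite /circ sliceM//= cosD sinD; congr slice; congr pair; ring.
Qed.

Lemma circ0 J : circ J 0 = 1.
Proof. by rewrite /circ cos0 sin0 slice_real scale1r. Qed.

Lemma circ_norm J t : unit_sphere J -> `|circ J t| = 1.
Proof. by move=> hJ; rewrite /circ slice_norm//= cos2Dsin2 sqrtr1. Qed.

Lemma circ_conj J t : unit_sphere J -> conjq (circ J t) = circ J (- t).
Proof. by move=> hJ; rewrite /circ conj_slice//= cosN sinN. Qed.

Lemma circX J t n : unit_sphere J -> circ J t ^+ n = circ J (n%:R * t).
Proof.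
move=> hJ; elim: n => [|n ih]; first by rewrite expr0 mul0r circ0.
by rewrite exprS ih -circD// -natr1 mulrDl mul1r addrC.
Qed.

Lemma circ_2pi J t n : unit_sphere J -> circ J (t + n%:R * (2 * pi)) = circ J t.
Proof.
move=> hJ; rewrite circD// -circX// (_ : circ J (2 * pi) = 1) ?expr1n ?mulr1//.
by rewrite /circ mulr_natl cos2pi sin2pi slice_real scale1r.
Qed.

Lemma circ_continuous J : continuous (circ J).
Proof.
move=> t; apply: cvgD; apply: cvgZr_tmp; [exact: continuous_cos|exact: continuous_sin].
Qed.

Lemma circ_scale_continuous J (c : R) : continuous (fun t => circ J (c * t)).
Proof.
move=> t; apply: (@continuous_comp _ _ _ (fun t => c * t) (circ J)).
  by apply: cvgMl_tmp; exact: cvg_id.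
exact: circ_continuous.
Qed.

Lemma is_derive_slice J (x y : R -> R) (t x' y' : R) :
  is_derive t (1 : R) x x' -> is_derive t (1 : R) y y' ->
  is_derive t (1 : R) (fun t => slice J (x t, y t)) (slice J (x', y')).
Proof.
move=> [dx ex] [dy ey].
have dx1 := (derivable1_diffP _ _).1 dx; have dy1 := (derivable1_diffP _ _).1 dy.
have dp : is_derive t (1 : R) (fun t => (x t, y t)) (x', y').
  split; first exact/derivable1_diffP/differentiable_pair.
  rewrite deriveE; last exact: differentiable_pair.
  by rewrite (diff_pair dx1 dy1) -(deriveE _ dx1) -(deriveE _ dy1) ex ey.
exact: (is_derive_lin (h := slice J) (@slice_continuous _ J) dp).
Qed.

Lemma is_derive_circ J (c t : R) : unit_sphere J ->
  is_derive t (1 : R) (fun t => circ J (c * t)) (c *: (J * circ J (c * t))).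
Proof.
move=> hJ.
have dx : is_derive t (1 : R) (fun t => cos (c * t)) (- c * sin (c * t)).
  by apply: is_derive_eq; rewrite /GRing.scale /=; ring.
have dy : is_derive t (1 : R) (fun t => sin (c * t)) (c * cos (c * t)).
  by apply: is_derive_eq; rewrite /GRing.scale /=; ring.
have := is_derive_slice J dx dy; congr is_derive.
rewrite /circ -[X in _ = _ *: (X * _)](sliceI J) sliceM//=.
by rewrite -linearZ; congr slice; congr pair; rewrite /= /GRing.scale /=; ring.
Qed.

(** A primitive is [- c^-1 *: J] times the integrand; the last hypothesis makes it periodic. *)
Lemma qcint_circ J (c : R) : unit_sphere J -> c != 0 -> circ J (c * (2 * pi)) = 1 ->
  qcint (fun t => circ J (c * t)) = 0.
Proof.
move=> hJ c0 c1; apply: qcint_eq0 => h ch.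
have cc := @circ_scale_continuous J c.
have d (t : R) : is_derive t (1 : R) (lmulq (- c^-1 *: J) \o (fun t => circ J (c * t)))
    (circ J (c * t)).
  have := is_derive_lin (h := lmulq (- c^-1 *: J)) (@quat_mull_continuous _ _)
    (is_derive_circ c t hJ).
  congr is_derive; rewrite /= /lmulq -scalerAl -scalerAr mulrA sphere_sqr//.
  by rewrite scalerA mulNr mulVf// mulN1r scaleN1r opprK.
by apply: (@qcint_FTC_eq0 h _ _ ch cc d); rewrite /= c1 mulr0 circ0.
Qed.

End CircleIntegral.

(** * Cauchy's formula on a slice *)

Section CauchyFormula.
Context {R : realType}.
Local Notation mu := (@lebesgue_measure R).
Variables (f : quat R -> quat R) (J : quat R).
Hypothesis (fr : entire_slice_regular f) (hJ : unit_sphere J).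

Let F := f \o slice J.
Let dF := partialx F.

Lemma slice_comp_differentiable z : differentiable F z.
Proof.
apply: differentiable_comp; last exact: fr.1.
by apply: linear_differentiable; exact: slice_continuous.
Qed.

(** The Cauchy-Riemann equation reads ['d F z (0, 1) = J * dF z]; with real linearity, the
    differential becomes linear over the slice. *)
Lemma slice_comp_deriveE z v : 'd F z v = slice J v * dF z.
Proof.
have [_ _ _ _ CR] := fr.2 J hJ.
have df := slice_comp_differentiable z.
have ex : 'd F z (1, 0) = dF z by rewrite /dF /partialx deriveE.
have ey : 'd F z (0, 1) = J * dF z.
  have -> : 'd F z (0, 1) = partialy F z by rewrite /partialy deriveE.
  have /eqP := CR z; rewrite scaler_eq0 invr_eq0 pnatr_eq0/= addr_eq0 => /eqP CRz.
  rewrite /dF (CRz : partialx F z = _) mulrN mulrA sphere_sqr//.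
  by rewrite mulN1r opprK.
rewrite [v in LHS](_ : v = v.1 *: (1, 0) + v.2 *: (0, 1)).
  by rewrite linearD !linearZ/= ex ey /slice mulrDl -!scalerAl mul1r.
case: v => a b; congr pair => /=; rewrite /GRing.scale/=; ring.
Qed.

Lemma is_derive_slice_comp (x y : R -> R) (s x' y' : R) :
  is_derive s 1 x x' -> is_derive s 1 y y' ->
  is_derive s 1 (fun t => F (x t, y t)) (slice J (x', y') * dF (x s, y s)).
Proof.
move=> [dx ex] [dy ey].
have dx' : differentiable x s := (derivable1_diffP _ _).1 dx.
have dy' : differentiable y s := (derivable1_diffP _ _).1 dy.
have dp : differentiable (fun t => (x t, y t)) s by exact: differentiable_pair.
have dc : differentiable (F \o (fun t => (x t, y t))) s.
  by apply: differentiable_comp => //; exact: slice_comp_differentiable.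
split; first exact/derivable1_diffP.
rewrite deriveE// diff_comp//=; last exact: slice_comp_differentiable.
by rewrite slice_comp_deriveE diff_pair// -!deriveE// ex ey.
Qed.

Lemma dF_continuous : continuous dF.
Proof. by case: (fr.2 J hJ) => _ _ c _ _; exact: c. Qed.

Variables (r : R) (z : R * R).
Hypothesis zr : `|slice J z| < r.

Let r0 : 0 < r. Proof. exact: le_lt_trans zr. Qed.

(** [w] runs over the circle of radius [r], and [p s t] over the segment from [z] to the coordinates
    of [w t]. *)
Let w (t : R) : quat R := slice J (r * cos t, r * sin t).
Let p (s t : R) : R * R := (z.1 + s * (r * cos t - z.1), z.2 + s * (r * sin t - z.2)).
(* the value of w / (w - z) *)
Let k (t : R) : quat R :=
  (`|w t - slice J z| ^- 2) *: (w t * conjq (w t - slice J z)).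
(** The integrand common to [derive_s] and [derive_t]. *)
Let D (s t : R) : quat R := w t * dF (p s t).

Let wE t : w t = r *: circ J t.
Proof. by rewrite /w /circ /slice scalerDr !scalerA. Qed.

Let w_norm t : `|w t| = r.
Proof. by rewrite wE normrZ circ_norm// mulr1 gtr0_norm. Qed.

Let wz_norm t : r - `|slice J z| <= `|w t - slice J z|.
Proof. by rewrite -{1}(w_norm t) lerB_dist. Qed.

Let wz_gt0 t : 0 < `|w t - slice J z|.
Proof. by rewrite (lt_le_trans _ (wz_norm t))// subr_gt0. Qed.

Let wzE t : w t - slice J z = slice J (r * cos t - z.1, r * sin t - z.2).
Proof. by rewrite /w -sliceN -sliceD. Qed.

Let kE t : k t * (w t - slice J z) = w t.
Proof.
rewrite /k -scalerAl -mulrA mul_conjq -scalerAr mulr1 scalerA mulVf ?scale1r//.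
by rewrite expf_neq0// gt_eqF.
Qed.

(** Membership in the slice is what lets [k t] commute with [z] and with the inverse of [w t] in
    [kE_geom]. *)
Let k_slice t : exists v, k t = slice J v.
Proof.
rewrite /k wzE conj_slice// /w sliceM// /slice scalerDr !scalerA.
by eexists (_, _).
Qed.

Let k_norm t : `|k t| <= r / (r - `|slice J z|).
Proof.
have : `|k t| * `|w t - slice J z| = r by rewrite -qnormM kE w_norm.
move/(canRL (mulfK _)) => ->; last by rewrite gt_eqF.
by rewrite ler_pM2l// lef_pV2// posrE ?subr_gt0.
Qed.

Let w_continuous : continuous w.
Proof.
move=> t; rewrite /continuous_at wE (_ : w = fun s => r *: circ J s).
  by apply: cvgZl_tmp; exact: circ_continuous.
by apply/funext => s; exact: wE.
Qed.

Let k_continuous : continuous k.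
Proof.
have cwz : continuous (fun t => w t - slice J z).
  by move=> t; apply: cvgB; [exact: w_continuous|exact: cvg_cst].
have cn : continuous (fun t => `|w t - slice J z| ^- 2).
  move=> t; apply: cvgV; first by rewrite expf_neq0// gt_eqF.
  by apply: cvgM; apply: cvg_norm; exact: cwz.
have cwc := quatM_continuous w_continuous (conjq_continuous cwz).
by move=> t; exact: (cvgZ (cn t) (cwc t)).
Qed.

Let p_continuous : continuous (fun st : R * R => p st.1 st.2).
Proof.
have c1 (u v : R) (g : R -> R) : continuous g ->
    continuous (fun st : R * R => u + st.1 * (r * g st.2 - v)).
  move=> cg st; apply: cvgD; first exact: cvg_cst.
  apply: cvgM; first exact: cvg_fst.
  apply: cvgB; last exact: cvg_cst.
  by apply: cvgMl_tmp; apply: continuous_comp; [exact: cvg_snd|exact: cg].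
move=> st; exact: (cvg_pair (c1 z.1 z.1 _ (@continuous_cos R) st) (c1 z.2 z.2 _ (@continuous_sin R) st)).
Qed.

Let D_continuous : continuous (fun st : R * R => D st.1 st.2).
Proof.
move=> st; apply: cvg_quatM.
  by apply: continuous_comp; [exact: cvg_snd|exact: w_continuous].
apply: (@continuous_comp _ _ _ (fun st : R * R => p st.1 st.2) dF).
  exact: p_continuous.
exact: dF_continuous.
Qed.

Let p1 t : p 1 t = (r * cos t, r * sin t).
Proof. by rewrite /p !mul1r; congr pair; ring. Qed.

Let p0 t : p 0 t = z.
Proof. by rewrite /p !mul0r !addr0; case: z. Qed.

Let derive_s (h : {linear quat R -> R^o}) (t s : R) : continuous h ->
  is_derive s (1 : R) (fun s => h (k t * F (p s t))) (h (D s t)).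
Proof.
move=> ch.
have dp : is_derive s (1 : R) (fun s => F (p s t))
    (slice J (r * cos t - z.1, r * sin t - z.2) * dF (p s t)).
  apply: is_derive_slice_comp.
    by apply: is_derive_eq; rewrite /GRing.scale /=; ring.
  by apply: is_derive_eq; rewrite /GRing.scale /=; ring.
have := is_derive_lin (h := lmulq (k t)) (@quat_mull_continuous _ (k t)) dp.
rewrite /= /lmulq mulrA -wzE kE => dm.
exact: (is_derive_lin ch dm).
Qed.

Let derive_t (s t : R) : s != 0 ->
  is_derive t (1 : R) (fun t => (- s^-1 *: J) * F (p s t)) (D s t).
Proof.
move=> s0.
have dp : is_derive t (1 : R) (fun t => F (p s t))
    (slice J (s * (r * - sin t), s * (r * cos t)) * dF (p s t)).
  apply: is_derive_slice_comp.
    by apply: is_derive_eq; rewrite /GRing.scale /=; ring.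
  by apply: is_derive_eq; rewrite /GRing.scale /=; ring.
have := is_derive_lin (h := lmulq (- s^-1 *: J)) (@quat_mull_continuous _ _) dp.
congr is_derive; rewrite /= /D /lmulq mulrA; congr (_ * _).
rewrite -scalerAl -{1}(sliceI J) sliceM//= /w /slice /= scalerDr !scalerA.
by congr (_ *: _ + _ *: _); field.
Qed.

(** The primitive in [derive_t] divides by [s]. At [s = 0] the derivative of [F] is frozen at [z],
    and only [w] has to be integrated. *)
Let derive_t0 (t : R) : is_derive t (1 : R) (fun t => - J * (w t * dF z)) (D 0 t).
Proof.
rewrite /D p0.
have dw : is_derive t (1 : R) w (J * w t).
  have dx : is_derive t (1 : R) (fun t => r * cos t) (r * - sin t).
    by apply: is_derive_eq; rewrite /GRing.scale /=; ring.
  have dy : is_derive t (1 : R) (fun t => r * sin t) (r * cos t).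
    by apply: is_derive_eq; rewrite /GRing.scale /=; ring.
  have := is_derive_slice J dx dy.
  congr is_derive; rewrite -[X in _ = X * _](sliceI J) /w sliceM//=.
  by congr slice; congr pair; ring.
have := is_derive_lin (h := lmulq (- J)) (@quat_mull_continuous _ _)
  (is_derive_lin (h := rmulq (dF z)) (@quat_mulr_continuous _ _) dw).
by congr is_derive; rewrite /= /lmulq /rmulq !mulrA mulNr sphere_sqr// opprK mul1r.
Qed.

Let cint_ker_eq0 (h : {linear quat R -> R^o}) : continuous h ->
  (\int[mu]_(t in `[0%R, (2 * pi)%R : R]) (h (k t * (F (r * cos t, r * sin t)%R - F z)%R))%:E = 0)%E.
Proof.
move=> ch.
have chD : continuous (fun st => h (D st.1 st.2)).
  by move=> st; apply: (@continuous_comp _ _ _ (fun st => D st.1 st.2) h); [exact: D_continuous|exact: ch].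
transitivity (\int[mu]_(t in `[0%R, (2 * pi)%R : R]) \int[mu]_(s in `[0%R, 1%R : R])
   (h (D s t))%:E)%E.
  apply: eq_integral => t _.
  have cD : continuous (fun s => h (D s t)).
    by move=> s; apply: (@continuous_comp _ _ _ (fun s : R => (s, t : R)) (fun st => h (D st.1 st.2)));
     [exact: cvg_pair cvg_id (cvg_cst t)|exact: chD].
  rewrite (@continuous_derive_FTC R _ _ 0 1 ler01 cD (fun s => derive_s t s ch)).
  by rewrite p1 p0 -linearB mulrBr.
rewrite -(@rect_Fubini R (fun st => h (D st.1 st.2)) 0 1 0 (2 * pi) chD) /=.
transitivity (\int[mu]_(s in `[0%R, 1%R : R]) 0)%E; last by rewrite integral0.
have cD (s : R) : continuous (D s).
  by move=> t; apply: (@continuous_comp _ _ _ (fun t : R => (s, t)) (fun st => D st.1 st.2));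
     [exact: cvg_pair (cvg_cst s) cvg_id|exact: D_continuous].
apply: eq_integral => s _.
have [->|s0] := eqVneq s 0.
  apply: (qcint_FTC_eq0 ch (cD 0) derive_t0).
  by rewrite /w mulr_natl cos2pi sin2pi cos0 sin0.
apply: (qcint_FTC_eq0 ch (cD s) (fun t => derive_t t s0)).
by rewrite /p mulr_natl cos2pi sin2pi cos0 sin0.
Qed.

Let G (t : R) : quat R := F (r * cos t, r * sin t) - F z.

Let Fw_continuous : continuous (fun t => F (r * cos t, r * sin t)).
Proof.
move=> t; apply: (@continuous_comp _ _ _ w f); first exact: w_continuous.
exact/differentiable_continuous/fr.1.
Qed.

Let G_continuous : continuous G.
Proof. by move=> t; apply: cvgB; [exact: Fw_continuous|exact: cvg_cst]. Qed.

Let qcint_ker_eq0 : qcint (fun t => k t * G t) = 0.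
Proof. by apply: qcint_eq0 => h ch; exact: cint_ker_eq0. Qed.

(** The value of [w t ^- n]. *)
Let e n (t : R) : quat R := r ^- n *: circ J (- n%:R * t).

Let e_continuous n : continuous (e n).
Proof.
by move=> t; apply: cvgZl_tmp; exact: circ_scale_continuous.
Qed.

Let e_norm n t : `|e n t| = r ^- n.
Proof. by rewrite /e normrZ circ_norm// mulr1 ger0_norm// invr_ge0 exprn_ge0// ltW. Qed.

Let qcint_e n : qcint (e n) = (if n == 0%N then 2 * pi else 0)%:A.
Proof.
case: n => [|n].
  rewrite (_ : e 0 = fun=> 1) ?qcint_cst//.
  by apply/funext => t; rewrite /e expr0 invr1 scale1r oppr0 mul0r circ0.
have cc := @circ_scale_continuous R J (- n.+1%:R).
rewrite scale0r (_ : e n.+1 = fun t => r ^- n.+1 *: 1 * circ J (- n.+1%:R * t)); last first.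
  by apply/funext => t; rewrite /e -scalerAl mul1r.
rewrite qcintMl// qcint_circ ?mulr0// ?oppr_eq0 ?pnatr_eq0//.
rewrite mulNr -circ_conj//; apply/eqP; rewrite -(inj_eq (can_inj (@conjqK R))) conjqK conjq1.
by rewrite -[X in circ J X]add0r circ_2pi// circ0.
Qed.

(** Iterates [k t = 1 + slice J z * e 1 t * k t], which is w / (w - z) = 1 + (z / w) (w / (w -
    z)). *)
Let kE_geom N t : k t = \sum_(n < N) slice J z ^+ n * e n t + slice J z ^+ N * e N t * k t.
Proof.
have e0 : e 0 t = 1 by rewrite /e expr0 invr1 scale1r oppr0 mul0r circ0.
have eS n : e n.+1 t = e 1 t * e n t.
  rewrite /e -scalerAl -scalerAr scalerA -circD// expr1 exprS invfM; congr (_ *: circ _ _).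
  by rewrite -natr1; ring.
have e_sl n : exists v, e n t = slice J v.
  by rewrite /e /circ -linearZ; eexists.
have we : w t * e 1 t = 1.
  rewrite wE /e -scalerAl -scalerAr scalerA -circD// expr1 divff ?gt_eqF//.
  by rewrite scale1r mulN1r subrr circ0.
have kS : k t = 1 + slice J z * e 1 t * k t.
  have : k t * w t = w t + k t * slice J z.
    by rewrite -{2}(kE t) mulrBr subrK.
  move/(congr1 (fun q => q * e 1 t)); rewrite -mulrA we mulr1 mulrDl we => kk.
  rewrite {1}kk; congr (_ + _).
  have [v1 ->] := k_slice t; have [v2 ->] := e_sl 1%N.
  by rewrite [slice J v1 * _]slice_comm// -!mulrA; congr (_ * _); exact: slice_comm.
elim: N => [|N ih]; first by rewrite big_ord0 add0r expr0 mul1r e0 mul1r.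
rewrite {1}ih big_ord_recr /= -addrA; congr (_ + _).
rewrite {1}kS mulrDr mulr1; congr (_ + _).
rewrite (eS N) exprSr !mulrA; congr (_ * _).
have [v1 ->] := e_sl N; have [v2 ->] := e_sl 1%N.
rewrite -!mulrA; congr (_ * _); rewrite mulrA [slice J v1 * _]slice_comm// -!mulrA.
by congr (_ * _); exact: slice_comm.
Qed.

(** Cauchy's coefficient integral written in the angle t, where dw / w is J dt. *)
Definition cauchy_coef n : quat R :=
  (2 * pi)^-1 *: qcint (fun t => r ^- n *: circ J (- n%:R * t) * F (r * cos t, r * sin t)).

Let cauchy_coefE n : (2 * pi) *: cauchy_coef n = qcint (fun t => e n t * F (r * cos t, r * sin t)).
Proof.
by rewrite /cauchy_coef scalerA divff ?scale1r// mulf_neq0// gt_eqF// pi_gt0.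
Qed.

Lemma cauchy_coef_bounded : exists M, forall n, `|cauchy_coef n| * r ^+ n <= M.
Proof.
have [M M0 FM] := circle_bounded Fw_continuous.
exists ((2 * pi)^-1 * (8 * pi * M)) => n; rewrite -ler_pdivlMr ?exprn_gt0//.
have pi2 : 0 <= (2 * pi : R)^-1 by rewrite invr_ge0 mulr_ge0// pi_ge0.
rewrite normrZ ger0_norm// -!mulrA ler_wpM2l// mulrA.
apply: le_trans (qcint_norm (M := M / r ^+ n) _ _) _.
- exact: quatM_continuous (@e_continuous n) Fw_continuous.
- move=> t /FM h; rewrite qnormM; have := e_norm n t; rewrite /e => ->.
  by rewrite mulrC ler_wpM2r// invr_ge0 exprn_ge0// ltW.
- by rewrite !mulrA.
Qed.

(** The kernel is expanded against [G], the difference F(w) - F(z): its full kernel integral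
    vanishes, so a partial sum equals minus its remainder, of order (|z| / r)^N. *)
Lemma cauchy_series : series (fun n => slice J z ^+ n * cauchy_coef n) @ \oo --> F z.
Proof.
have [M M0 GM] := circle_bounded G_continuous.
pose C := 8 * pi * (r / (r - `|slice J z|) * M).
have eG n : continuous (fun t => e n t * G t).
  exact: quatM_continuous (@e_continuous n) G_continuous.
have ekG n : continuous (fun t => e n t * (k t * G t)).
  exact: quatM_continuous (@e_continuous n) (quatM_continuous k_continuous G_continuous).
have S N : \sum_(n < N) slice J z ^+ n * qcint (fun t => e n t * G t) =
    - (slice J z ^+ N * qcint (fun t => e N t * (k t * G t))).
  apply/eqP; rewrite -addr_eq0 -[X in _ == X]qcint_ker_eq0; apply/eqP.
  have cs m : continuous (fun t => \sum_(n < m) slice J z ^+ n * (e n t * G t)).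
    elim: m => [|m ih]; first by under eq_fun do rewrite big_ord0; exact: cst_continuous.
    under eq_fun do rewrite big_ord_recr /=.
    have cm : continuous (fun t => slice J z ^+ m * (e m t * G t)).
      by apply: quatM_continuous; [exact: cst_continuous|exact: eG].
    by move=> t; exact: (cvgD (ih t) (cm t)).
  have sE m : qcint (fun t => \sum_(n < m) slice J z ^+ n * (e n t * G t)) =
      \sum_(n < m) slice J z ^+ n * qcint (fun t => e n t * G t).
    elim: m => [|m ih].
      rewrite big_ord0 -[RHS](scaler0 _ (2 * pi)) -qcint_cst; congr qcint.
      by apply/funext => t; rewrite big_ord0.
    rewrite big_ord_recr /= -ih -qcintMl// -qcintD//.
      by congr qcint; apply/funext => t; rewrite big_ord_recr.
    by apply: quatM_continuous; [exact: cst_continuous|exact: eG].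
  rewrite -sE -qcintMl// -qcintD//; last first.
    by apply: quatM_continuous; [exact: cst_continuous|exact: ekG].
  congr qcint; apply/funext => t; rewrite [k t in RHS](kE_geom N t) mulrDl mulr_suml.
  by congr (_ + _); rewrite -?mulrA//; apply: eq_bigr => n _; rewrite -!mulrA.
have Sle N : `|\sum_(n < N) slice J z ^+ n * qcint (fun t => e n t * G t)| <=
    C * (`|slice J z| / r) ^+ N.
  rewrite S normrN qnormM qnormX exprMn exprVn mulrCA ler_wpM2l ?exprn_ge0//.
  rewrite [C * _]mulrC; apply: le_trans (qcint_norm (M := r ^- N * (r / (r - `|slice J z|) * M)) (ekG N) _) _.
    move=> t ht; rewrite !qnormM e_norm; apply: ler_wpM2l.
      by rewrite invr_ge0 exprn_ge0// ltW.
    by apply: ler_pM; rewrite ?k_norm ?GM.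
  by rewrite /C mulrCA.
have e0 n : slice J z ^+ n * qcint (e n) = (if n == 0%N then 2 * pi else 0)%:A.
  rewrite qcint_e; case: n => [|n]; first by rewrite expr0 mul1r.
  by rewrite scale0r mulr0.
have pi2 : 2 * pi != 0 :> R by rewrite mulf_neq0// gt_eqF// pi_gt0.
(* The constant [F z] enters only through the term [n = 0], the other [qcint (e n)] being zero;
   hence the condition [0 < N]. *)
have part N : (0 < N)%N -> series (fun n => slice J z ^+ n * cauchy_coef n) N - F z =
    (2 * pi)^-1 *: \sum_(n < N) slice J z ^+ n * qcint (fun t => e n t * G t).
  case: N => // N _.
  apply: (canRL (scalerK pi2)); rewrite scalerBr /series /= big_mkord scaler_sumr.
  transitivity (\sum_(n < N.+1) slice J z ^+ n * qcint (fun t => e n t * F (r * cos t, r * sin t)) -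
     \sum_(n < N.+1) slice J z ^+ n * qcint (e n) * F z).
    congr (_ - _); first by apply: eq_bigr => n _; rewrite scalerAr cauchy_coefE.
    rewrite big_ord_recl e0 /= big1 ?addr0 -?scalerAl ?mul1r// => n _.
    by rewrite e0 /= scale0r mul0r.
  rewrite -sumrB; apply: eq_bigr => n _; rewrite -mulrA -mulrBr; congr (_ * _).
  have eF : continuous (fun t => e n t * F (r * cos t, r * sin t)).
    exact: quatM_continuous (@e_continuous n) Fw_continuous.
  apply/eqP; rewrite subr_eq -qcintMr// -qcintD//; last first.
    by apply: quatM_continuous; [exact: e_continuous|exact: cst_continuous].
  by apply/eqP; congr qcint; apply/funext => t; rewrite -mulrDr subrK.
have zr1 : `|(`|slice J z| / r)| < 1.
  by rewrite ger0_norm ?divr_ge0// ?ltW// ltr_pdivrMr// mul1r.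
have c0 := cvg_geometric ((2 * pi)^-1 * C) zr1.
apply/cvgrPdist_le => eps eps0; near=> N.
rewrite -normrN opprB part; last by near: N; exact: nbhs_infty_gt.
rewrite normrZ ger0_norm ?invr_ge0 ?mulr_ge0 ?pi_ge0//.
apply: (@le_trans _ _ (geometric ((2 * pi)^-1 * C) (`|slice J z| / r) N)); last first.
  by near: N; exact: (cvgr_le _ c0).
rewrite /= -[leRHS]mulrA; apply: ler_wpM2l; last exact: Sle.
by rewrite invr_ge0 mulr_ge0// pi_ge0.
Unshelve. all: by end_near. Qed.

End CauchyFormula.

(** * Independence of the radius and of the slice *)

Section Expansion.
Context {R : realType}.

Lemma regular_slice_qseries (f : quat R -> quat R) (J : quat R) :
  entire_slice_regular f -> unit_sphere J ->
  exists2 a, entire_coef a & forall z, f (slice J z) = qseries a (slice J z).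
Proof.
move=> fr hJ; pose a := cauchy_coef f J 1.
(* Both radii give convergent expansions of [f] at the real points of []0, 1[], and these determine
   the coefficients. *)
have indep r : 1 <= r -> cauchy_coef f J r = a.
  move=> r1; apply/funext => n; apply/eqP; rewrite -subr_eq0; apply/eqP; move: n.
  have r0 : 0 < r by exact: lt_le_trans r1.
  have z0 : `|slice J ((0, 0) : R * R)| < r by rewrite slice_real scale0r normr0.
  have z1 : `|slice J ((0, 0) : R * R)| < 1 by rewrite slice_real scale0r normr0.
  have [M1 h1] := cauchy_coef_bounded fr hJ z0.
  have [M2 h2] := cauchy_coef_bounded fr hJ z1.
  apply: (@real_series_coef_eq0 _ (fun n => cauchy_coef f J r n - a n) 1 (M1 + M2)) => //.
    move=> n; rewrite expr1n mulr1; apply: le_trans (ler_normB _ _) _; apply: lerD.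
      by apply: le_trans (h1 n); rewrite ler_peMr// exprn_ege1.
    by have := h2 n; rewrite expr1n mulr1.
  move=> x /andP[x0 x1].
  have xn c : 0 < c -> x < c -> `|slice J (x, 0)| < c.
    by move=> c0 xc; rewrite slice_real normrZ qnorm1 mulr1 gtr0_norm.
  have rX m (c : quat R) : slice J (x, 0) ^+ m * c = x ^+ m *: c.
    rewrite slice_real; elim: m => [|m ih]; first by rewrite !expr0 mul1r scale1r.
    by rewrite !exprS -mulrA ih mulr_algl scalerA.
  have s1 := cauchy_series fr hJ (xn 1 ltr01 x1).
  have s2 := cauchy_series fr hJ (xn r r0 (lt_le_trans x1 r1)).
  have := qsumB s2 s1; rewrite subrr.
  by under eq_fun do rewrite !rX -scalerBr.
have ea : entire_coef a.
  (* Boundedness at a radius beyond [2 * r] gives a geometric majorant of ratio 1/2; the summand [1]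
     ensures [1 <= s], as [indep] requires. *)
  move=> r r0; pose s := 2 * r + 1.
  have s1 : 1 <= s by rewrite lerDr mulr_ge0.
  have s0 : 0 < s by exact: lt_le_trans s1.
  have z0 : `|slice J ((0, 0) : R * R)| < s by rewrite slice_real scale0r normr0.
  have [M h] := cauchy_coef_bounded fr hJ z0.
  have r2 : `|2^-1 : R| < 1 by rewrite ger0_norm// invf_lt1// ltr1n.
  apply: series_le_cvg (is_cvg_geometric_series (a := M) r2) => n /=.
  - by rewrite mulr_ge0// exprn_ge0.
  - by rewrite mulr_ge0 ?exprn_ge0// (le_trans _ (h 0%N))// mulr_ge0// exprn_ge0// ltW.
  - rewrite exprVn ler_pdivlMr ?exprn_gt0//; apply: le_trans (h n).
    rewrite (indep s s1) mulrAC mulrC -exprMn ler_wpM2l//.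
    by rewrite lerXn2r ?nnegrE ?mulr_ge0 ?(ltW s0)// mulrC lerDl.
exists a => // z; pose r := `|slice J z| + 1.
have zr : `|slice J z| < r by rewrite ltrDl.
have r1 : 1 <= r by rewrite lerDr.
have := cauchy_series fr hJ zr; rewrite (indep r r1) => c.
by rewrite /qseries (qsum_lim c).
Qed.

Lemma regular_qseries (f : quat R -> quat R) : entire_slice_regular f ->
  exists2 a, entire_coef a & f = qseries a.
Proof.
move=> fr.
have [I0 hI0 _] := mem_slice (0 : quat R).
have [a ea fa] := regular_slice_qseries fr hI0.
exists a => //; apply/funext => q; have [J hJ [z ->]] := mem_slice q.
have [b eb fb] := regular_slice_qseries fr hJ.
rewrite fb (_ : a = b)//; apply: qseries_inj => // x.
by rewrite -(slice_real I0) -fa slice_real -(slice_real J) fb.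
Qed.

End Expansion.

(** * Changes of variables *)

Section Substitution.
Context {R : realType}.
Local Notation mu := (@lebesgue_measure R).
(** [phi] is an increasing bijection from the whole line onto the interval [D], with inverse [psi];
    the affine, exponential and arctangent substitutions below all take this shape. *)
Variables (phi dphi psi : R -> R) (D : set R).
Hypothesis phiE : forall t : R, is_derive t (1 : R) phi (dphi t).
Hypothesis dphi_continuous : continuous dphi.
Hypothesis dphi_ge0 : forall t, 0 <= dphi t.
Hypothesis mD : measurable D.
Hypothesis iD : is_interval D.
Hypothesis mpsi : measurable_fun D psi.
Hypothesis phiD : forall t, D (phi t).
Hypothesis phiK : cancel phi psi.
Hypothesis psiK : forall x, D x -> phi (psi x) = x.
Hypothesis phi_mono : {mono phi : x y / x <= y}.

Let T := measurableTypeR R.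

(* The two sides of the substitution rule for indicators are measures of [B]
   that agree on half-open intervals. *)
Let lam (B : set T) : \bar R := mu (D `&` psi @^-1` B).
Let kap (B : set T) : \bar R := (\int[mu]_(t in B) (dphi t)%:E)%E.

Let mdphi : measurable_fun setT dphi.
Proof. exact: continuous_measurable_fun. Qed.

Let lam0 : lam set0 = 0%E. Proof. by rewrite /lam preimage_set0 setI0 measure0. Qed.
Let lam_ge0 B : (0 <= lam B)%E. Proof. exact: measure_ge0. Qed.
Let lam_sigma : semi_sigma_additive lam.
Proof.
move=> B mB tB mUB; rewrite /lam preimage_bigcup setI_bigcupr.
apply: measure_semi_sigma_additive.
- by move=> n; apply: mpsi => //; exact: mB.
- apply/trivIsetP => i j _ _ ij; move/trivIsetP : tB => /(_ i j Logic.I Logic.I ij) h.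
  apply/seteqP; split => // x [[_ bi] [_ bj]].
  by have : (B i `&` B j) (psi x) by []; rewrite h.
- by rewrite -setI_bigcupr -preimage_bigcup; exact: mpsi.
Qed.
HB.instance Definition _ := isMeasure.Build _ T R lam lam0 lam_ge0 lam_sigma.

Let kap0 : kap set0 = 0%E. Proof. exact: integral_set0. Qed.
Let kap_ge0 B : (0 <= kap B)%E.
Proof. by apply: integral_ge0 => t _; rewrite lee_fin. Qed.
Let kap_sigma : semi_sigma_additive kap.
Proof.
apply: semi_sigma_additive_nng_induced; first exact/measurable_EFinP.
by move=> t; rewrite lee_fin.
Qed.
HB.instance Definition _ := isMeasure.Build _ T R kap kap0 kap_ge0 kap_sigma.

Let phi_lt (x y : R) : (phi x < phi y) = (x < y). Proof. exact: leW_mono. Qed.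

Let lam_itv (a b : R) : a <= b -> lam `]a, b] = (phi b - phi a)%:E.
Proof.
move=> ab; rewrite /lam (_ : _ `&` _ = `]phi a, phi b]%classic).
  rewrite lebesgue_measure_itv/= lte_fin phi_lt; case: ltP => // ba.
  by rewrite (@le_anti _ _ a b) ?ab ?ba// subrr.
apply/seteqP; split => x /=; rewrite !in_itv/=.
  by move=> [Dx]; rewrite -phi_lt -phi_mono psiK.
move=> xab; have Dx : D x.
  by apply: iD (phiD a) (phiD b) _ _; case/andP : xab => /ltW -> ->.
by split => //; rewrite -phi_lt -phi_mono psiK.
Qed.

Let kap_itv (a b : R) : a <= b -> kap `]a, b] = (phi b - phi a)%:E.
Proof.
move=> ab; rewrite /kap integral_itv_obnd_cbnd; last exact/measurable_EFinP/measurable_funTS.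
exact: continuous_derive_FTC.
Qed.

Let lam_kap B : measurable B -> lam B = kap B.
Proof.
have ab (a b : R) : lam `]a, b] = kap `]a, b].
  have [h|/ltW h] := leP a b; first by rewrite lam_itv// kap_itv.
  have -> : `]a, b]%classic = set0 :> set R by rewrite set_itv_ge// bnd_simp -leNgt.
  by rewrite lam0 kap0.
(* Half-open intervals form a generating family stable under intersection, and they exhaust the line
   with finite measure. *)
apply: (@measure_unique _ R T (@ocitv R) (fun n => `](- n%:R)%R, n%:R]%classic)) => //.
- exact: ocitvI.
- by move=> n; exact: is_ocitv.
- rewrite -subTset => x _ /=; exists (Num.truncn `|x|).+1 => //=; rewrite in_itv/=.
  have := truncnS_gt `|x|; rewrite ltr_norml => /andP[-> /ltW].
  by rewrite andTb.
- by move=> _ [[a b] _ <-]; exact: ab.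
- move=> n; apply: (@le_lt_trans _ _ (phi n%:R - phi (- n%:R))%:E); last exact: ltry.
  by rewrite -lam_itv// (@le_trans _ _ 0)// oppr_le0.
Qed.

Lemma integral_indic_subst B : measurable B ->
  (\int[mu]_(x in D) (\1_B x)%:E = \int[mu]_t (\1_B (phi t) * dphi t)%:E)%E.
Proof.
move=> mB; have mphi : measurable_fun setT phi.
  apply: continuous_measurable_fun => t.
  by apply/differentiable_continuous/derivable1_diffP; case: (phiE t).
have mpB : measurable (phi @^-1` B) by rewrite -[X in measurable X]setTI; exact: mphi.
have := lam_kap mpB; rewrite /lam /kap integral_indic// setIC => h.
transitivity (mu (psi @^-1` (phi @^-1` B) `&` D)).
  by congr (mu _); apply/seteqP; split => x [] /= + Dx; rewrite psiK.
rewrite h integral_mkcond; apply: eq_integral => t _.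
rewrite patchE indicE; have [tB|tB] := pselect (B (phi t)).
  by rewrite !mem_set// mul1r.
by rewrite !memNset// mul0r.
Qed.

Import HBNNSimple.

(** Linearity passes from indicators to simple functions, and monotone convergence on both sides
    does the rest. *)
Lemma ge0_integral_subst (G : R -> \bar R) : measurable_fun setT G ->
  (forall x, 0 <= G x)%E ->
  (\int[mu]_(x in D) G x = \int[mu]_t (G (phi t) * (dphi t)%:E))%E.
Proof.
move=> mG G0; have mphi : measurable_fun setT phi.
  apply: continuous_measurable_fun => t.
  by apply/differentiable_continuous/derivable1_diffP; case: (phiE t).
have mG' : measurable_fun (setT : set T) (G : T -> \bar R) by exact: mG.
pose f_ := nnsfun_approx measurableT mG'.
have f_cvg x : (EFin (f_ n x)) @[n --> \oo] --> G x by apply: cvg_nnsfun_approx.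
have f_nd x m n : (m <= n)%N -> f_ m x <= f_ n x.
  by move=> mn; exact/lefP/nd_nnsfun_approx.
have nn (f : {nnsfun (measurableTypeR R) >-> R}) :
    (\int[mu]_(x in D) (f x)%:E = \int[mu]_t (f (phi t) * dphi t)%:E)%E.
  have ms y : measurable (f @^-1` [set y]) by rewrite -[X in measurable X]setTI; exact: measurable_funP.
  under eq_integral do rewrite fimfunE -fsumEFin//.
  rewrite ge0_integral_fsum//; last 2 first.
  - by move=> y; apply/measurable_EFinP/measurable_funTS/measurable_funM.
  - by move=> y x _; rewrite nnfun_muleindic_ge0.
  under [RHS]eq_integral do rewrite fimfunE mulr_fsuml -fsumEFin//.
  have mi y : measurable_fun setT (fun t => \1_(f @^-1` [set y]) (phi t) : R).
    rewrite (_ : (fun t => _) = \1_(phi @^-1` (f @^-1` [set y]))); last first.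
      by apply/funext => t; rewrite !indicE.
    by apply: measurable_indic; rewrite -[X in measurable X]setTI; apply: mphi => //; exact: ms.
  rewrite ge0_integral_fsum//; last 2 first.
  - move=> y; apply/measurable_EFinP/measurable_funM => //.
    by apply: measurable_funM; [exact: measurable_cst|exact: mi].
  - move=> y x _; rewrite lee_fin mulr_ge0// -lee_fin.
    exact: (nnfun_muleindic_ge0 f y (phi x)).
  apply: eq_fsbigr => y /set_mem [s _ fs].
  have yy : 0 <= y by rewrite -fs.
  under eq_integral do rewrite EFinM.
  rewrite ge0_integralZl_EFin//; last exact/measurable_EFinP/measurable_funTS/measurable_indic.
  under [RHS]eq_integral do rewrite -mulrA EFinM.
  rewrite ge0_integralZl_EFin//; last 2 first.
  - by move=> x _; rewrite lee_fin mulr_ge0.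
  - by apply/measurable_EFinP; apply: measurable_funM; [exact: mi|exact: mdphi].
  by rewrite integral_indic_subst.
transitivity (limn (fun n => \int[mu]_(x in D) (f_ n x)%:E)%E).
  rewrite -monotone_convergence//.
  - by apply: eq_integral => x _; apply/esym/cvg_lim => //; exact: f_cvg.
  - by move=> n; exact/measurable_EFinP/measurable_funTS/measurable_funP.
  - by move=> n x _; rewrite lee_fin.
  - by move=> x _ m n mn; rewrite lee_fin; exact: f_nd.
under eq_fun do rewrite nn.
rewrite -monotone_convergence//.
- apply: eq_integral => t _; apply/cvg_lim => //.
  under eq_fun do rewrite EFinM.
  apply: cvgeZr => //; exact: f_cvg.
- move=> n; apply/measurable_EFinP; apply: measurable_funM; last exact: mdphi.
  exact: (measurableT_comp (measurable_funP (f_ n)) mphi).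
- by move=> n x _; rewrite lee_fin mulr_ge0.
- by move=> x _ m n mn; rewrite lee_fin ler_wpM2r//; exact: f_nd.
Qed.

End Substitution.

(** * Affine, exponential and polar substitutions *)

Section SpecialSubstitutions.
Context {R : realType}.
Local Notation mu := (@lebesgue_measure R).
Local Notation RR := (measurableTypeR R * measurableTypeR R)%type.
Implicit Types (G : R -> \bar R).

Lemma integral_affine G (c d : R) : 0 < c -> measurable_fun setT G ->
  (forall x, 0 <= G x)%E ->
  (\int[mu]_x G x = \int[mu]_t (G (c * t + d)%R * c%:E))%E.
Proof.
move=> c0 mG G0.
have dphi (t : R) : is_derive t (1 : R) (fun t => c * t + d) c.
  by apply: is_derive_eq; rewrite /GRing.scale /=; ring.
apply: (ge0_integral_subst (psi := fun x => (x - d) / c) dphi) => //.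
- exact: cst_continuous.
- by move=> _; exact: ltW.
- by apply: measurable_funM => //; exact: measurable_funB.
- by move=> x _; rewrite mulrCA divff ?gt_eqF// mulr1 subrK.
- by move=> x y; rewrite lerD2r ler_pM2l.
Qed.

Lemma integral_expR G : measurable_fun setT G -> (forall x, 0 <= G x)%E ->
  (\int[mu]_(x in `]0%R, +oo[) G x = \int[mu]_t (G (expR t) * (expR t)%:E))%E.
Proof.
move=> mG G0; apply: (ge0_integral_subst (psi := @ln R)) => //.
- exact: continuous_expR.
- exact: interval_is_interval.
- exact: measurable_funTS.
- by move=> t /=; rewrite in_itv/= andbT expR_gt0.
- by move=> x /=; rewrite in_itv/= andbT => x0; rewrite lnK.
- exact: ler_expR.
Qed.

(** The substituted map has to be defined on the whole line, hence [atan] in the role of [phi] and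
    [tan] as its inverse. *)
Lemma integral_atan G : measurable_fun setT G -> (forall x, 0 <= G x)%E ->
  (\int[mu]_(x in `](- (pi / 2))%R, (pi / 2)%R[) G x =
   \int[mu]_u (G (atan u) * ((1 + u ^+ 2)^-1)%:E))%E.
Proof.
move=> mG G0; have cos0 x : x \in `]- (pi / 2), pi / 2[ -> cos x != 0 :> R.
  by rewrite in_itv/= => h; rewrite gt_eqF// cos_gt0_pihalf.
apply: (ge0_integral_subst (psi := @tan R)) => //.
- move=> u; apply: cvgV; first by rewrite gt_eqF// ltr_wpDr ?sqr_ge0.
  by apply: cvgD; [exact: cvg_cst|exact: exprn_continuous].
- by move=> u; rewrite invr_ge0 addr_ge0 ?sqr_ge0.
- exact: interval_is_interval.
- apply: open_continuous_measurable_fun; first exact: interval_open.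
  by move=> x /set_mem xD; apply: continuous_tan; exact: cos0.
- by move=> u /=; rewrite in_itv/= atan_gtNpi2 atan_ltpi2.
- by move=> x xD; apply: tanK.
- exact/le_mono/lt_atan.
Qed.

Lemma integral2_iterated (G : R * R -> \bar R) : measurable_fun (setT : set RR) G ->
  (forall z, 0 <= G z)%E ->
  (\int[(mu \x mu)%E]_z G z = \int[mu]_x \int[mu]_y G (x, y))%E.
Proof. by move=> mG G0; exact: (@fubini_tonelli1 _ _ _ _ R mu mu). Qed.

Lemma integral2_swap (G : R -> R -> \bar R) :
  measurable_fun (setT : set RR) (fun z => G z.1 z.2) ->
  (forall x y, 0 <= G x y)%E ->
  (\int[mu]_x \int[mu]_y G x y = \int[mu]_y \int[mu]_x G x y)%E.
Proof. by move=> mG G0; exact: (@fubini_tonelli _ _ _ _ R mu mu (fun z => G z.1 z.2)). Qed.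

(* Substitute [y = |x| u], exchange the integrals, then [x = r / sqrt (1 + u^2)]
   and [u = tan t]; the radius [r] runs over the whole line, the angle over a
   half turn. *)
Lemma polar_integral (G : R * R -> \bar R) : measurable_fun (setT : set RR) G ->
  (forall z, 0 <= G z)%E ->
  (\int[(mu \x mu)%E]_z G z = \int[mu]_r \int[mu]_(t in `](- (pi / 2))%R, (pi / 2)%R[)
     (`|r|%:E * G (r * cos t, `|r| * sin t)%R))%E.
Proof.
move=> mG G0; rewrite (integral2_iterated mG G0).
have m1 : measurable_fun (setT : set RR) (fst : RR -> R) by exact: measurable_fst.
have m2 : measurable_fun (setT : set RR) (snd : RR -> R) by exact: measurable_snd.
(* [c u] is the cosine of [atan u], and [c u * u] is its sine. *)
pose c (u : R) : R := (Num.sqrt (1 + u ^+ 2))^-1.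
have c0 u : 0 < c u by rewrite invr_gt0 sqrtr_gt0 ltr_wpDr ?sqr_ge0.
have c2 u : c u ^+ 2 = (1 + u ^+ 2)^-1.
  by rewrite /c exprVn sqr_sqrtr// addr_ge0 ?sqr_ge0.
have mc : measurable_fun setT c.
  apply: continuous_measurable_fun => u; apply: cvgV.
    by rewrite gt_eqF// sqrtr_gt0 ltr_wpDr ?sqr_ge0.
  apply: continuous_comp; last exact: sqrt_continuous.
  by apply: cvgD; [exact: cvg_cst|exact: exprn_continuous].
have mn (f : RR -> R) : measurable_fun setT f -> measurable_fun setT (fun z => `|f z|).
  by move=> mf; exact: measurableT_comp.
have mGc (f g : RR -> R) : measurable_fun setT f -> measurable_fun setT g ->
    measurable_fun setT (fun z => G (f z, g z)).
  by move=> mf mg; apply: (measurableT_comp mG); exact: measurable_fun_pair.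
have mnE (f : RR -> R) : measurable_fun setT f -> measurable_fun setT (fun z => `|f z|%:E).
  by move=> mf; apply/measurable_EFinP; exact: mn.
have mH1 : measurable_fun (setT : set RR) (fun z => `|z.1|%:E * G (z.1, `|z.1| * z.2)%R)%E.
  apply: emeasurable_funM; first exact: mnE.
  by apply: mGc => //; apply: measurable_funM => //; exact: mn.
transitivity (\int[mu]_x \int[mu]_u (`|x|%:E * G (x, `|x| * u)%R))%E.
  (* The substitution y = |x| u degenerates at [x = 0], which is a null set. *)
  have ae : {ae mu, forall x : R, setT x ->
      (\int[mu]_y G (x, y) = \int[mu]_u (`|x|%:E * G (x, `|x| * u)%R))%E}.
    exists [set 0]; split; first exact: measurable_set1.
      exact: lebesgue_measure_set1.
    move=> x /= nx; apply: contrapT => x0; apply: nx => _.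
    have xp : 0 < `|x| by rewrite normr_gt0; apply/eqP.
    rewrite (@integral_affine (fun y => G (x, y)) `|x| 0)//.
      by apply: eq_integral => u _; rewrite addr0 muleC.
    exact: (@measurable_fun_pair2 _ _ _ (measurableTypeR R) (measurableTypeR R) _ _ x mG).
  apply: ge0_ae_eq_integral ae => //.
  - exact: (@measurable_fun_fubini_tonelli_F _ _ (measurableTypeR R) (measurableTypeR R) R mu G mG G0).
  - apply: (@measurable_fun_fubini_tonelli_F _ _ (measurableTypeR R) (measurableTypeR R) R mu
      (fun z => `|z.1|%:E * G (z.1, `|z.1| * z.2)%R)%E mH1).
    by move=> z; rewrite mule_ge0.
  - by move=> x _; exact: integral_ge0.
  - by move=> x _; apply: integral_ge0 => u _; rewrite mule_ge0.
rewrite (@integral2_swap (fun x u => `|x|%:E * G (x, `|x| * u)%R)%E mH1); last first.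
  by move=> x y; rewrite mule_ge0.
transitivity (\int[mu]_u \int[mu]_r (`|r|%:E * G (r * c u, `|r| * (c u * u))%R * ((1 + u ^+ 2)^-1)%:E))%E.
  apply: eq_integral => u _.
  have mHu : measurable_fun setT (fun x : R => `|x|%:E * G (x, `|x| * u)%R)%E.
    exact: (@measurable_fun_pair1 _ _ _ (measurableTypeR R) (measurableTypeR R) _ _ u mH1).
  rewrite (@integral_affine (fun x => `|x|%:E * G (x, `|x| * u)%R)%E (c u) 0)//; last first.
    by move=> x; rewrite mule_ge0.
  apply: eq_integral => r _; rewrite addr0 normrM (gtr0_norm (c0 u)) -c2.
  rewrite EFinM expr2 EFinM [c u * r]mulrC [(c u * `|r|)%R]mulrC -mulrA.
  rewrite -!muleA [in LHS]muleCA; congr (_ * _)%E.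
  by rewrite muleCA.
have mcu : measurable_fun (setT : set RR) (fun z : RR => c z.1).
  exact: (measurableT_comp (mc : measurable_fun (setT : set (measurableTypeR R)) c) m1).
have mH2 : measurable_fun (setT : set RR)
    (fun z => `|z.2|%:E * G (z.2 * c z.1, `|z.2| * (c z.1 * z.1))%R * ((1 + z.1 ^+ 2)^-1)%:E)%E.
  apply: emeasurable_funM.
    apply: emeasurable_funM; first exact: mnE.
    by apply: mGc; do ?apply: measurable_funM => //; exact: mn.
  apply/measurable_EFinP; rewrite (_ : (fun z => _) = (fun z : RR => c z.1 * c z.1)).
    exact: measurable_funM.
  by apply/funext => z; rewrite -c2 expr2.
rewrite (@integral2_swap (fun u r => `|r|%:E * G (r * c u, `|r| * (c u * u))%R *
    ((1 + u ^+ 2)^-1)%:E)%E mH2); last first.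
  by move=> u r; rewrite !mule_ge0// lee_fin invr_ge0 addr_ge0// sqr_ge0.
apply: eq_integral => r _.
have mH3 : measurable_fun setT (fun t : R => `|r|%:E * G (r * cos t, `|r| * sin t)%R)%E.
  apply: emeasurable_funM; first exact: measurable_cst.
  apply: (measurableT_comp mG); apply: measurable_fun_pair; apply: measurable_funM => //;
    apply: continuous_measurable_fun; [exact: continuous_cos|exact: continuous_sin].
rewrite (integral_atan mH3); last by move=> t; rewrite mule_ge0.
apply: eq_integral => u _; rewrite cos_atan -/(c u).
suff -> : sin (atan u) = c u * u by [].
have cu : cos (atan u) != 0 by rewrite cos_atan -/(c u) (gt_eqF (c0 u)).
by rewrite /c -cos_atan -[X in _ * X]atanK /tan mulrC divfK.
Qed.

End SpecialSubstitutions.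

Lemma is_derive_continuous_at (R : realType) (f : R -> R) (x df : R) : is_derive x (1 : R) f df -> {for x, continuous f}.
Proof. by case=> d _; exact: (differentiable_continuous ((derivable1_diffP _ _).1 d)). Qed.

(** Side conditions for integrands built from exponentials; continuity, and with it measurability,
    comes from an inferred derivative. *)
Ltac exp_side := solve [ done | exact: measurable_itv
  | by move=> ? _; rewrite lee_fin expR_ge0
  | by apply/measurable_EFinP; apply: measurable_funTS;
    apply: continuous_measurable_fun => ?; apply: is_derive_continuous_at ].

(** * The Gamma and Macdonald functions *)

Section GammaFunction.
Context {R : realType}.
Local Notation mu := (@lebesgue_measure R).
Local Notation RR := (measurableTypeR R * measurableTypeR R)%type.
Implicit Types (s : R).

Lemma integral_mulindic (D : set R) (F : R -> \bar R) :
  (\int[mu]_y (F y * (\1_D y)%:E) = \int[mu]_(y in D) F y)%E.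
Proof.
rewrite [RHS]integral_mkcond; apply: eq_integral => y _.
by rewrite patchE indicE; case: ifP; rewrite ?mule1 ?mule0.
Qed.

(* Euler's integral after [t = expR x] *)
Definition egamma s : \bar R := (\int[mu]_x (expR (s * x - expR x))%:E)%E.

Lemma egamma_measurable s : measurable_fun setT (fun x : R => (expR (s * x - expR x))%:E).
Proof.
by apply/measurable_EFinP; apply: continuous_measurable_fun => x; apply: is_derive_continuous_at.
Qed.

Lemma GammaE s : Gamma s = fine (egamma s).
Proof.
rewrite /Gamma /Rintegral /egamma; congr fine.
rewrite (@integral_expR _ (fun t => (t `^ (s - 1) * expR (- t))%:E)).
- apply: eq_integral => x _; rewrite -EFinM; congr EFin.
  rewrite /powR (gt_eqF (expR_gt0 x)) expRK.
  by rewrite -!expRD; congr expR; ring.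
- apply/measurable_EFinP; apply: measurable_funM; first exact: measurable_powR.
  by apply: continuous_measurable_fun => x; apply: is_derive_continuous_at.
- by move=> x; rewrite lee_fin mulr_ge0 ?powR_ge0 ?expR_ge0.
Qed.

Lemma half_line_FTC (f F : R -> R) (l : R) : (forall x, 0 <= f x) -> continuous f ->
  (forall x : R, is_derive x (1 : R) F (f x)) -> F x @[x --> +oo] --> l ->
  (\int[mu]_(x in `[0%R, +oo[) (f x)%:E = (l - F 0)%:E)%E.
Proof.
move=> f0 cf dF Fl; rewrite (@ge0_continuous_FTC2y _ f F 0 l)//.
- exact: continuous_subspaceT.
- by apply: cvg_at_right_filter; exact: (is_derive_continuous_at (dF 0)).
- by move=> x _; rewrite derive1E; case: (dF x).
Qed.

Lemma integral_exp_tail (c : R) : 0 < c ->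
  (\int[mu]_(y in `[0%R, +oo[) (expR (- (c * y)))%:E = (c^-1)%:E)%E.
Proof.
move=> c0; have dF (x : R) : is_derive x (1 : R) (fun x => - expR (- (c * x)) / c) (expR (- (c * x))).
  apply: is_derive_eq; rewrite /GRing.scale /=; field; lra.
rewrite (@half_line_FTC _ _ 0 _ _ dF).
- by rewrite mulr0 oppr0 expR0; congr EFin; field; lra.
- by move=> x; exact: expR_ge0.
- by move=> x; apply: is_derive_continuous_at.
- rewrite -(mul0r c^-1) -oppr0; apply: cvgM; last exact: cvg_cst.
  apply: cvgN.
  apply: (@cvg_comp _ _ _ (fun x => c * x) (fun x => expR (- x)) _ (pinfty_nbhs R)).
    exact: gt0_cvgMry.
  exact: cvgr_expR.
Qed.

Lemma integral_exp_exp_tail (x : R) :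
  (\int[mu]_(y in `[0%R, +oo[) (expR (x + y - expR (x + y)))%:E = (expR (- expR x))%:E)%E.
Proof.
have dF (y : R) : is_derive y (1 : R) (fun y => - expR (- expR (x + y))) (expR (x + y - expR (x + y))).
  apply: is_derive_eq; rewrite /GRing.scale /= !expRD expRN; ring.
rewrite (@half_line_FTC _ _ 0 _ _ dF).
- by rewrite addr0 sub0r opprK.
- by move=> y; exact: expR_ge0.
- by move=> y; apply: is_derive_continuous_at.
- rewrite -oppr0; apply: cvgN.
  apply: (@cvg_comp _ _ _ (fun y => expR (x + y)) (fun x => expR (- x)) _ (pinfty_nbhs R)); last exact: cvgr_expR.
  apply/cvgryPge => A; near=> y; apply: le_trans (expR_ge1Dx _).
  rewrite addrA -lerBlDl; near: y; apply: nbhs_pinfty_ge; exact: num_real.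
Unshelve. all: end_near. Qed.

Lemma egamma1 : egamma 1 = 1%E.
Proof.
have m1 : measurable_fun setT (fun x : R => (expR (- (1 * x)))%:E).
  by apply/measurable_EFinP; apply: continuous_measurable_fun => x; apply: is_derive_continuous_at.
have h : (\int[mu]_(x in `]0%R, +oo[) (expR (- (1 * x)))%:E = 1)%E.
  rewrite integral_itv_obnd_cbnd; last exact: measurable_funTS.
  by rewrite integral_exp_tail ?invr1.
rewrite -h (@integral_expR _ (fun x => (expR (- (1 * x)))%:E) m1); last first.
  by move=> x; rewrite lee_fin expR_ge0.
by apply: eq_integral => x _; rewrite -EFinM -expRD !mul1r addrC.
Qed.

(* Write [expR (- expR x)] with [integral_exp_exp_tail] and exchange the integrals. *)
Lemma egammaS s : 0 < s -> egamma s = (egamma (s + 1) * (s^-1)%:E)%E.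
Proof.
move=> s0; pose D : set R := `[0, +oo[%classic.
have mD : measurable_fun (setT : set R) (fun y => (\1_D y)%:E : \bar R).
  by apply/measurable_EFinP; apply: measurable_indic; exact: measurable_itv.
pose G (x y : R) : \bar R := ((expR (s * x + (x + y - expR (x + y))))%:E * (\1_D y)%:E)%E.
have mG : measurable_fun (setT : set RR) (fun z => G z.1 z.2).
  apply: emeasurable_funM; last first.
    by apply: (measurableT_comp (mD : measurable_fun (setT : set (measurableTypeR R)) _)); exact: measurable_snd.
  apply/measurable_EFinP.
  apply: (@measurableT_comp _ _ _ RR R R (@expR R) _ (fun z : RR => s * z.1 + (z.1 + z.2 - expR (z.1 + z.2)))).
    exact: continuous_measurable_fun (@continuous_expR R).
  apply: continuous2_measurable => z.
  apply: cvgD; first by apply: cvgM; [exact: cvg_cst|exact: cvg_fst].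
  have h : (fun w : R * R => w.1 + w.2) w @[w --> z] --> z.1 + z.2.
    by apply: cvgD; [exact: cvg_fst|exact: cvg_snd].
  apply: cvgB => //; apply: (continuous_comp (f := fun w : R * R => w.1 + w.2)) => //.
  exact: continuous_expR.
have G0 x y : (0 <= G x y)%E by rewrite mule_ge0 ?lee_fin// expR_ge0.
transitivity (\int[mu]_x \int[mu]_y G x y)%E.
  apply: eq_integral => x _; rewrite integral_mulindic.
  under eq_integral do rewrite (expRD (s * x)) EFinM.
  rewrite ge0_integralZl_EFin ?expR_ge0//; [|exp_side..].
  by rewrite integral_exp_exp_tail -EFinM -expRD.
rewrite (@integral2_swap _ G mG G0).
transitivity (\int[mu]_y ((egamma (s + 1) * (expR (- (s * y)))%:E) * (\1_D y)%:E))%E.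
  apply: eq_integral => y _.
  have mGy : measurable_fun setT (fun x : R => G x y).
    exact: (@measurable_fun_pair1 _ _ _ (measurableTypeR R) (measurableTypeR R) _ _ y mG).
  rewrite (@integral_affine _ (fun x => G x y) 1 (- y) ltr01 mGy (G0^~ y)).
  rewrite /G; under eq_integral do rewrite mule1 mul1r.
  rewrite ge0_integralZr//; [|exp_side..].
  congr (_ * _)%E; rewrite -ge0_integralZr ?lee_fin ?expR_ge0//; [|exp_side..].
  by apply: eq_integral => x _; rewrite -EFinM -expRD subrK; congr (expR _)%:E; ring.
rewrite integral_mulindic ge0_integralZl.
- by rewrite integral_exp_tail.
- exact: measurable_itv.
- by apply/measurable_EFinP; apply: measurable_funTS; apply: continuous_measurable_fun => y; apply: is_derive_continuous_at.
- by move=> y _; rewrite lee_fin expR_ge0.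
- by apply: integral_ge0 => x _; rewrite lee_fin expR_ge0.
Qed.

Lemma egamma_ge0 s : (0 <= egamma s)%E.
Proof. by apply: integral_ge0 => x _; rewrite lee_fin expR_ge0. Qed.

Lemma egamma_gt0 s : 0 < s -> (0 < egamma s)%E.
Proof.
move=> s0; apply: (@lt_le_trans _ _ (\int[mu]_(x in `[0%R, 1%R]) (expR (- expR 1))%:E)%E).
  rewrite integral_cst; [idtac|exp_side..].
  have h : mu `[0%R, 1%R]%classic = 1%E.
    by rewrite lebesgue_measure_itv/= lte_fin ltr01 -EFinB subr0.
  rewrite [X in (_ * X)%E](_ : _ = 1%E); last exact: h.
  by rewrite mule1 lte_fin expR_gt0.
apply: (@le_trans _ _ (\int[mu]_(x in `[0%R, 1%R]) (expR (s * x - expR x))%:E)%E).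
  apply: ge0_le_integral => //.
  - exp_side.
  - move=> x /=; rewrite in_itv/= => /andP[x0 x1].
    rewrite lee_fin ler_expR -[leLHS]add0r lerD//; first by rewrite mulr_ge0// ltW.
    by rewrite lerN2 ler_expR.
apply: ge0_subset_integral => //; first exact: egamma_measurable.
Qed.

(** Pointwise, [s * x] is at most [b * x] for [x >= 0] and at most [a * x] for [x < 0]. *)
Lemma egamma_le (s a b : R) : a <= s <= b -> (egamma s <= egamma a + egamma b)%E.
Proof.
move=> /andP[as_ sb]; rewrite /egamma -ge0_integralD//; [|exp_side..].
apply: ge0_le_integral => //; [exp_side|exp_side|idtac].
move=> x _; rewrite -EFinD lee_fin.
have [x0|x0] := leP 0 x.
  rewrite -[leLHS]add0r lerD ?expR_ge0// ler_expR lerD2r.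
  by rewrite ler_wpM2r.
rewrite -[leLHS]addr0 lerD ?expR_ge0// ler_expR lerD2r.
by rewrite ler_wnM2r// ltW.
Qed.

(** Starting from [egamma1], the functional equation gives finiteness at the positive integers,
    [egamma_le] fills the gaps, and one more use of [egammaS] reaches the arguments below [1]. *)
Lemma egamma_fin s : 0 < s -> egamma s \is a fin_num.
Proof.
have H (t : R) : 1 <= t -> egamma t \is a fin_num.
  move=> t1; have hn n : egamma n.+1%:R \is a fin_num.
    elim: n => [|n]; first by rewrite egamma1.
    rewrite (@egammaS n.+1%:R) ?ltr0n// natr1.
    rewrite !ge0_fin_numE ?egamma_ge0 ?mule_ge0 ?egamma_ge0 ?lee_fin ?invr_ge0//.
    (* By the functional equation, an infinite value at the successor would make the value already
       known to be finite infinite too. *)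
    move=> h; rewrite ltey; apply/eqP => h'; move: h; rewrite h' gt0_mulye ?ltxx// lte_fin invr_gt0 ltr0n//.
  rewrite ge0_fin_numE ?egamma_ge0//.
  have := truncnS_gt t => /ltW tn.
  apply: le_lt_trans (@egamma_le t 1 (Num.truncn t).+1%:R _) _; first by rewrite t1.
  by rewrite lte_add_pinfty// -ge0_fin_numE ?egamma_ge0// egamma1.
move=> s0; rewrite egammaS// fin_numM// H// lerDr ltW//.
Qed.

Lemma Gamma_egamma s : 0 < s -> egamma s = (Gamma s)%:E.
Proof. by move=> s0; rewrite GammaE fineK ?egamma_fin. Qed.

Lemma Gamma_gt0 s : 0 < s -> 0 < Gamma s.
Proof. by move=> s0; rewrite -lte_fin -Gamma_egamma ?egamma_gt0. Qed.

Lemma GammaS s : 0 < s -> Gamma (s + 1) = s * Gamma s.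
Proof.
move=> s0; have := egammaS s0; rewrite !Gamma_egamma ?addr_gt0//.
by rewrite -EFinM => -[->]; rewrite mulrCA divff ?gt_eqF// mulr1.
Qed.

Lemma Gamma_nat n : Gamma n.+1%:R = n`!%:R :> R.
Proof.
elim: n => [|n IH]; first by rewrite GammaE egamma1.
by rewrite -natr1 GammaS ?ltr0n// IH -natrM factS.
Qed.

End GammaFunction.

(** * The Macdonald function and its Mellin transform *)

Section Macdonald.
Context {R : realType}.
Local Notation mu := (@lebesgue_measure R).
Local Notation RR := (measurableTypeR R * measurableTypeR R)%type.
Implicit Types (nu m x y : R).

Lemma is_derive_cosh (c x : R) : is_derive x (1 : R) (fun t => cosh (c * t)) ((expR (c * x) - expR (- (c * x))) / 2 * c).
Proof. by rewrite /cosh; apply: is_derive_eq; rewrite /GRing.scale /=; field. Qed.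

Lemma cosh_continuous : continuous (@cosh R).
Proof.
move=> x; rewrite (_ : cosh = fun t => cosh (1 * t)); last by apply/funext => t; rewrite mul1r.
exact: (is_derive_continuous_at (is_derive_cosh 1 x)).
Qed.

Lemma cosh_gt0 x : 0 < cosh x.
Proof. by rewrite /cosh divr_gt0// addr_gt0 ?expR_gt0. Qed.

Lemma coshN x : cosh (- x) = cosh x.
Proof. by rewrite /cosh opprK addrC. Qed.

(** Twice the Macdonald integral, by evenness of the integrand; being extended real valued, it makes
    sense before convergence is known. *)
Definition emac nu y : \bar R := (\int[mu]_t (expR (- (y * cosh t)) * cosh (nu * t))%:E)%E.

Let emac_fun nu (z : R * R) : R := expR (- (z.1 * cosh z.2)) * cosh (nu * z.2).

Lemma exp_cosh_continuous nu : continuous (emac_fun nu).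
Proof.
move=> z; have h : (fun w : R * R => cosh w.2) w @[w --> z] --> cosh z.2.
  by apply: continuous_comp; [exact: cvg_snd|exact: cosh_continuous].
apply: cvgM.
  apply: (continuous_comp (f := fun w : R * R => - (w.1 * cosh w.2))).
    by apply: cvgN; apply: cvgM => //; exact: cvg_fst.
  exact: continuous_expR.
apply: (continuous_comp (f := fun w : R * R => nu * w.2)); last exact: cosh_continuous.
by apply: cvgM; [exact: cvg_cst|exact: cvg_snd].
Qed.

Lemma exp_cosh_measurable nu : measurable_fun (setT : set RR)
  (fun z : RR => (expR (- (z.1 * cosh z.2)) * cosh (nu * z.2))%:E).
Proof. by apply/measurable_EFinP; apply: continuous2_measurable; exact: exp_cosh_continuous. Qed.

Lemma exp_cosh_ge0 nu y t : 0 <= expR (- (y * cosh t)) * cosh (nu * t).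
Proof. by rewrite mulr_ge0 ?expR_ge0// ltW// cosh_gt0. Qed.

Lemma emac_ge0 nu y : (0 <= emac nu y)%E.
Proof. by apply: integral_ge0 => t _; rewrite lee_fin exp_cosh_ge0. Qed.

Lemma emac_measurable nu : measurable_fun setT (emac nu).
Proof.
apply: (@measurable_fun_fubini_tonelli_F _ _ (measurableTypeR R) (measurableTypeR R) R mu
  (fun z : RR => (expR (- (z.1 * cosh z.2)) * cosh (nu * z.2))%:E) (exp_cosh_measurable nu)).
by move=> z; rewrite lee_fin exp_cosh_ge0.
Qed.

Lemma MacE nu y : Mac nu y = fine (emac nu y) / 2.
Proof.
rewrite /emac ge0_symfun_integralT.
- rewrite -set_itvcy /Mac /Rintegral.
  set J := (\int[_]_(_ in _) _)%E.
  (* An infinite integral is no exception: [fine] sends both sides to [0]. *)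
  case: J => [r||]; first by rewrite -EFinM /=; field.
    by rewrite gt0_muley//= mul0r.
  by rewrite gt0_muleNy//= mul0r.
- exact: exp_cosh_ge0.
- move=> t; apply: (continuous_comp (f := fun t : R => (y, t)) (g := emac_fun nu)).
    by apply: (cvg_pair (cvg_cst _) cvg_id).
  exact: exp_cosh_continuous.
- by move=> t /=; rewrite mulrN !coshN.
Qed.

Lemma Mac_ge0 nu y : 0 <= Mac nu y.
Proof. by rewrite MacE divr_ge0// fine_ge0// emac_ge0. Qed.

Lemma Mac_measurable nu : measurable_fun setT (Mac nu).
Proof.
rewrite (_ : Mac nu = fun y => fine (emac nu y) / 2); last by apply/funext => y; rewrite MacE.
by apply: measurable_funM => //; apply: measurableT_comp => //; exact: emac_measurable.
Qed.

Let H m nu x t := expR (m * x + nu * t - expR x * cosh t).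

Let H_continuous m nu : continuous (fun z : R * R => H m nu z.1 z.2).
Proof.
move=> z; rewrite /H.
apply: (continuous_comp (f := fun w : R * R => m * w.1 + nu * w.2 - expR w.1 * cosh w.2)); last exact: continuous_expR.
apply: cvgB; first by apply: cvgD; apply: cvgM; [exact: cvg_cst|exact: cvg_fst|exact: cvg_cst|exact: cvg_snd].
apply: cvgM.
  by apply: continuous_comp; [exact: cvg_fst|exact: continuous_expR].
by apply: continuous_comp; [exact: cvg_snd|exact: cosh_continuous].
Qed.

Let H_measurable m nu : measurable_fun (setT : set RR) (fun z : RR => (H m nu z.1 z.2)%:E).
Proof. by apply/measurable_EFinP; apply: continuous2_measurable; exact: H_continuous. Qed.

(* [x = u + t + ln 2] and then [t = (v - u) / 2] turn [expR x * cosh t] into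
   [expR u + expR v]. *)
Lemma exp_cosh_double_integral m nu :
  (\int[mu]_x \int[mu]_t (expR (m * x + nu * t - expR x * cosh t))%:E =
   (2^-1 * expR (m * ln 2))%:E * (egamma ((m - nu) / 2) * egamma ((m + nu) / 2)))%E.
Proof.
have H0 x t : (0 <= (H m nu x t)%:E)%E by rewrite lee_fin expR_ge0.
(* The order of integration is exchanged so that each affine substitution acts on the inner
   variable, the outer one being fixed. *)
rewrite (integral2_swap (H_measurable m nu) H0).
pose H' (u t : R) := H m nu (u + (t + ln 2)) t.
have mH' : measurable_fun (setT : set RR) (fun z : RR => (H' z.1 z.2)%:E).
  apply/measurable_EFinP; apply: continuous2_measurable => z.
  apply: (continuous_comp (f := fun w : R * R => (w.1 + (w.2 + ln 2), w.2)) (g := fun w => H m nu w.1 w.2)).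
    have h : (fun w : R * R => w.1 + (w.2 + ln 2)) w @[w --> z] --> z.1 + (z.2 + ln 2).
      by apply: cvgD; [exact: cvg_fst|apply: cvgD; [exact: cvg_snd|exact: cvg_cst]].
    exact: (cvg_pair h cvg_snd).
  exact: H_continuous.
transitivity (\int[mu]_t \int[mu]_u (H' u t)%:E)%E.
  apply: eq_integral => t _.
  rewrite (@integral_affine _ (fun x => (H m nu x t)%:E) 1 (t + ln 2))//.
    by apply: eq_integral => u _; rewrite mule1 mul1r.
  exact: (@measurable_fun_pair1 _ _ _ (measurableTypeR R) (measurableTypeR R) _ _ t (H_measurable m nu)).
have H'0 x t : (0 <= (H' x t)%:E)%E by rewrite lee_fin expR_ge0.
rewrite -(integral2_swap mH' H'0).
transitivity (\int[mu]_u ((expR ((m - nu) / 2 * u - expR u))%:E * ((2^-1 * expR (m * ln 2))%:E * egamma ((m + nu) / 2))))%E.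
  apply: eq_integral => u _.
  rewrite (@integral_affine _ (fun t => (H' u t)%:E) 2^-1 (- (u / 2)))//; last first.
    exact: (@measurable_fun_pair2 _ _ _ (measurableTypeR R) (measurableTypeR R) _ _ u mH').
  rewrite muleA -ge0_integralZl_EFin//; [|solve [exp_side|by rewrite ?lee_fin !mulr_ge0 ?expR_ge0]..].
  apply: eq_integral => v _; rewrite -!EFinM /H' /H; congr EFin.
  have -> : expR (u + (2^-1 * v - u / 2 + ln 2)) * cosh (2^-1 * v - u / 2) = expR u + expR v.
    rewrite /cosh mulrA mulrDr -!expRD.
    rewrite (_ : u + _ + _ = v + ln 2); last by field.
    rewrite (_ : u + _ + _ = u + ln 2); last by field.
    by rewrite !expRD lnK ?posrE//; field.
  rewrite [in RHS]mulrCA -!mulrA [in RHS]mulrC -!expRD; congr (expR _ / _).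
  by field.
rewrite ge0_integralZr//; [|exp_side..|].
  by rewrite /egamma muleCA.
by rewrite mule_ge0 ?egamma_ge0// lee_fin mulr_ge0 ?expR_ge0.
Qed.

(** [cosh (nu * t)] is the mean of two exponentials, and changing the sign of [nu] only exchanges
    the two factors [egamma]. *)
Lemma emac_mellin m nu : (\int[mu]_x ((expR (m * x))%:E * emac nu (expR x)) =
   (2^-1 * expR (m * ln 2))%:E * (egamma ((m - nu) / 2) * egamma ((m + nu) / 2)))%E.
Proof.
have mH n x : measurable_fun setT (fun t : R => (H m n x t)%:E).
  exact: (@measurable_fun_pair2 _ _ _ (measurableTypeR R) (measurableTypeR R) _ _ x (H_measurable m n)).
have mHF n : measurable_fun setT (fun x : R => \int[mu]_t (H m n x t)%:E)%E.
  apply: (@measurable_fun_fubini_tonelli_F _ _ (measurableTypeR R) (measurableTypeR R) R mu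
    _ (H_measurable m n)).
  by move=> z; rewrite lee_fin expR_ge0.
have H0 n x : (0 <= \int[mu]_t (H m n x t)%:E)%E.
  by apply: integral_ge0 => t _; rewrite lee_fin expR_ge0.
transitivity (\int[mu]_x ((\int[mu]_t (H m nu x t)%:E + \int[mu]_t (H m (- nu) x t)%:E) * (2^-1)%:E))%E.
  apply: eq_integral => x _; rewrite /emac -ge0_integralZl_EFin ?expR_ge0//; last first.
  - exact: (@measurable_fun_pair2 _ _ _ (measurableTypeR R) (measurableTypeR R) _ _ (expR x) (exp_cosh_measurable nu)).
  - by move=> t _; rewrite lee_fin exp_cosh_ge0.
  rewrite -ge0_integralD//; [|exp_side..].
  rewrite -ge0_integralZr//; last first.
  - by move=> t _; apply: adde_ge0; rewrite lee_fin; exact: expR_ge0.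
  - by apply: emeasurable_funD; exact: mH.
  apply: eq_integral => t _; rewrite -EFinM -EFinD -EFinM /H /cosh; congr EFin.
  by rewrite !expRD; rewrite !mulNr; field.
rewrite ge0_integralZr//; last first.
- by move=> t _; apply: adde_ge0.
- by apply: emeasurable_funD; exact: mHF.
rewrite ge0_integralD//; [|exact: mHF..].
rewrite !exp_cosh_double_integral opprK [(egamma ((m - nu) / 2) * _)%E]muleC.
set X := ((2^-1 * _)%:E * _)%E; have : (0 <= X)%E.
  by rewrite !mule_ge0 ?egamma_ge0// lee_fin mulr_ge0 ?expR_ge0.
case: X => [r _| _|//]; last by rewrite gt0_mulye// lte_fin.
by rewrite -EFinD -EFinM; congr EFin; field.
Qed.

(** The hypothesis makes both arguments of [Gamma] positive. The integral is then finite, so [emac]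
    is finite almost everywhere, and there [Mac] is half of it. *)
Lemma Mac_mellin m nu : `|nu| < m ->
  (\int[mu]_x (expR (m * x) * Mac nu (expR x))%:E =
   (4^-1 * expR (m * ln 2) * (Gamma ((m - nu) / 2) * Gamma ((m + nu) / 2)))%:E)%E.
Proof.
move=> num; have [h1 h2] : 0 < (m - nu) / 2 /\ 0 < (m + nu) / 2.
  by move: num; rewrite ltr_norml => /andP[? ?]; split; lra.
have := emac_mellin m nu; rewrite !Gamma_egamma// -!EFinM => eM.
pose F x := ((expR (m * x))%:E * emac nu (expR x))%E.
have mexp : measurable_fun (setT : set R) (@expR R) by exact: continuous_measurable_fun (@continuous_expR R).
have mF : measurable_fun setT F.
  apply: emeasurable_funM.
    by apply/measurable_EFinP; apply: continuous_measurable_fun => x; apply: is_derive_continuous_at.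
  by apply: (measurableT_comp (emac_measurable nu)).
have F0 x : (0 <= F x)%E by rewrite mule_ge0 ?emac_ge0// lee_fin expR_ge0.
have iF : mu.-integrable setT F.
  apply/integrableP; split => //.
  by under eq_integral do rewrite gee0_abs//; rewrite eM ltry.
transitivity (\int[mu]_x (F x * (2^-1)%:E))%E.
  apply: ge0_ae_eq_integral => //.
  - apply/measurable_EFinP; apply: measurable_funM.
      by apply: continuous_measurable_fun => x; apply: is_derive_continuous_at.
    exact: (measurableT_comp (Mac_measurable nu)).
  - exact: emeasurable_funM.
  - by move=> x _; rewrite lee_fin mulr_ge0 ?expR_ge0// Mac_ge0.
  - by move=> x _; rewrite mule_ge0.
  have := integrable_ae measurableT iF; apply: filterS => x /(_ Logic.I) Ffin _.
  rewrite /F MacE; have : emac nu (expR x) \is a fin_num.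
    move: Ffin; rewrite /F ge0_fin_numE; last by exact: F0.
    rewrite ge0_fin_numE ?emac_ge0//.
    by case: (emac nu (expR x)) => [r _|+|//]; rewrite ?ltry// gt0_muley ?lte_fin ?expR_gt0.
  by case: (emac nu (expR x)) => // r _; rewrite -!EFinM /= mulrA.
rewrite ge0_integralZr//.
by rewrite eM -EFinM; congr EFin; field.
Qed.

End Macdonald.

(** * Radial moments of the density *)

Section RadialMoments.
Context {R : realType}.
Local Notation mu := (@lebesgue_measure R).
Implicit Types (nu : R) (k : nat).

Lemma integral_normr (G : R -> \bar R) : measurable_fun setT G -> (forall x, 0 <= G x)%E ->
  (\int[mu]_r G `|r|%R = \int[mu]_x (G (expR x) * (2 * expR x)%:E))%E.
Proof.
move=> mG G0; have mGn : measurable_fun setT (fun r : R => G `|r|).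
  by apply: (measurableT_comp mG); apply: continuous_measurable_fun; exact: norm_continuous.
transitivity (\int[mu]_(r in `]-oo, 0%R]%classic `|` `]0%R, +oo[%classic) G `|r|%R)%E.
  congr (integral _ _ _).
  by apply/seteqP; split => x //= _; rewrite !in_itv/= andbT; case: leP; [left|right].
rewrite ge0_integral_setU//=; first last.
- apply/disj_setPS => x [] /=; rewrite !in_itv/= andbT => h1 h2.
  by move: (le_lt_trans h1 h2); rewrite ltxx.
- exact: measurable_funTS.
have -> : (\int[mu]_(r in `]-oo, 0%R]) G `|r|%R = \int[mu]_(r in `]0%R, +oo[) G `|r|%R)%E.
  rewrite [RHS]integral_itv_obnd_cbnd; last exact: measurable_funTS.
  rewrite (@ge0_integration_by_substitution0 _ (fun r => G `|r|%R))//.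
  by apply: eq_integral => r _; rewrite normrN.
rewrite (@integral_expR _ (fun r => G `|r|%R))//.
have mexp : measurable_fun setT (fun x : R => (expR x)%:E).
  by apply/measurable_EFinP; exact: continuous_measurable_fun (@continuous_expR R).
have mGe : measurable_fun setT (fun x : R => G `|expR x|).
  apply: (measurableT_comp mGn); exact: continuous_measurable_fun (@continuous_expR R).
rewrite -ge0_integralD//; [|solve [exact: emeasurable_funM|by move=> x _; rewrite mule_ge0 ?lee_fin ?expR_ge0]..].
apply: eq_integral => x _; rewrite ger0_norm ?expR_ge0//.
rewrite -ge0_muleDr ?lee_fin ?expR_ge0//.
by rewrite -EFinD; congr (_ * _%:E)%E; ring.
Qed.

Definition rdensity nu r : R :=
  r `^ (2 * nu + 2) / (pi * 2 `^ nu * Gamma (nu + 1)) * Mac nu (r ^+ 2).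

Lemma densityE nu (p : quat R) : density nu p = rdensity nu `|p|.
Proof. by []. Qed.

Lemma rdensity_measurable nu : measurable_fun setT (rdensity nu).
Proof.
apply: measurable_funM.
  by apply: measurable_funM => //; exact: measurable_powR.
apply: (measurableT_comp (Mac_measurable nu)).
by apply: continuous_measurable_fun => x; exact: exprn_continuous.
Qed.

Lemma rdensity_ge0 nu r : -1 < nu -> 0 <= rdensity nu r.
Proof.
move=> nu1; have /Gamma_gt0/ltW g0 : 0 < nu + 1 by lra.
by rewrite mulr_ge0 ?Mac_ge0// divr_ge0 ?powR_ge0// !mulr_ge0 ?pi_ge0 ?powR_ge0.
Qed.

(** The exponent is [4 * k] from the squared norm of [(p ^+ 2) ^+ k], plus [1] from the polar
    Jacobian; [pi] is the factor left by Parseval over a half turn. *)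
Lemma density_moment nu k : -1 < nu ->
  (\int[mu]_r (pi * `|r| ^+ (4 * k + 1) * rdensity nu `|r|)%:E =
   (4 ^+ k * k`!%:R * (Gamma (k%:R + nu + 1) / Gamma (nu + 1)))%:E)%E.
Proof.
move=> nu1; have g0 : 0 < Gamma (nu + 1) by apply: Gamma_gt0; lra.
pose F (r : R) : \bar R := (pi * r ^+ (4 * k + 1) * rdensity nu r)%:E.
have C0 : 0 < 2 `^ nu by rewrite powR_gt0.
have pn0 : pi != 0 :> R by rewrite gt_eqF ?pi_gt0.
have cn0 : 2 `^ nu != 0 by rewrite gt_eqF.
have gn0 : Gamma (nu + 1) != 0 by rewrite gt_eqF.
(* With |r| = exp (y / 2) the argument of [Mac] becomes exp y, and the powers of |r| together with
   the Jacobian give the exponent (4k + 1) / 2 + (nu + 1) + 1/2. *)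
pose m : R := 2 * k%:R + nu + 2.
have num : `|nu| < m.
  have := ler0n R k; rewrite /m ltr_norml => k0; apply/andP; split; lra.
pose G (r : R) := F `|r|; have G0 r : (0 <= G r)%E.
  rewrite lee_fin; apply: mulr_ge0; last exact: rdensity_ge0.
  by apply: mulr_ge0; [exact: pi_ge0|exact: exprn_ge0].
have mG : measurable_fun setT G.
  have mn : measurable_fun (setT : set R) (fun r : R => `|r|).
    by apply: continuous_measurable_fun; exact: norm_continuous.
  apply/measurable_EFinP; apply: measurable_funM; last exact: (measurableT_comp (rdensity_measurable nu)).
  by apply: measurable_funM => //; exact: measurable_funX.
have me : measurable_fun (setT : set R) (@expR R) by exact: continuous_measurable_fun (@continuous_expR R).
transitivity (\int[mu]_r G `|r|%R)%E; first by apply: eq_integral => r _; rewrite /G normr_id.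
rewrite (integral_normr mG G0) (@integral_affine _ (fun x => G (expR x) * (2 * expR x)%:E)%E 2^-1 0)//; last 2 first.
- apply: emeasurable_funM; first exact: (measurableT_comp mG).
  by apply/measurable_EFinP; apply: measurable_funM.
- by move=> x; rewrite mule_ge0// lee_fin mulr_ge0// expR_ge0.
transitivity (\int[mu]_y (((2 `^ nu * Gamma (nu + 1))^-1)%:E * (expR (m * y) * Mac nu (expR y))%:E))%E.
  apply: eq_integral => y _; rewrite addr0 -!EFinM; congr EFin.
  rewrite ger0_norm ?expR_ge0// /rdensity.
  rewrite (_ : expR (2^-1 * y) ^+ 2 = expR y); last by rewrite -expRM_natl; congr expR; lra.
  rewrite [expR (2^-1 * y) `^ _]/powR (gt_eqF (expR_gt0 _)) expRK -expRM_natl.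
  rewrite (_ : m * y = (4 * k + 1)%:R * (2^-1 * y) + (2 * nu + 2) * (2^-1 * y) + 2^-1 * y); last first.
    by rewrite natrD natrM /m; field.
  rewrite !expRD; move: (@pi R) pn0 => P pn0; field.
  by rewrite pn0 cn0 gn0.
rewrite ge0_integralZl_EFin; last 4 first.
- exact: measurableT.
- by move=> x _; rewrite lee_fin mulr_ge0 ?expR_ge0 ?Mac_ge0.
- apply/measurable_EFinP; apply: measurable_funM; last exact: (measurableT_comp (Mac_measurable nu)).
  by apply: continuous_measurable_fun => x; apply: is_derive_continuous_at.
- by rewrite invr_ge0 mulr_ge0 ?ltW.
rewrite Mac_mellin// -EFinM; congr EFin.
rewrite (_ : (m - nu) / 2 = k.+1%:R); last by rewrite /m -natr1; field.
rewrite (_ : (m + nu) / 2 = k%:R + nu + 1); last by rewrite /m; field.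
rewrite Gamma_nat.
rewrite (_ : expR (m * ln 2) = 4 ^+ k * 2 `^ nu * 4); last first.
  rewrite /powR (_ : (2 == 0 :> R) = false) ?pnatr_eq0// -[4 ^+ k](@lnK R) ?posrE ?exprn_gt0//.
  rewrite -[X in _ = _ * X](@lnK R) ?posrE// -!expRD; congr expR.
  rewrite lnXn// (_ : 4 = 2 * 2 :> R); last by ring.
  by rewrite lnM ?posrE// /m -mulr_natl; ring.
by field; rewrite !gt_eqF.
Qed.

End RadialMoments.

(** * Norms and coefficients *)

Section Parseval.
Context {R : realType}.
Local Notation mu := (@lebesgue_measure R).
Implicit Types (a b : nat -> quat R) (J : quat R).

Lemma series_tail_le (u : nat -> quat R) s (v : nat -> R) n :
  (forall n, `|u n| <= v n) -> cvgn (series v) -> series u @ \oo --> s ->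
  `|s - series u n| <= limn (series v) - series v n.
Proof.
move=> uv cv us.
have c1 : (fun m => `|series u m - series u n|) @ \oo --> `|s - series u n|.
  by apply: cvg_norm; apply: cvgB => //; exact: cvg_cst.
have c2 : (fun m => series v m - series v n) @ \oo --> limn (series v) - series v n.
  by apply: cvgB => //; exact: cvg_cst.
apply: (ler_cvg_to c1 c2); near=> m; have nm : (n <= m)%N by near: m; exact: nbhs_infty_ge.
rewrite !sub_series nm; apply: le_trans (ler_norm_sum _ _ _) _.
by apply: ler_sum => i _; exact: uv.
Unshelve. all: by end_near. Qed.

(** The remainders are bounded on the circle by the tails of [v], uniformly in the angle, so
    integration may be done term by term. *)
Lemma qcint_series (u : nat -> R -> quat R) (U : R -> quat R) (v : nat -> R) :
  (forall n, continuous (u n)) -> continuous U -> (forall n t, `|u n t| <= v n) ->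
  cvgn (series v) -> (forall t, series (fun n => u n t) @ \oo --> U t) ->
  series (fun n => qcint (u n)) @ \oo --> qcint U.
Proof.
move=> cu cU uv cv uU.
have cs m : continuous (fun t => \sum_(n < m) u n t).
  elim: m => [|m ih]; first by under eq_fun do rewrite big_ord0; exact: cst_continuous.
  under eq_fun do rewrite big_ord_recr /=.
  by move=> t; exact: (cvgD (ih t) (cu m t)).
have sE m : qcint (fun t => \sum_(n < m) u n t) = series (fun n => qcint (u n)) m.
  rewrite /series /= big_mkord; elim: m => [|m ih].
    rewrite big_ord0 -[RHS](scaler0 _ (2 * pi)) -qcint_cst; congr qcint.
    by apply/funext => t; rewrite big_ord0.
  rewrite big_ord_recr /= -ih -qcintD//; last exact: cs.
  by congr qcint; apply/funext => t; rewrite big_ord_recr.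
have cd m : continuous (fun t => U t - series (fun n => u n t) m).
  rewrite (_ : (fun t => _) = fun t => U t - \sum_(n < m) u n t); last first.
    by apply/funext => t; rewrite /series /= big_mkord.
  by move=> t; apply: cvgB; [exact: cU|exact: cs].
have dE m : qcint U - series (fun n => qcint (u n)) m = qcint (fun t => U t - series (fun n => u n t) m).
  apply/eqP; rewrite subr_eq -sE -(qcintD (cd m) (cs m)).
  by apply/eqP; congr qcint; apply/funext => t; rewrite /series /= big_mkord subrK.
apply/cvgrPdist_le => e e0.
have p8 : 0 < 8 * pi :> R by rewrite mulr_gt0// pi_gt0.
have hv : \forall m \near \oo, `|limn (series v) - series v m| <= e / (8 * pi).
  by move/cvgrPdist_le : cv => h; apply: h; rewrite divr_gt0.
near=> m; rewrite dE; apply: (@le_trans _ _ (8 * pi * (limn (series v) - series v m))).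
  by apply: qcint_norm; [exact: cd|move=> t _; exact: series_tail_le].
rewrite mulrC -ler_pdivlMr//; apply: le_trans (ler_norm _) _.
by near: m.
Unshelve. all: by end_near. Qed.

Variables (b : nat -> quat R) (J : quat R) (rho : R).
Hypotheses (eb : entire_coef b) (hJ : unit_sphere J).

Let F s := qseries b (rho *: circ J s).
Let v n : R := `|rho| ^+ n * `|b n|.
Let M : R := limn (series v).

Let termE n s : (rho *: circ J s) ^+ n * b n = rho ^+ n *: (circ J (n%:R * s) * b n).
Proof. by rewrite exprZn circX// scalerAl. Qed.

Let term_norm n s : `|(rho *: circ J s) ^+ n * b n| = v n.
Proof. by rewrite termE normrZ normrX qnormM circ_norm// mul1r. Qed.

Let term_continuous n : continuous (fun s => (rho *: circ J s) ^+ n * b n).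
Proof.
under eq_fun do rewrite termE; move=> s; apply: cvgZl_tmp; move: s.
by apply: quatM_continuous; [exact: circ_scale_continuous|exact: cst_continuous].
Qed.

Let F_continuous : continuous F.
Proof.
move=> s; apply: (@continuous_comp _ _ _ (fun s => rho *: circ J s) (qseries b)).
  by apply: cvgZl_tmp; exact: circ_continuous.
exact: qseries_continuous.
Qed.

Let F_norm s : `|F s| <= M.
Proof.
have vM : series v @ \oo --> M by exact: (eb (normr_ge0 rho)).
apply: (qsum_norm_le (u := fun n => (rho *: circ J s) ^+ n * b n) (v := v)) => // [n|]; last exact: qseries_cvg.
by rewrite term_norm.
Qed.

(** Orthogonality of the exponentials kills every term but the [k]-th, so the integrated partial
    sums are constant beyond [k]. *)
Let F_coef k : qcint (fun s => circ J (- k%:R * s) * F s) = (2 * pi * rho ^+ k) *: b k.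
Proof.
have tE n s : circ J (- k%:R * s) * ((rho *: circ J s) ^+ n * b n) =
    circ J ((n%:R - k%:R) * s) * (rho ^+ n *: b n).
  by rewrite termE -scalerAr mulrA -circD// scalerAr; congr (circ _ _ * _); ring.
have h : series (fun n => qcint (fun s => circ J (- k%:R * s) * ((rho *: circ J s) ^+ n * b n))) @ \oo -->
    qcint (fun s => circ J (- k%:R * s) * F s).
  apply: (qcint_series (v := v)).
  - by move=> n; apply: quatM_continuous; [exact: circ_scale_continuous|exact: term_continuous].
  - by apply: quatM_continuous; [exact: circ_scale_continuous|exact: F_continuous].
  - by move=> n s; rewrite qnormM circ_norm// mul1r term_norm.
  - exact: eb.
  - by move=> s; apply: qsumMl; exact: qseries_cvg.
have {}h : (fun n => if (k < n)%N then (2 * pi * rho ^+ k) *: b k else 0) @ \oo --> qcint (fun s => circ J (- k%:R * s) * F s).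
  apply: cvg_trans h; apply: near_eq_cvg; near=> n.
  have kn : (k < n)%N by near: n; exact: nbhs_infty_gt.
  rewrite kn /series /= big_mkord (bigD1 (Ordinal kn))//= big1 ?addr0.
    rewrite (_ : (fun s => _) = fun=> rho ^+ k *: b k).
      by rewrite qcint_cst scalerA.
    by apply/funext => s; rewrite tE subrr mul0r circ0 mul1r.
  move=> i ik; rewrite (_ : (fun s => _) = fun s => circ J ((i%:R - k%:R) * s) * (rho ^+ i *: b i)).
    rewrite qcintMr; last exact: circ_scale_continuous.
    rewrite qcint_circ ?mul0r//.
      by rewrite subr_eq0 eqr_nat.
    have c2 m : circ J (m%:R * (2 * pi)) = 1 by rewrite -[X in circ J X]add0r circ_2pi// circ0.
    by rewrite mulrBl circD// c2 mul1r -circ_conj// c2 conjq1.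
  by apply/funext => s; exact: tE.
suff h2 : (fun n => if (k < n)%N then (2 * pi * rho ^+ k) *: b k else 0) @ \oo --> (2 * pi * rho ^+ k) *: b k.
  by rewrite -(cvg_lim _ h)// -[RHS](cvg_lim _ h2).
apply: cvg_near_cst; near=> n.
by rewrite ifT//; near: n; exact: nbhs_infty_gt.
Unshelve. all: by end_near. Qed.

(** Only the conjugate factor is expanded; each term is then a Fourier coefficient of [F], known
    from [F_coef]. No double series arises. *)
Lemma circle_parseval :
  series (fun n => 2 * pi * (rho ^+ n ^+ 2 * `|b n| ^+ 2)) @ \oo -->
  cint (fun s => `|qseries b (rho *: circ J s)| ^+ 2).
Proof.
have tE n s : conjq ((rho *: circ J s) ^+ n * b n) * F s =
    (rho ^+ n *: conjq (b n)) * (circ J (- n%:R * s) * F s).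
  by rewrite termE conjqZ conjqM circ_conj// -mulNr scalerAl -!scalerAl mulrA.
have h : series (fun n => qcint (fun s => conjq ((rho *: circ J s) ^+ n * b n) * F s)) @ \oo -->
    qcint (fun s => conjq (F s) * F s).
  apply: (qcint_series (v := fun n => M * v n)).
  - by move=> n; apply: quatM_continuous; [apply: conjq_continuous; exact: term_continuous|exact: F_continuous].
  - by apply: quatM_continuous; [exact: conjq_continuous|exact: F_continuous].
  - by move=> n s; rewrite qnormM qnorm_conj term_norm mulrC; apply: ler_wpM2r; rewrite ?F_norm// /v mulr_ge0// exprn_ge0.
  - by apply/cvg_ex; eexists; apply: rsumZ; exact: eb.
  - move=> s; apply: qsumMr.
    rewrite (_ : series _ = conjq \o series (fun n => (rho *: circ J s) ^+ n * b n)); last first.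
      apply/funext => n; rewrite /series /=; elim: n => [|n ih].
        by rewrite !big_geq//; apply: quat_eqP; split; rewrite //= oppr0.
      by rewrite !big_nat_recr//= conjqD ih.
    apply: (cvg_conjq (f := series (fun n => (rho *: circ J s) ^+ n * b n))).
    exact: qseries_cvg.
have {}h : (fun n => (series (fun n => 2 * pi * (rho ^+ n ^+ 2 * `|b n| ^+ 2)) n)%:A) @ \oo -->
    qcint (fun s => conjq (F s) * F s).
  apply: cvg_trans h; apply: near_eq_cvg; near=> n.
  rewrite /series /= scaler_suml; apply: eq_bigr => i _.
  under eq_fun do rewrite tE.
  rewrite qcintMl; last by apply: quatM_continuous; [exact: circ_scale_continuous|exact: F_continuous].
  rewrite F_coef -scalerAl -scalerAr scalerA mul_conjq scalerA.
  by congr (_ *: _); ring.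
have [h1 _ _ _] := cvg_comps h.
rewrite (_ : cint _ = qre (qcint (fun s => conjq (F s) * F s))); last first.
  transitivity (cint (fun s => qre (conjq (F s) * F s))) => //.
  by congr cint; apply/funext => s; rewrite mul_conjq /= mulr1.
by apply: cvg_trans h1; apply: near_eq_cvg; near=> n; rewrite /= mulr1.
Unshelve. all: by end_near. Qed.

End Parseval.

(** * Norm integrals on a slice *)

Section SliceNorm.
Context {R : realType}.
Local Notation mu := (@lebesgue_measure R).
Local Notation RR := (measurableTypeR R * measurableTypeR R)%type.
Implicit Types (b : nat -> quat R) (J : quat R) (nu : R).

Lemma continuous_slice_norm J : continuous (fun z : R * R => `|slice J z|).
Proof. by move=> z; apply: cvg_norm; exact: slice_continuous. Qed.

Lemma density_slice_measurable nu J :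
  measurable_fun (setT : set RR) (fun z : RR => density nu (slice J z)).
Proof.
apply: (@measurableT_comp _ _ _ RR R R (rdensity nu) _ (fun z : RR => `|slice J z|)).
  exact: rdensity_measurable.
exact: continuous2_measurable (@continuous_slice_norm J).
Qed.

(** The substitution is [s = 2 * t + pi]; the endpoints of the interval are null. *)
Lemma integral_half_turn (H : R -> R) : continuous H -> (forall s, 0 <= H s) ->
  (\int[mu]_(t in `](- (pi / 2))%R, (pi / 2)%R[) (H (2 * t)%R)%:E =
   (2^-1 * cint (fun s => H (s - pi)))%:E)%E.
Proof.
move=> cH H0; pose D : set R := `](- (pi / 2)), (pi / 2)[%classic.
have cH2 : continuous (fun t : R => H (2 * t)).
  move=> t; apply: (@continuous_comp _ _ _ (fun t : R => 2 * t) H); last exact: cH.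
  by apply: cvgMl_tmp; exact: cvg_id.
have cHp : continuous (fun s : R => H (s - pi)).
  move=> t; apply: (@continuous_comp _ _ _ (fun t : R => t - pi) H); last exact: cH.
  by apply: cvgB; [exact: cvg_id|exact: cvg_cst].
have mD : measurable_fun (setT : set R) (fun y => (\1_D y)%:E : \bar R).
  by apply/measurable_EFinP; apply: measurable_indic; exact: measurable_itv.
rewrite -(integral_mulindic D) (@integral_affine _ _ 2^-1 (- (pi / 2)))//; last first.
- by move=> t; rewrite mule_ge0 ?lee_fin.
- apply: emeasurable_funM => //; apply/measurable_EFinP.
  exact: continuous_measurable_fun.
transitivity (\int[mu]_s (((H (s - pi))%:E * (2^-1)%:E) * (\1_(`]0, 2 * pi[%classic : set R) s)%:E))%E.
  apply: eq_integral => s _; rewrite muleAC; congr (_ * _ * _%:E)%E.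
    by congr (H _)%:E; field.
  rewrite !indicE; congr (nat_of_bool _)%:R; apply/idP/idP; rewrite !inE /D /= !in_itv /= => /andP[h1 h2]; apply/andP; split; lra.
rewrite integral_mulindic ge0_integralZr//; last first.
- by move=> s _; rewrite lee_fin.
- apply/measurable_EFinP; apply: measurable_funTS; exact: continuous_measurable_fun.
rewrite muleC -(@integral_itv_bndoo _ _ _ _ true false); last first.
  apply/measurable_EFinP; apply: measurable_funTS; exact: continuous_measurable_fun.
rewrite EFinM; congr (_ * _)%E.
rewrite /cint /Rintegral fineK//.
exact: (integrable_fin_num _ (circle_integrable cHp)).
Qed.

(** For [r < 0] the factor |r| on the sine reverses the sense of rotation, which amounts to
    replacing [J] by [- J]. Squaring doubles the angle, so a half turn covers the circle. *)
Lemma slice_sqr_polar J (r t : R) : unit_sphere J ->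
  slice J (r * cos t, `|r| * sin t) ^+ 2 =
  r ^+ 2 *: circ (if 0 <= r then J else - J) (2 * t).
Proof.
move=> hJ; set J' := if _ then _ else _.
have hJ' : unit_sphere J' by rewrite /J'; case: ifP => // _; rewrite /unit_sphere /= sqrrN.
suff -> : slice J (r * cos t, `|r| * sin t) = r *: circ J' t by rewrite exprZn circX.
rewrite /J' /circ /slice /= scalerDr !scalerA; congr (_ + _).
by case: ltP => [r0|r0]; rewrite ?(ltr0_norm r0) ?(ger0_norm r0)// scalerN mulNr scaleNr.
Qed.

Lemma half_circle_parseval b J (r : R) : entire_coef b -> unit_sphere J ->
  (\int[mu]_(t in `](- (pi / 2))%R, (pi / 2)%R[)
     (`|qseries b (slice J (r * cos t, `|r| * sin t) ^+ 2)| ^+ 2)%:E =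
   \sum_(k <oo) (pi * (`|r| ^+ (4 * k) * `|b k| ^+ 2))%:E)%E.
Proof.
move=> eb hJ; pose J' := if 0 <= r then J else - J.
have hJ' : unit_sphere J' by rewrite /J'; case: ifP => // _; rewrite /unit_sphere /= sqrrN.
pose H s := `|qseries b (r ^+ 2 *: circ J' s)| ^+ 2.
under eq_integral do rewrite slice_sqr_polar// -/J' -/(H _).
rewrite (@integral_half_turn H).
(* The shift by [pi] changes the sign of the exponential. The sign is moved to the radius, which
   [circle_parseval] allows to be negative. *)
- have -> : (fun s => H (s - pi)) = (fun s => `|qseries b ((- r ^+ 2) *: circ J' s)| ^+ 2).
    apply/funext => s.
    have c1 : circ J' (- pi) = -1.
      by rewrite /circ cosN sinN cospi sinpi oppr0 slice_real scaleN1r.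
    by rewrite /H (circD _ _ hJ') c1 mulrN1 scalerN scaleNr.
  have := @circle_parseval _ _ _ (- r ^+ 2) eb hJ'.
  move=> h0; have h := cvgM (cvg_cst (2^-1 : R)) h0.
  apply/esym/cvg_lim => //.
  rewrite (_ : (fun n => _) = (fun n => (2^-1 * series (fun n => 2 * pi * ((- r ^+ 2) ^+ n ^+ 2 * `|b n| ^+ 2)) n)%:E)).
    by apply/fine_cvgP; split; [exact: nearW|exact: h].
  apply/funext => n; rewrite sumEFin; congr EFin; rewrite /series /= mulr_sumr.
  apply: eq_bigr => k _; rewrite (_ : `|r| ^+ (4 * k) = ((- r ^+ 2) ^+ k) ^+ 2).
    by field.
  by rewrite [RHS]exprAC sqrrN exprM (exprM _ 2 2) real_normK// num_real.
- move=> s; apply: cvgM; apply: cvg_norm;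
    apply: (@continuous_comp _ _ _ (fun s => r ^+ 2 *: circ J' s) (qseries b));
    [apply: cvgZl_tmp; exact: circ_continuous|exact: qseries_continuous|
     apply: cvgZl_tmp; exact: circ_continuous|exact: qseries_continuous].
- by move=> s; rewrite exprn_ge0.
Qed.

Definition moment nu k : R := 4 ^+ k * k`!%:R * (Gamma (k%:R + nu + 1) / Gamma (nu + 1)).

Lemma slice_sqr_norm b J nu : entire_coef b -> unit_sphere J -> -1 < nu ->
  int_slice J (fun p => `|qseries b (p ^+ 2)| ^+ 2 * density nu p) =
  (\sum_(k <oo) (moment nu k * `|b k| ^+ 2)%:E)%E.
Proof.
move=> eb hJ nu1; rewrite /int_slice /leb2.
have cF : continuous (fun z : R * R => `|qseries b (slice J z ^+ 2)|).
  move=> z; apply: cvg_norm; apply: (@continuous_comp _ _ _ (fun z => slice J z ^+ 2) (qseries b)); last exact: qseries_continuous.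
  by apply: quatM_continuous; exact: slice_continuous.
have mF : measurable_fun (setT : set RR) (fun z : RR => `|qseries b (slice J z ^+ 2)|).
  exact: continuous2_measurable cF.
have mn : measurable_fun (setT : set R) (fun r : R => `|r|).
  by apply: continuous_measurable_fun; exact: norm_continuous.
have mm k : measurable_fun (setT : set R) (fun r : R => (pi * `|r| ^+ (4 * k + 1) * rdensity nu `|r|)%:E).
  apply/measurable_EFinP; apply: measurable_funM; last exact: (measurableT_comp (rdensity_measurable nu)).
  by apply: measurable_funM => //; exact: measurable_funX.
have m0 k (r : R) : (0 <= (pi * `|r| ^+ (4 * k + 1) * rdensity nu `|r|)%:E)%E.
  rewrite lee_fin; apply: mulr_ge0; last exact: rdensity_ge0.
  by apply: mulr_ge0; [exact: pi_ge0|exact: exprn_ge0].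
rewrite polar_integral; last 2 first.
- apply/measurable_EFinP; apply: measurable_funM; last exact: density_slice_measurable.
  exact: measurable_funX.
- by move=> z; rewrite lee_fin mulr_ge0 ?exprn_ge0// densityE rdensity_ge0.
transitivity (\int[mu]_r \sum_(k <oo) ((`|b k| ^+ 2)%:E * (pi * `|r| ^+ (4 * k + 1) * rdensity nu `|r|)%:E))%E.
  apply: eq_integral => r _.
  have E t : `|slice J (r * cos t, `|r| * sin t)| = `|r|.
    rewrite slice_norm//= !exprMn real_normK ?num_real//.
    by rewrite -mulrDr cos2Dsin2 mulr1 sqrtr_sqr.
  under eq_integral do rewrite densityE E -EFinM mulrA [X in X * _]mulrC -mulrA mulrC EFinM.
  rewrite ge0_integralZl_EFin//; last 2 first.
  - apply/measurable_EFinP; apply: measurable_funTS; apply: measurable_funX.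
    apply: continuous_measurable_fun => t.
    apply: (@continuous_comp _ _ _ (fun t => (r * cos t, `|r| * sin t)) (fun z : R * R => `|qseries b (slice J z ^+ 2)|)); last exact: cF.
    have h1 : (fun t => r * cos t) s @[s --> t] --> r * cos t by apply: cvgMl_tmp; exact: continuous_cos.
    have h2 : (fun t => `|r| * sin t) s @[s --> t] --> `|r| * sin t by apply: cvgMl_tmp; exact: continuous_sin.
    exact: (cvg_pair h1 h2).
  - by rewrite mulr_ge0 ?rdensity_ge0.
  rewrite half_circle_parseval// -nneseriesZl; last first.
    by move=> k _; rewrite lee_fin mulr_ge0 ?pi_ge0// mulr_ge0 ?exprn_ge0.
  apply: eq_eseriesr => k _; rewrite -!EFinM; congr EFin; rewrite addn1 (exprS `|r| (4 * k)).
  by move: (`|r|) (`|b k|) (4 * k)%N (@pi R) => x y m P; ring.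
rewrite integral_nneseries//; last 2 first.
- by move=> k; apply: emeasurable_funM => //; exact: mm.
- by move=> k r _; rewrite mule_ge0.
apply: eq_eseriesr => k _; rewrite ge0_integralZl_EFin//; [|solve [exact: mm|by move=> r _; exact: m0|by rewrite exprn_ge0]..].
by rewrite density_moment// -EFinM mulrC.
Qed.

End SliceNorm.

(** * Even and odd coefficients and the weights [beta_coef] *)

Section EvenOdd.
Context {R : realType}.
Implicit Types (a : nat -> quat R) (alpha : R).

Definition even_coef a k := a k.*2.
Definition odd_coef a k := a k.*2.+1.

Lemma sum_double (V : nmodType) (u : nat -> V) n :
  \sum_(0 <= k < n.*2) u k = \sum_(0 <= k < n) u k.*2 + \sum_(0 <= k < n) u k.*2.+1.
Proof.
elim: n => [|n ih]; first by rewrite !big_geq// addr0.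
rewrite doubleS !big_nat_recr//= ih.
by rewrite -!addrA; congr (_ + _); rewrite [RHS]addrCA.
Qed.

Lemma cvg_double (T : topologicalType) (u : nat -> T) (l : T) :
  u @ \oo --> l -> (fun n => u n.*2) @ \oo --> l.
Proof.
move=> ul; apply: (cvg_comp (fun n => n.*2) u) ul.
move=> A [N _ NA]; exists N => // n /= Nn; apply: NA => /=.
by rewrite (leq_trans Nn)// -addnn leq_addl.
Qed.

(** At the radius [s = r + 1], which is at least [1], the powers of exponent [k.*2] and [k.*2.+1]
    dominate [r ^+ k], so the full series bounds both subseries. *)
Lemma entire_sub a (r : R) : entire_coef a -> 0 <= r ->
  cvgn (series (fun k => r ^+ k * `|even_coef a k|)) /\
  cvgn (series (fun k => r ^+ k * `|odd_coef a k|)).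
Proof.
move=> ea r0; pose s := r + 1.
have s1 : 1 <= s by rewrite lerDr.
have s0 : 0 <= s by rewrite (le_trans _ s1).
have rs : r <= s by rewrite lerDl.
have b n : 0 <= s ^+ n * `|a n| by rewrite mulr_ge0 ?exprn_ge0.
pose S := limn (series (fun n => s ^+ n * `|a n|)).
have le n : series (fun n => s ^+ n * `|a n|) n <= S.
  apply: nondecreasing_cvgn_le (ea _ s0) n.
  by apply/nondecreasing_seqP => n; rewrite -subr_ge0 /series /= big_nat_recr//= addrAC subrr add0r.
have le2 n : series (fun k => r ^+ k * `|even_coef a k|) n + series (fun k => r ^+ k * `|odd_coef a k|) n <= S.
  apply: le_trans (le n.*2); rewrite /series /= sum_double; apply: lerD; apply: ler_sum => k _;
    rewrite ler_wpM2r//; apply: (@le_trans _ _ (s ^+ k)); rewrite ?lerXn2r// ?nnegrE// ler_weXn2l//.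
    by rewrite -addnn leq_addl.
  by rewrite -addnn ltnW// ltnS leq_addl.
have p u n : (forall k, 0 <= u k) -> 0 <= series u n :> R.
  by move=> u0; rewrite /series /=; apply: sumr_ge0.
have e0 k : 0 <= r ^+ k * `|even_coef a k| by rewrite mulr_ge0 ?exprn_ge0.
have o0 k : 0 <= r ^+ k * `|odd_coef a k| by rewrite mulr_ge0 ?exprn_ge0.
split; apply: nondecreasing_is_cvgn.
- by apply/nondecreasing_seqP => n; rewrite -subr_ge0 /series /= big_nat_recr//= addrAC subrr add0r.
- by exists S => _ [n _ <-]; apply: le_trans (le2 n); rewrite lerDl p.
- by apply/nondecreasing_seqP => n; rewrite -subr_ge0 /series /= big_nat_recr//= addrAC subrr add0r.
- by exists S => _ [n _ <-]; apply: le_trans (le2 n); rewrite lerDr p.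
Qed.

Lemma entire_even a : entire_coef a -> entire_coef (even_coef a).
Proof. by move=> ea r r0; case: (entire_sub ea r0). Qed.

Lemma entire_odd a : entire_coef a -> entire_coef (odd_coef a).
Proof. by move=> ea r r0; case: (entire_sub ea r0). Qed.

Lemma qseries_even_odd a q : entire_coef a ->
  qseries a q = qseries (even_coef a) (q ^+ 2) + q * qseries (odd_coef a) (q ^+ 2).
Proof.
move=> ea; have he := @qseries_cvg _ _ (q ^+ 2) (entire_even ea).
have ho := qsumMl (c := q) (@qseries_cvg _ _ (q ^+ 2) (entire_odd ea)).
have h := cvg_double (@qseries_cvg _ _ q ea).
rewrite (_ : (fun n => _) = (fun n => series (fun n => q ^+ 2 ^+ n * even_coef a n) n +
    series (fun n => q * (q ^+ 2 ^+ n * odd_coef a n)) n)) in h.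
  by rewrite -(cvg_lim _ h)//; apply: cvg_lim => //; exact: cvgD.
apply/funext => n; rewrite /series /= sum_double; congr (_ + _); apply: eq_bigr => k _.
  by rewrite /even_coef -muln2 mulnC exprM.
by rewrite /odd_coef mulrA exprS -muln2 mulnC exprM.
Qed.

Lemma half_double (q : quat R) : 2^-1 *: (q + q) = q.
Proof. by apply: quat_eqP; split; rewrite /=; lra. Qed.

Lemma evenpart_qseries a q : entire_coef a ->
  evenpart (qseries a) q = qseries (even_coef a) (q ^+ 2).
Proof.
move=> ea; rewrite /evenpart (qseries_even_odd q ea) (qseries_even_odd (- q) ea) sqrrN mulNr addrACA subrr addr0.
exact: half_double.
Qed.

Lemma oddpart_qseries a q : entire_coef a ->
  oddpart (qseries a) q = q * qseries (odd_coef a) (q ^+ 2).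
Proof.
move=> ea; rewrite /oddpart (qseries_even_odd q ea) (qseries_even_odd (- q) ea) sqrrN mulNr opprD opprK addrACA subrr add0r.
exact: half_double.
Qed.

Lemma beta_coef0 alpha : -1 < alpha -> beta_coef alpha 0 = 1.
Proof.
move=> h; rewrite /beta_coef /= expr0 fact0 !mul1r add0r divff// gt_eqF// Gamma_gt0//; lra.
Qed.

Lemma beta_coef_double alpha k : beta_coef alpha k.*2 = moment alpha k.
Proof.
rewrite /beta_coef /moment doubleK /= uphalf_double -muln2 mulnC exprM.
by rewrite (_ : 2 ^+ 2 = 4 :> R) //; ring.
Qed.

(** The factor [2 * (alpha + 1)] of the norm turns the normalisation [Gamma (alpha + 2)] of the odd
    density into [Gamma (alpha + 1)] and supplies the odd power of [2]. *)
Lemma beta_coef_doubleS alpha k : -1 < alpha ->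
  beta_coef alpha k.*2.+1 = 2 * (alpha + 1) * moment (alpha + 1) k.
Proof.
move=> h; have a0 : 0 < alpha + 1 by lra.
rewrite /beta_coef /moment (_ : k.*2.+1./2 = k) /= ?uphalf_double// doubleK.
rewrite exprS -muln2 mulnC exprM (_ : 2 ^+ 2 = 4 :> R); last by ring.
rewrite (GammaS a0) (_ : k.+1%:R + alpha + 1 = k%:R + (alpha + 1) + 1); last by rewrite -natr1; ring.
have g0 : Gamma (alpha + 1) != 0 by rewrite gt_eqF// Gamma_gt0.
by field; rewrite g0 gt_eqF.
Qed.

Lemma momentS alpha k : -1 < alpha -> moment alpha k.+1 = 4 * k.+1%:R * (k%:R + alpha + 1) * moment alpha k.
Proof.
move=> h; have k0 : 0 <= k%:R :> R by [].
rewrite /moment exprS factS natrM (_ : k.+1%:R + alpha + 1 = k%:R + alpha + 1 + 1); last by rewrite -natr1; ring.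
have ka : 0 < k%:R + alpha + 1 by move: k0 h; lra.
by rewrite (GammaS ka); ring.
Qed.

Lemma moment_gt0 alpha k : -1 < alpha -> 0 < moment alpha k.
Proof.
move=> h; have k0 := ler0n R k.
apply: mulr_gt0; first by apply: mulr_gt0; rewrite ?exprn_gt0// ltr0n fact_gt0.
by apply: divr_gt0; apply: Gamma_gt0; lra.
Qed.

Lemma moment_shift alpha k : -1 < alpha ->
  2 * (alpha + 1) * moment (alpha + 1) k = 2 * (k%:R + alpha + 1) * moment alpha k.
Proof.
move=> h; have a0 : 0 < alpha + 1 by lra.
have k0 := ler0n R k; have ka : 0 < k%:R + alpha + 1 by lra.
rewrite /moment (GammaS a0) (addrA k%:R) (GammaS ka).
have g0 : Gamma (alpha + 1) != 0 by rewrite gt_eqF// Gamma_gt0.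
by field; rewrite g0 gt_eqF.
Qed.

(** For odd [n] equality holds. For [n = 2 * k] the ratio is [2 * (k + alpha + 1)], which reaches
    [2 * k + 1] exactly when [alpha] is at least -1/2: this is where the hypothesis enters. *)
Lemma beta_coefS alpha n : - 2^-1 <= alpha -> n.+1%:R * beta_coef alpha n <= beta_coef alpha n.+1.
Proof.
move=> h; have h1 : -1 < alpha by lra.
have := odd_double_half n; set k := n./2; case: (odd n) => /= <-; last first.
  rewrite add0n beta_coef_double beta_coef_doubleS// moment_shift//.
  apply: ler_wpM2r; first exact/ltW/moment_gt0.
  by rewrite -natr1 -muln2 natrM; lra.
rewrite add1n beta_coef_doubleS// moment_shift// -doubleS beta_coef_double momentS//.
rewrite le_eqVlt; apply/orP; left; apply/eqP.
by rewrite -muln2 natrM; ring.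
Qed.

Lemma beta_coef_ge_fact alpha n : - 2^-1 <= alpha -> n`!%:R <= beta_coef alpha n.
Proof.
move=> h; elim: n => [|n ih]; first by rewrite fact0 beta_coef0//; lra.
apply: le_trans (beta_coefS n h); rewrite factS natrM ler_wpM2l//.
Qed.

Lemma ereal_series_lim (u : nat -> R) (l : R) : series u @ \oo --> l ->
  (\sum_(n <oo) (u n)%:E = l%:E)%E.
Proof.
move=> ul; apply/cvg_lim => //.
rewrite (_ : (fun n => _) = (fun n => (series u n)%:E)); last by apply/funext => n; rewrite sumEFin.
by apply/fine_cvgP; split; [exact: nearW|exact: ul].
Qed.

Lemma nneseries_double (u : nat -> \bar R) : (forall n, 0 <= u n)%E ->
  (\sum_(n <oo) u n = \sum_(k <oo) u k.*2 + \sum_(k <oo) u k.*2.+1)%E.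
Proof.
move=> u0.
have cu (w : nat -> \bar R) : (forall n, 0 <= w n)%E ->
    (fun n => (\sum_(0 <= k < n) w k)%R) @ \oo --> (\sum_(k <oo) w k)%E.
  by move=> w0; apply: is_cvg_nneseries.
have h := cvg_double (cu _ u0).
rewrite -(cvg_lim _ h)//; apply/cvg_lim => //.
rewrite (_ : (fun n => _) = (fun n => (\sum_(0 <= k < n) u k.*2)%R + (\sum_(0 <= k < n) u k.*2.+1)%R)%E).
  apply: cvgeD; [|by apply: cu|by apply: cu].
  by apply: ge0_adde_def; rewrite inE; apply: nneseries_ge0.
by apply/funext => n; rewrite sum_double.
Qed.

Variables (alpha : R) (I : quat R).
Hypotheses (halpha : - 2^-1 <= alpha) (hI : unit_sphere I).

Let halpha1 : -1 < alpha. Proof. by move: halpha; lra. Qed.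

Definition fock_norm2 f : \bar R :=
  (int_slice I (fun p => `|evenpart f p| ^+ 2 * density alpha p)%R
     + (2 * (alpha + 1))%:E *
       int_slice I (fun p =>
         `|oddpart f p| ^+ 2 * `|p| ^- 2 * density (alpha + 1) p)%R)%E.

Lemma fock_norm2_qseries a : entire_coef a ->
  fock_norm2 (qseries a) = (\sum_(n <oo) (beta_coef alpha n * `|a n| ^+ 2)%:E)%E.
Proof.
move=> ea; have a0 : 0 < 2 * (alpha + 1) by move: halpha1; lra.
rewrite nneseries_double; last first.
  by move=> n; rewrite lee_fin mulr_ge0 ?exprn_ge0// (le_trans _ (beta_coef_ge_fact n halpha)).
rewrite /fock_norm2; congr (_ + _)%E.
  transitivity (int_slice I (fun p => `|qseries (even_coef a) (p ^+ 2)| ^+ 2 * density alpha p)%R).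
    by rewrite /int_slice; apply: eq_integral => z _; rewrite evenpart_qseries.
  rewrite (slice_sqr_norm (entire_even ea) hI halpha1).
  by apply: eq_eseriesr => k _; rewrite beta_coef_double.
transitivity ((2 * (alpha + 1))%:E * int_slice I (fun p => `|qseries (odd_coef a) (p ^+ 2)| ^+ 2 * density (alpha + 1) p)%R)%E.
  congr (_ * _)%E; rewrite /int_slice; apply: eq_integral => z _.
  rewrite oddpart_qseries// qnormM exprMn; congr EFin.
  (* at [p = 0], where the factor [`|p| ^- 2] is a junk value, the density vanishes *)
  have [->|z0] := eqVneq (slice I z) 0.
    rewrite /density normr0 powR0 ?mul0r ?mulr0//; rewrite gt_eqF//; move: halpha1; lra.
  have n0 : `|slice I z| ^+ 2 != 0 by rewrite expf_neq0// normr_eq0.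
  by congr (_ * _); rewrite mulrC mulKf.
have h2 : -1 < alpha + 1 by move: halpha1; lra.
rewrite (slice_sqr_norm (entire_odd ea) hI h2).
rewrite -nneseriesZl; last first.
  move=> k _; rewrite lee_fin mulr_ge0 ?exprn_ge0// ltW// moment_gt0//; move: halpha1; lra.
apply: eq_eseriesr => k _; rewrite -EFinM; congr EFin.
by rewrite beta_coef_doubleS// mulrA.
Qed.

End EvenOdd.

(** * The Hilbert space *)

Section WeightedProduct.
Context d (T : measurableType d) (R : realType).
Variable mu : {measure set T -> \bar R}.
Implicit Types (F G : T -> quat R) (c : quat R).

Variable w : T -> R.
Hypotheses (mw : measurable_fun setT w) (w0 : forall z, 0 <= w z).

Definition qmeasurable F := [/\ measurable_fun setT (fun z => qre (F z)), measurable_fun setT (fun z => qi (F z)),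
  measurable_fun setT (fun z => qj (F z)) & measurable_fun setT (fun z => qk (F z))].

Definition sqr_integrable F :=
  qmeasurable F /\ (\int[mu]_z (`|F z| ^+ 2 * w z)%:E < +oo)%E.

Definition wprod G F z := w z *: (conjq (G z) * F z).

Lemma sqr_integrable_integrable F : sqr_integrable F ->
  mu.-integrable setT (EFin \o (fun z => `|F z| ^+ 2 * w z)).
Proof.
move=> [[m1 m2 m3 m4] Foo]; apply/integrableP; split.
  apply/measurable_EFinP; apply: measurable_funM => //.
  under eq_fun do rewrite qnorm_sqr.
  by do !apply: measurable_funD; exact: measurable_funX.
by under eq_integral do rewrite gee0_abs ?lee_fin ?mulr_ge0 ?exprn_ge0//.
Qed.

(** The product of the norms is at most the sum of their squares, which gives one majorant for all
    four components. *)
Lemma wprod_integrable G F : sqr_integrable G -> sqr_integrable F -> qintegrable mu setT (wprod G F).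
Proof.
move=> hG hF.
have ib : mu.-integrable setT (EFin \o (fun z => `|G z| ^+ 2 * w z + `|F z| ^+ 2 * w z)).
  exact: (integrableD measurableT (sqr_integrable_integrable hG) (sqr_integrable_integrable hF)).
have [[[a1 a2 a3 a4] _] [[b1 b2 b3 b4] _]] := (hG, hF).
have key (h : quat R -> R) : (forall q, `|h q| <= `|q|) ->
    measurable_fun setT (fun z => h (wprod G F z)) -> mu.-integrable setT (EFin \o (fun z => h (wprod G F z))).
  move=> hn hm; apply: (le_integrable measurableT _ _ ib); first exact/measurable_EFinP.
  move=> z _ /=; rewrite lee_fin; apply: le_trans (hn _) _.
  have s0 : 0 <= `|G z| ^+ 2 * w z + `|F z| ^+ 2 * w z by rewrite addr_ge0// mulr_ge0// exprn_ge0.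
  rewrite ger0_norm// normrZ qnormM qnorm_conj ger0_norm// -mulrDl mulrC ler_wpM2r//.
  have := sqr_ge0 (`|G z| - `|F z|); have := normr_ge0 (G z); have := normr_ge0 (F z); nra.
have M (f g : T -> R) : measurable_fun setT f -> measurable_fun setT g -> measurable_fun setT (fun z => f z * g z).
  exact: measurable_funM.
have D (f g : T -> R) : measurable_fun setT f -> measurable_fun setT g -> measurable_fun setT (fun z => f z + g z).
  exact: measurable_funD.
have N (f : T -> R) : measurable_fun setT f -> measurable_fun setT (fun z => - f z).
  by move=> mf; apply: measurableT_comp.
split; [apply: (key (@qre R) (@normr_qre R))|apply: (key (@qi R) (@normr_qi R))|
  apply: (key (@qj R) (@normr_qj R))|apply: (key (@qk R) (@normr_qk R))].
all: by rewrite /wprod /=; apply: (M _ _) => //;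
  repeat first [assumption|apply: (D _ _)|apply: (N _)|apply: (M _ _)].
Qed.

Definition wip G F := qintegral mu setT (wprod G F).

Lemma wipD G F1 F2 : sqr_integrable G -> sqr_integrable F1 -> sqr_integrable F2 ->
  wip G (fun z => F1 z + F2 z) = wip G F1 + wip G F2.
Proof.
move=> hG h1 h2; rewrite /wip -(qintegralD measurableT); [|exact: wprod_integrable..].
by congr qintegral; apply/funext => z; rewrite /wprod mulrDr scalerDr.
Qed.

Lemma wipMr G F c : sqr_integrable G -> sqr_integrable F ->
  wip G (fun z => F z * c) = wip G F * c.
Proof.
move=> hG hF; rewrite /wip -(qintegralMr measurableT); last exact: wprod_integrable.
by congr qintegral; apply/funext => z; rewrite /wprod mulrA scalerAl.
Qed.

Lemma wip_conj G F : sqr_integrable G -> sqr_integrable F -> conjq (wip G F) = wip F G.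
Proof.
move=> hG hF; rewrite /wip (qintegral_conj measurableT); last exact: wprod_integrable.
by congr qintegral; apply/funext => z; rewrite /wprod conjqZ conjqM conjqK.
Qed.

Lemma qre_wip F : qre (wip F F) = fine (\int[mu]_z (`|F z| ^+ 2 * w z)%:E).
Proof.
transitivity (\int[mu]_z qre (wprod F F z)) => //; rewrite /Rintegral; congr fine.
apply: eq_integral => z _.
by rewrite [wprod _ _ _]/wprod mul_conjq mulrC /= mulr1.
Qed.

End WeightedProduct.

Lemma quat_cauchy_cvg (R : realType) (u : nat -> quat R) :
  (forall e : R, 0 < e -> exists N, forall m n, (N <= m)%N -> (N <= n)%N -> `|u m - u n| <= e) ->
  cvgn u.
Proof.
move=> H.
have key (h : quat R -> R) : (forall p q, h (p - q) = h p - h q) ->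
    (forall q, `|h q| <= `|q|) -> cvgn (fun n => h (u n)).
  move=> hB hle; apply/cauchy_cvgP/cauchy_exP => e e0.
  have [|N HN] := H (e / 2); first by rewrite divr_gt0.
  exists (h (u N)), N => // n /= Nn; rewrite /ball /= -hB (le_lt_trans (hle _))//.
  by rewrite (le_lt_trans (HN _ _ _ Nn))//; lra.
apply/cvg_ex; exists (Quat (limn (fun n => qre (u n))) (limn (fun n => qi (u n)))
  (limn (fun n => qj (u n))) (limn (fun n => qk (u n)))).
by apply: cvg_quat; apply: key => //;
  [exact: normr_qre|exact: normr_qi|exact: normr_qj|exact: normr_qk].
Qed.

(** * The Fock space as a weighted l2 space of coefficients *)

Section FockSpace.
Context {R : realType}.
Variables (alpha : R) (I : quat R).
Hypotheses (halpha : - 2^-1 <= alpha) (hI : unit_sphere I).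
Local Notation RR := (measurableTypeR R * measurableTypeR R)%type.
Local Notation V := (sliceFock alpha I).
Local Notation ip := (sliceFock_ip alpha I).
Local Notation beta := (beta_coef alpha).
Implicit Types (a b : nat -> quat R) (f g : quat R -> quat R) (c p q : quat R).

Let halpha1 : -1 < alpha. Proof. by move: halpha; lra. Qed.
Let halpha2 : -1 < alpha + 1. Proof. by move: halpha1; lra. Qed.
Let alpha_gt0 : 0 < 2 * (alpha + 1). Proof. by move: halpha1; lra. Qed.

Definition l2 a := cvgn (series (fun n => beta n * `|a n| ^+ 2)).

Lemma beta_gt0 n : 0 < beta n.
Proof. by rewrite (lt_le_trans _ (beta_coef_ge_fact n halpha))// ltr0n fact_gt0. Qed.

Let weight_ge0 n a : 0 <= beta n * `|a n| ^+ 2.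
Proof. by rewrite mulr_ge0 ?exprn_ge0// ltW// beta_gt0. Qed.

Lemma l2D a b : l2 a -> l2 b -> l2 (fun n => a n + b n).
Proof.
move=> la lb; have c : cvgn (series (fun n => 2 * (beta n * `|a n| ^+ 2) + 2 * (beta n * `|b n| ^+ 2))).
  rewrite (_ : series _ = series (fun n => 2 * (beta n * `|a n| ^+ 2)) \+ series (fun n => 2 * (beta n * `|b n| ^+ 2))).
    by apply: is_cvgD; apply/cvg_ex; eexists; apply: rsumZ.
  by apply/funext => n; rewrite /series /= big_split.
apply: series_le_cvg c => n.
- exact: (weight_ge0 n (fun n => a n + b n)).
- by rewrite addr_ge0// mulr_ge0.
- rewrite !(mulrCA 2) -mulrDr; apply: ler_wpM2l; first exact/ltW/beta_gt0.
  have := ler_normD (a n) (b n); have := sqr_ge0 (`|a n| - `|b n|).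
  have := normr_ge0 (a n + b n); nra.
Qed.

Lemma l2Mr a c : l2 a -> l2 (fun n => a n * c).
Proof.
move=> la; rewrite /l2 (_ : (fun n => _) = (fun n => `|c| ^+ 2 * (beta n * `|a n| ^+ 2))).
  by apply/cvg_ex; eexists; apply: rsumZ.
by apply/funext => n; rewrite qnormM exprMn; ring.
Qed.

Lemma exp_series_le (x : R) : 0 <= x -> cvgn (series (fun n => x ^+ n / beta n)).
Proof.
move=> x0; apply: series_le_cvg (is_cvg_series_exp_coeff x) => n; rewrite /exp_coeff /=.
- by rewrite divr_ge0 ?exprn_ge0// ltW// beta_gt0.
- by rewrite divr_ge0 ?exprn_ge0.
- by rewrite ler_wpM2l ?exprn_ge0// lef_pV2 ?posrE ?beta_gt0 ?ltr0n ?fact_gt0// beta_coef_ge_fact.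
Qed.

(** The difference of the two sides is [s / (2 * B)] times a square. The free weight [s] lets this
    stand in for the Cauchy-Schwarz inequality for series. *)
Lemma young (x y s B : R) : 0 < B -> 0 < s -> 0 <= x -> 0 <= y ->
  x * y <= 2^-1 * (s * (x ^+ 2 / B)) + 2^-1 * (s^-1 * (B * y ^+ 2)).
Proof.
move=> B0 s0 x0 y0; rewrite -subr_ge0.
rewrite (_ : _ - _ = 2^-1 * (s / B) * (x - B / s * y) ^+ 2).
  by rewrite mulr_ge0 ?sqr_ge0// mulr_ge0// divr_ge0// ltW.
by field; rewrite !gt_eqF.
Qed.

Lemma l2_entire a : l2 a -> entire_coef a.
Proof.
move=> la r r0.
have c : cvgn (series (fun n => 2^-1 * ((r ^+ 2) ^+ n / beta n) + 2^-1 * (beta n * `|a n| ^+ 2))).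
  rewrite (_ : series _ = series (fun n => 2^-1 * ((r ^+ 2) ^+ n / beta n)) \+ series (fun n => 2^-1 * (beta n * `|a n| ^+ 2))).
    by apply: is_cvgD; apply/cvg_ex; eexists; apply: rsumZ => //; apply: exp_series_le; rewrite sqr_ge0.
  by apply/funext => n; rewrite /series /= big_split.
apply: series_le_cvg c => n.
- by rewrite mulr_ge0 ?exprn_ge0.
- by rewrite addr_ge0// mulr_ge0// divr_ge0 ?exprn_ge0 ?sqr_ge0// ltW// beta_gt0.
- have := @young (r ^+ n) `|a n| 1 (beta n) (beta_gt0 n) ltr01 (exprn_ge0 n r0) (normr_ge0 _).
  by rewrite invr1 !mul1r exprAC.
Qed.

Lemma qseries_bound a q (s : R) : l2 a -> 0 < s ->
  `|qseries a q| <= 2^-1 * (s * limn (series (fun n => (`|q| ^+ 2) ^+ n / beta n))) +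
    2^-1 * (s^-1 * limn (series (fun n => beta n * `|a n| ^+ 2))).
Proof.
move=> la s0; have ce := exp_series_le (sqr_ge0 `|q|).
have c : series (fun n => 2^-1 * (s * ((`|q| ^+ 2) ^+ n / beta n)) + 2^-1 * (s^-1 * (beta n * `|a n| ^+ 2))) @ \oo -->
    2^-1 * (s * limn (series (fun n => (`|q| ^+ 2) ^+ n / beta n))) +
    2^-1 * (s^-1 * limn (series (fun n => beta n * `|a n| ^+ 2))).
  rewrite (_ : series _ = series (fun n => (2^-1 * s) * ((`|q| ^+ 2) ^+ n / beta n)) \+
      series (fun n => (2^-1 * s^-1) * (beta n * `|a n| ^+ 2))).
    by rewrite !mulrA; apply: cvgD; apply: rsumZ.
  by apply/funext => n; rewrite /series /= big_split /=; congr (_ + _); apply: eq_bigr => i _; rewrite mulrA.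
apply: (qsum_norm_le (u := fun n => q ^+ n * a n) _ _ c); last exact/qseries_cvg/l2_entire.
move=> n.
rewrite qnormM qnormX exprAC.
exact: (@young (`|q| ^+ n) `|a n| s (beta n) (beta_gt0 n) s0 (exprn_ge0 n (normr_ge0 _)) (normr_ge0 _)).
Qed.

(** The expansion of regular functions combined with the norm identity [fock_norm2_qseries]; it lets
    the Hilbert space axioms be checked on coefficients. *)
Lemma fockP f : V f <-> exists2 a, l2 a & f = qseries a.
Proof.
split=> [[fr foo]|[a la ->]].
  have [a ea fa] := regular_qseries fr; exists a => //.
  move: foo; rewrite -/(fock_norm2 alpha I f) fa fock_norm2_qseries// => foo.
  apply: nondecreasing_is_cvgn.
    by apply/nondecreasing_seqP => n; rewrite -subr_ge0 /series /= big_nat_recr//= addrAC subrr add0r.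
  exists (fine (\sum_(n <oo) (beta n * `|a n| ^+ 2)%:E)) => _ [n _ <-].
  have u0 k : (0 <= (beta k * `|a k| ^+ 2)%:E)%E by rewrite lee_fin.
  rewrite -lee_fin fineK ?ge0_fin_numE ?nneseries_ge0//.
  rewrite /series /= -sumEFin; apply: nneseries_lim_ge => k _ _; exact: u0.
have ea := l2_entire la; split; first exact: qseries_regular.
rewrite -[X in (X < _)%E]/(fock_norm2 alpha I (qseries a)) fock_norm2_qseries//.
by rewrite (ereal_series_lim la) ltry.
Qed.

Let w1 (z : RR) := density alpha (slice I z).
Let w2 (z : RR) := `|slice I z| ^- 2 * density (alpha + 1) (slice I z).
Let E f (z : RR) := evenpart f (slice I z).
Let O f (z : RR) := oddpart f (slice I z).

Let w1_measurable : measurable_fun setT w1.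
Proof. exact: density_slice_measurable. Qed.

Let w2_measurable : measurable_fun setT w2.
Proof.
apply: measurable_funM; last exact: density_slice_measurable.
have h : measurable_fun (setT : set RR) (fun z : RR => `|slice I z|).
  exact: continuous2_measurable (@continuous_slice_norm _ I).
rewrite (_ : (fun z => _) = (fun z : RR => `|slice I z| `^ (- 2%:R))); last first.
  by apply/funext => z; rewrite powR_invn.
exact: (measurableT_comp (@measurable_powR R (- 2%:R)) h).
Qed.

Let w1_ge0 z : 0 <= w1 z.
Proof. by rewrite /w1 densityE rdensity_ge0. Qed.

Let w2_ge0 z : 0 <= w2 z.
Proof. by rewrite /w2 densityE mulr_ge0 ?rdensity_ge0// invr_ge0 exprn_ge0. Qed.

Lemma ipE f g : ip f g = wip leb2 w1 (E g) (E f) + (2 * (alpha + 1)) *: wip leb2 w2 (O g) (O f).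
Proof. by []. Qed.

Lemma continuous_qmeasurable (F : R * R -> quat R) : continuous F -> qmeasurable (F : RR -> quat R).
Proof.
move=> cF; split; apply: continuous2_measurable => z; (apply: continuous_comp; first exact: cF).
- exact: qre_continuous.
- exact: qi_continuous.
- exact: qj_continuous.
- exact: qk_continuous.
Qed.

Lemma fock_sqr_integrable f : V f -> sqr_integrable leb2 w1 (E f) /\ sqr_integrable leb2 w2 (O f).
Proof.
move=> Vf; have [a la fa] := (fockP f).1 Vf.
have cf : continuous f by rewrite fa; exact/qseries_continuous/l2_entire.
have c1 : continuous (fun z : R * R => f (slice I z)).
  by move=> z; apply: continuous_comp; [exact: slice_continuous|exact: cf].
have c2 : continuous (fun z : R * R => f (- slice I z)).
  move=> z; apply: (@continuous_comp _ _ _ (fun z => - slice I z) f); last exact: cf.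
  by apply: cvgN; exact: slice_continuous.
have cE : continuous (fun z : R * R => evenpart f (slice I z)).
  by move=> z; apply: cvgZl_tmp; exact: (cvgD (c1 z) (c2 z)).
have cO : continuous (fun z : R * R => oddpart f (slice I z)).
  by move=> z; apply: cvgZl_tmp; exact: (cvgB (c1 z) (c2 z)).
have [_ foo] := Vf; move: foo; set A := int_slice _ _; set B := int_slice _ _ => foo.
have A0 : (0 <= A)%E by apply: integral_ge0 => z _; rewrite lee_fin mulr_ge0 ?exprn_ge0// w1_ge0.
have B0 : (0 <= B)%E.
  apply: integral_ge0 => z _; rewrite lee_fin -mulrA mulr_ge0 ?exprn_ge0//; exact: w2_ge0.
split; split; try exact: continuous_qmeasurable.
- by rewrite -[X in (X < _)%E]/A (le_lt_trans _ foo)// leeDl// mule_ge0// lee_fin ltW.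
- under eq_integral do rewrite mulrA.
  rewrite -[X in (X < _)%E]/B; have : ((2 * (alpha + 1))%:E * B < +oo)%E.
    by apply: le_lt_trans foo; rewrite -[X in (X <= _)%E]add0e; exact: (leeD A0 (lexx _)).
  by move: B0; case: (B) => [r _ _|_|//]; rewrite ?ltry// gt0_muley ?lte_fin.
Qed.

Lemma ipD f g h : V f -> V g -> V h -> ip (f \+ g) h = ip f h + ip g h.
Proof.
move=> /fock_sqr_integrable[f1 f2] /fock_sqr_integrable[g1 g2] /fock_sqr_integrable[h1 h2].
rewrite !ipE.
have -> : E (f \+ g) = (fun z => E f z + E g z).
  by apply/funext => z; rewrite /E /evenpart /= -scalerDr addrACA.
have -> : O (f \+ g) = (fun z => O f z + O g z).
  by apply/funext => z; rewrite /O /oddpart /= -scalerDr opprD addrACA.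
by rewrite (wipD w1_measurable w1_ge0 h1 f1 g1) (wipD w2_measurable w2_ge0 h2 f2 g2) scalerDr addrACA.
Qed.

Lemma ipMr f g c : V f -> V g -> ip (fun q => f q * c) g = ip f g * c.
Proof.
move=> /fock_sqr_integrable[f1 f2] /fock_sqr_integrable[g1 g2]; rewrite !ipE.
have -> : E (fun q => f q * c) = (fun z => E f z * c).
  by apply/funext => z; rewrite /E /evenpart /= -scalerAl mulrDl.
have -> : O (fun q => f q * c) = (fun z => O f z * c).
  by apply/funext => z; rewrite /O /oddpart /= -scalerAl mulrBl.
by rewrite (wipMr w1_measurable w1_ge0 _ g1 f1) (wipMr w2_measurable w2_ge0 _ g2 f2) scalerAl -mulrDl.
Qed.

Lemma ip_conjE f g : V f -> V g -> conjq (ip f g) = ip g f.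
Proof.
move=> /fock_sqr_integrable[f1 f2] /fock_sqr_integrable[g1 g2]; rewrite !ipE.
by rewrite conjqD conjqZ (wip_conj w1_measurable w1_ge0 g1 f1) (wip_conj w2_measurable w2_ge0 g2 f2).
Qed.

(** For an element of the space both integrals are finite, so [fine] respects the sum in
    [fock_norm2_qseries]. *)
Lemma qre_ip a : l2 a -> qre (ip (qseries a) (qseries a)) = limn (series (fun n => beta n * `|a n| ^+ 2)).
Proof.
move=> la; have Vf : V (qseries a) by apply/fockP; exists a.
have [[_ f1] [_ f2]] := fock_sqr_integrable Vf.
transitivity (qre (wip leb2 w1 (E (qseries a)) (E (qseries a))) +
  2 * (alpha + 1) * qre (wip leb2 w2 (O (qseries a)) (O (qseries a)))) => //.
rewrite !qre_wip.
have := fock_norm2_qseries halpha hI (l2_entire la); rewrite (ereal_series_lim la).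
pose A : \bar R := (\int[leb2]_z (`|E (qseries a) z| ^+ 2 * w1 z)%:E)%E.
pose B : \bar R := (\int[leb2]_z (`|O (qseries a) z| ^+ 2 * w2 z)%:E)%E.
have A0 : A \is a fin_num.
  by rewrite ge0_fin_numE//; apply: integral_ge0 => z _; rewrite lee_fin mulr_ge0 ?exprn_ge0.
have B0 : B \is a fin_num.
  by rewrite ge0_fin_numE//; apply: integral_ge0 => z _; rewrite lee_fin mulr_ge0 ?exprn_ge0.
rewrite (_ : fock_norm2 _ _ _ = A + (2 * (alpha + 1))%:E * B)%E; last first.
  rewrite /fock_norm2 -[X in (X + _)%E]/A; congr (_ + _ * _)%E.
  by rewrite /int_slice /B; apply: eq_integral => z _; congr EFin; rewrite [RHS]mulrA.
by rewrite -/A -/B -(fineK A0) -(fineK B0) -EFinM -EFinD => -[].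
Qed.

Lemma qseriesDE a b : l2 a -> l2 b ->
  qseries (fun n => a n + b n) = qseries a \+ qseries b.
Proof. by move=> la lb; apply/funext => q; rewrite qseriesD//; exact: l2_entire. Qed.

Lemma qseriesMrE a c : l2 a -> qseries (fun n => a n * c) = (fun q => qseries a q * c).
Proof. by move=> la; apply/funext => q; rewrite qseriesMr//; exact: l2_entire. Qed.

Lemma l2_fock a : l2 a -> V (qseries a).
Proof. by move=> la; apply/fockP; exists a. Qed.

(** Testing with the four basis units recovers the components. Together with right linearity this
    lifts identities of real parts to the whole inner product. *)
Lemma qre_mulr_inj p q : (forall c, qre (p * c) = qre (q * c)) -> p = q.
Proof.
move=> h; apply: quat_eqP; split.
- by have := h 1; rewrite !mulr1.
- by have := h (Quat 0 1 0 0); rewrite !mulqE /Defs.mulq /=; lra.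
- by have := h (Quat 0 0 1 0); rewrite !mulqE /Defs.mulq /=; lra.
- by have := h (Quat 0 0 0 1); rewrite !mulqE /Defs.mulq /=; lra.
Qed.

(* by polarization of [qre_ip] *)
Lemma qre_ip_series a b : l2 a -> l2 b ->
  series (fun n => beta n * qre (conjq (b n) * a n)) @ \oo --> qre (ip (qseries a) (qseries b)).
Proof.
move=> la lb; have lab := l2D la lb; have Va := l2_fock la; have Vb := l2_fock lb.
have Vab := l2_fock lab.
have E1 : qre (ip (qseries a) (qseries b)) = 2^-1 * (limn (series (fun n => beta n * `|a n + b n| ^+ 2))
    - limn (series (fun n => beta n * `|a n| ^+ 2)) - limn (series (fun n => beta n * `|b n| ^+ 2))).
  rewrite -(qre_ip lab) -(qre_ip la) -(qre_ip lb); move: Vab; rewrite qseriesDE// => Vab.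
  rewrite (ipD Va Vb Vab) -(ip_conjE Vab Va) -(ip_conjE Vab Vb) (ipD Va Vb Va) (ipD Va Vb Vb) -(ip_conjE Va Vb).
  move: (ip (qseries a) (qseries a)) (ip (qseries b) (qseries b)) (ip (qseries a) (qseries b)) => x z y.
  by rewrite /=; field.
rewrite E1 (_ : series _ = (fun n => 2^-1 * (series (fun n => beta n * `|a n + b n| ^+ 2) n
    - series (fun n => beta n * `|a n| ^+ 2) n - series (fun n => beta n * `|b n| ^+ 2) n))); last first.
  apply/funext => n; rewrite /series /= -!sumrB mulr_sumr; apply: eq_bigr => k _.
  by rewrite !qnorm_sqr /=; field.
by apply: cvgM; [exact: cvg_cst|apply: cvgB => //; apply: cvgB].
Qed.

(** The identity of real parts is applied to the coefficients [a n * c] for every [c]. *)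
Lemma ip_series a b : l2 a -> l2 b ->
  series (fun n => beta n *: (conjq (b n) * a n)) @ \oo --> ip (qseries a) (qseries b).
Proof.
move=> la lb.
have cs : cvgn (series (fun n => beta n *: (conjq (b n) * a n))).
  have c : cvgn (series (fun n => beta n * `|a n| ^+ 2 + beta n * `|b n| ^+ 2)).
    rewrite (_ : series _ = series (fun n => beta n * `|a n| ^+ 2) \+ series (fun n => beta n * `|b n| ^+ 2)).
      exact: is_cvgD.
    by apply/funext => n; rewrite /series /= big_split.
  apply: quat_normed_cvg; apply: series_le_cvg c => n //.
  - by rewrite addr_ge0.
  - rewrite normrZ qnormM qnorm_conj gtr0_norm ?beta_gt0// -mulrDr.
    apply: ler_wpM2l; first exact/ltW/beta_gt0.
    have := sqr_ge0 (`|a n| - `|b n|); have := normr_ge0 (a n); have := normr_ge0 (b n); nra.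
suff <- : limn (series (fun n => beta n *: (conjq (b n) * a n))) = ip (qseries a) (qseries b) by [].
apply: qre_mulr_inj => c.
have h1 := qsumMr (c := c) (cs : series _ @ \oo --> _).
have [h2 _ _ _] := cvg_comps h1.
have h3 := qre_ip_series (l2Mr (c := c) la) lb.
rewrite qseriesMrE// (ipMr _ (l2_fock la) (l2_fock lb)) in h3.
rewrite -(cvg_lim _ h3)// -(cvg_lim _ h2)//; congr (limn _); apply/funext => n.
rewrite /series /= (big_morph (@qre R) (id1 := 0) (op1 := +%R))//.
by apply: eq_bigr => k _ /=; ring.
Qed.

Lemma qseriesBE a b : l2 a -> l2 b ->
  l2 (fun n => a n - b n) /\ qseries a \- qseries b = qseries (fun n => a n - b n).
Proof.
move=> la lb.
have -> : (fun n => a n - b n) = (fun n => a n + b n * -1).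
  by apply/funext => n; rewrite mulrN1.
split; first exact/l2D/l2Mr.
rewrite qseriesDE// ?qseriesMrE//; last exact: l2Mr.
by apply/funext => q; rewrite /= mulrN1.
Qed.

Lemma ip_normE a : l2 a -> ip_norm ip (qseries a) = Num.sqrt (limn (series (fun n => beta n * `|a n| ^+ 2))).
Proof. by move=> la; rewrite /ip_norm qre_ip. Qed.

Lemma series_weight_ge0 a : l2 a -> 0 <= limn (series (fun n => beta n * `|a n| ^+ 2)).
Proof.
by move=> la; apply: limr_ge => //; near=> n; rewrite /series /=; apply: sumr_ge0.
Unshelve. all: by end_near. Qed.

Lemma series_weight_le a n : l2 a ->
  \sum_(0 <= k < n) beta k * `|a k| ^+ 2 <= limn (series (fun n => beta n * `|a n| ^+ 2)).
Proof.
move=> la; apply: (nondecreasing_cvgn_le _ la n).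
by apply/nondecreasing_seqP => m; rewrite -subr_ge0 /series /= big_nat_recr//= addrAC subrr add0r.
Qed.

Lemma l2_bounded a (M : R) : (forall n, \sum_(0 <= k < n) beta k * `|a k| ^+ 2 <= M) ->
  l2 a /\ limn (series (fun n => beta n * `|a n| ^+ 2)) <= M.
Proof.
move=> h; have la : l2 a.
  apply: nondecreasing_is_cvgn; last by exists M => _ [n _ <-]; exact: h.
  by apply/nondecreasing_seqP => m; rewrite -subr_ge0 /series /= big_nat_recr//= addrAC subrr add0r.
by split => //; apply: limr_le => //; near=> n; exact: h.
Unshelve. all: by end_near. Qed.

Definition kernel_coef q n : quat R := (beta n)^-1 *: conjq (q ^+ n).

Lemma kernel_coef_l2 q : l2 (kernel_coef q).
Proof.
rewrite /l2 (_ : (fun n => _) = (fun n => (`|q| ^+ 2) ^+ n / beta n)).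
  by apply: exp_series_le; rewrite sqr_ge0.
apply/funext => n; rewrite /kernel_coef normrZ qnorm_conj qnormX gtr0_norm ?invr_gt0 ?beta_gt0//.
by rewrite exprMn exprAC; have := beta_gt0 n => b0; field; rewrite gt_eqF.
Qed.

Lemma kernel_termE p q n : kernel_term alpha p q n = p ^+ n * kernel_coef q n.
Proof. by rewrite /kernel_term /kernel_coef -scalerAr. Qed.

Lemma fock_kernelE q : fock_kernel alpha ^~ q = qseries (kernel_coef q).
Proof.
apply/funext => p; rewrite /fock_kernel /qseries; congr (limn (series _)).
by apply/funext => n; rewrite kernel_termE.
Qed.

(** In [ip_series] the weight [beta n] cancels against the kernel coefficient, leaving the power
    series of [f] at [q]. *)
Lemma fock_reproducing : reproducing_kernel V ip (fock_kernel alpha).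
Proof.
move=> q; rewrite fock_kernelE; split; first exact/l2_fock/kernel_coef_l2.
move=> f /fockP[a la ->].
rewrite -(cvg_lim _ (ip_series la (@kernel_coef_l2 q)))//; congr (limn (series _)).
apply/funext => n; rewrite /kernel_coef conjqZ conjqK -scalerAl scalerA divff ?scale1r//.
by rewrite gt_eqF// beta_gt0.
Qed.

Lemma kernel_series_cvg p q : cvgn (series (kernel_term alpha p q)).
Proof.
rewrite (_ : kernel_term alpha p q = fun n => p ^+ n * kernel_coef q n); last first.
  by apply/funext => n; exact: kernel_termE.
by apply/cvg_ex; exists (qseries (kernel_coef q) p); exact/qseries_cvg/l2_entire/kernel_coef_l2.
Qed.

Lemma fock_continuous_evaluations : continuous_evaluations V ip.
Proof.
move=> q f /fockP[a la ->] e e0.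
pose C := limn (series (fun n => (`|q| ^+ 2) ^+ n / beta n)).
have C0 : 0 <= C.
  apply: limr_ge; first by apply: exp_series_le; rewrite sqr_ge0.
  near=> n; rewrite /series /=; apply: sumr_ge0 => i _.
  by rewrite divr_ge0 ?exprn_ge0 ?sqr_ge0// ltW// beta_gt0.
(* With this [s] and the distance [Num.sqrt (s * e)], both terms of [qseries_bound] are at most
   [e / 2], the second one strictly; [C + 1] is used as a denominator that is visibly positive. *)
pose s := e / (C + 1).
have C1 : 0 < C + 1 by lra.
have s0 : 0 < s by rewrite divr_gt0.
exists (Num.sqrt (s * e)); first by rewrite sqrtr_gt0 mulr_gt0.
move=> _ /fockP[b lb ->]; have [lab ->] := qseriesBE lb la.
have se0 : 0 < s * e by exact: mulr_gt0.
rewrite ip_normE// ltr_sqrt// => h.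
have <- : qseries (fun n => b n - a n) q = qseries b q - qseries a q.
  by have [_ <-] := qseriesBE lb la.
apply: le_lt_trans (qseries_bound q lab s0) _; rewrite -/C.
have h1 : s * C <= e.
  by rewrite /s mulrAC ler_pdivrMr// ler_wpM2l ?ltW// ltrDl.
have h2 : s^-1 * limn (series (fun n => beta n * `|b n - a n| ^+ 2)) < e.
  by rewrite mulrC ltr_pdivrMr// mulrC.
lra.
Unshelve. all: by end_near. Qed.

(** Coefficients converge one at a time because [beta k] is positive. The Cauchy bounds are stated
    for finite sums, where the coefficientwise limit can be taken, and [l2_bounded] returns to the
    infinite sum. *)
Lemma fock_complete (u : nat -> quat R -> quat R) : (forall n, V (u n)) ->
  (forall e : R, 0 < e -> exists N, forall m n, (N <= m)%N -> (N <= n)%N ->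
      ip_norm ip (u m \- u n) < e) ->
  exists2 f, V f & (fun n => ip_norm ip (u n \- f)) @ \oo --> (0 : R).
Proof.
move=> Vu cu.
have /choice[A HA] : forall n, exists a, l2 a /\ u n = qseries a.
  by move=> n; have [a la ua] := (fockP _).1 (Vu n); exists a.
have lA n : l2 (A n) by case: (HA n).
have uA n : u n = qseries (A n) by case: (HA n).
have cA (e : R) : 0 < e -> exists N, forall m n K, (N <= m)%N -> (N <= n)%N ->
    \sum_(0 <= k < K) beta k * `|A m k - A n k| ^+ 2 <= e ^+ 2.
  move=> e0; have [N HN] := cu e e0; exists N => m n K Nm Nn.
  have := HN m n Nm Nn; rewrite !uA; have [lmn ->] := qseriesBE (lA m) (lA n).
  rewrite ip_normE// => h; apply: le_trans (series_weight_le K lmn) _.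
  rewrite -[leLHS]sqr_sqrtr ?series_weight_ge0// lerXn2r ?nnegrE ?sqrtr_ge0 ?ltW//.
have cvA k : cvgn (fun n => A n k).
  apply: quat_cauchy_cvg => e e0; have b0 := beta_gt0 k.
  (* The factor [Num.sqrt (beta k)] cancels the weight of the [k]-th term. *)
  have [|N HN] := cA (e * Num.sqrt (beta k)); first by rewrite mulr_gt0// sqrtr_gt0.
  exists N => m n Nm Nn; have := HN m n k.+1 Nm Nn.
  rewrite big_nat_recr//= exprMn (sqr_sqrtr (ltW b0)) => h.
  have h2 : beta k * `|A m k - A n k| ^+ 2 <= beta k * e ^+ 2.
    rewrite [leRHS]mulrC; apply: le_trans h; rewrite lerDr sumr_ge0// => i _.
    exact: (weight_ge0 i (fun i => A m i - A n i)).
  by move: h2; rewrite ler_pM2l// ler_sqr ?nnegrE// ltW.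
pose a k := limn (fun n => A n k).
have key (e : R) : 0 < e -> exists N, forall m, (N <= m)%N ->
    l2 (fun k => A m k - a k) /\ limn (series (fun k => beta k * `|A m k - a k| ^+ 2)) <= e ^+ 2.
  move=> e0; have [N HN] := cA e e0; exists N => m Nm; apply: l2_bounded => K.
  have h : (fun n => \sum_(0 <= k < K) beta k * `|A m k - A n k| ^+ 2) @ \oo -->
      \sum_(0 <= k < K) beta k * `|A m k - a k| ^+ 2.
    have t k : (fun n => beta k * `|A m k - A n k| ^+ 2) @ \oo --> beta k * `|A m k - a k| ^+ 2.
      have hk : (fun n => `|A m k - A n k|) @ \oo --> `|A m k - a k|.
        by apply: cvg_norm; apply: cvgB; [exact: cvg_cst|exact: cvA].
      by apply: cvgM; [exact: cvg_cst|exact: (cvgM hk hk)].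
    elim: K => [|K ih].
      by under eq_fun do rewrite big_geq//; rewrite big_geq//; exact: cvg_cst.
    rewrite big_nat_recr//=; under eq_fun do rewrite big_nat_recr//=.
    exact: (cvgD ih (t K)).
  rewrite -(cvg_lim _ h)//; apply: limr_le; first by apply/cvg_ex; eexists; exact: h.
  by near=> n; apply: HN => //; near: n; exact: nbhs_infty_ge.
(* [a] is the difference of the sequences [A N] and [A N - a], both in [l2]. *)
have la : l2 a.
  have [N HN] := key 1 ltr01; have [l1 _] := HN N (leqnn N).
  have := (qseriesBE (lA N) l1).1.
  by congr l2; apply/funext => k; rewrite opprB addrC subrK.
exists (qseries a); first exact: l2_fock.
apply/cvgrPdist_le => e e0; have [N HN] := key e e0; near=> m.
have [lm hm] : l2 (fun k => A m k - a k) /\ limn (series (fun k => beta k * `|A m k - a k| ^+ 2)) <= e ^+ 2.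
  by apply: HN; near: m; exact: nbhs_infty_ge.
rewrite sub0r normrN uA; have [_ ->] := qseriesBE (lA m) la.
rewrite ip_normE// ger0_norm ?sqrtr_ge0//.
by rewrite -[leRHS](gtr0_norm e0) -(sqrtr_sqr e); exact: ler_wsqrtr.
Unshelve. all: by end_near. Qed.

Lemma fock_rkhs : quaternionic_rkhs V ip.
Proof.
split; last exact: fock_continuous_evaluations.
split.
(* The zero sequence, written as a multiple of a known element so that [l2Mr] applies. *)
- apply/fockP; exists (fun n => kernel_coef 0 n * 0); first exact/l2Mr/kernel_coef_l2.
  by rewrite qseriesMrE; [apply/funext => q; rewrite mulr0|exact: kernel_coef_l2].
- move=> f g /fockP[a la ->] /fockP[b lb ->]; rewrite -qseriesDE//; exact/l2_fock/l2D.
- move=> f c /fockP[a la ->]; rewrite -qseriesMrE//; exact/l2_fock/l2Mr.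
- exact: ipD.
- move=> f g c; exact: ipMr.
- exact: ip_conjE.
- by move=> f /fockP[a la ->]; rewrite qre_ip// series_weight_ge0.
- move=> f /fockP[a la ->] /(congr1 (@qre R)); rewrite qre_ip//= => h q.
  have a0 n : a n = 0.
    have := series_weight_le n.+1 la; rewrite h big_nat_recr//= => h1.
    have h2 : beta n * `|a n| ^+ 2 <= 0.
      by apply: le_trans h1; rewrite lerDr sumr_ge0.
    apply/eqP; rewrite -normr_eq0 -sqrf_eq0; apply/eqP/le_anti; rewrite exprn_ge0// andbT.
    by move: h2; rewrite pmulr_rle0// beta_gt0.
  have -> : a = (fun n => a n * 0) by apply/funext => n; rewrite a0 mulr0.
  by rewrite qseriesMrE// mulr0.
- exact: fock_complete.
Qed.

End FockSpace.

Unset Implicit Arguments.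

(** The second conjunct guarantees that the [limn] defining [fock_kernel] is the sum of a convergent
    series and not a default value. *)
Theorem theorem3p14 (R : realType) (alpha : R) (I : quat R)
    (halpha : - 2^-1 <= alpha) (hI : unit_sphere I) :
  quaternionic_rkhs (sliceFock alpha I) (sliceFock_ip alpha I) /\
  (forall p q : quat R, cvgn (series (kernel_term alpha p q))) /\
  reproducing_kernel (sliceFock alpha I) (sliceFock_ip alpha I)
    (fock_kernel alpha).
Proof.
split; first exact: fock_rkhs.
split; first exact: kernel_series_cvg.
exact: fock_reproducing.
Qed.
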